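(* Let $d\ge3$, $\mu\ge-1$, $\theta\in\mathbb{R}$. Let $H_0:\mathbb{Z}^d\to\mathbb{R}$ satisfy $0\le H_0\le\overline{H}_0$ in $\mathbb{Z}^d$ and, for some $\varepsilon_0\in(0,1)$, $\limsup_{|x|\to+\infty}\frac{(\overline{H}_0(x)-H_0(x))|x|^{\varepsilon_0}}{\overline{H}_0(x)}\in[0,+\infty)$. Let $W:\mathbb{Z}^d\to[0,+\infty)$ satisfy $\liminf_{|x|\to+\infty}W(x)|x|^{-\theta}>0$. Consider the problem $$\mathcal{L}_\mu u\ge Wu^p\ \text{ in }\mathbb{Z}^d,\qquad u\gneqq0\ \text{ in }\mathbb{Z}^d.\qquad(S)$$ Let $w_\infty=\liminf_{|x|\to+\infty}\frac{W(x)}{H_0(x)}$. (i) If $\mu=-1$, $\theta>\tau_--2$ and $p\in(0,p^*_{\mu,\theta}]$, then (S) has no solution. (ii) If $\mu\in(-1,0)$ and one of the following holds: (a) $\theta>-2$ and $p\in(0,p^*_{\mu,\theta}]$; (b) $\theta=-2$, and either $p\in(0,1)$, or $p=1$ and $w_\infty>\mu+1$; (c) $\tau_+-2<\theta<-2$ and $p\in(0,p^\#_{\mu,\theta})$, then (S) has no solution. (iii) If $\mu\in[0,+\infty)$ and one of the following holds: (d) $\theta>-2$ and $p\in\big(\max\{0,p^\#_{\mu,\theta}\},\,p^*_{\mu,\theta}\big]$; (e) $\theta=-2$, $p=1$ and $w_\infty>\mu+1$, then (S) has no solution.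
   Context: $\mathbb{Z}^d$ is the integer lattice graph with $x\sim y$ iff $\sum_k|x_k-y_k|=1$; $|x|$ is the Euclidean norm; $\Delta u(x)=\sum_{y\sim x}(u(y)-u(x))$. $\Phi_d$ is the fundamental solution of $-\Delta$: $-\Delta\Phi_d=\delta_0$ in $\mathbb{Z}^d$ ($\delta_0$ equals $1$ at $0$ and $0$ elsewhere), $\lim_{|x|\to\infty}\Phi_d(x)=0$. The function $\overline{H}_0$ is defined by $\overline{H}_0(x)=-[\Delta\Phi_d^{1/2}(x)]\,\Phi_d^{-1/2}(x)$; it is known that $\overline{H}_0>0$ and $\overline{H}_0(x)=\frac{(d-2)^2}{4}|x|^{-2}+O(|x|^{-3})$ as $|x|\to\infty$. The Hardy operator is $\mathcal{L}_\mu u=-\Delta u+\mu H_0u$. The notation $u\gneqq0$ means $u\ge0$ everywhere and $u\not\equiv0$. For $\mu\ge-1$, $\tau_\pm=\tau_\pm(\mu)=\frac{2-d}{2}(1\mp\sqrt{1+\mu})$. The critical exponents are $p^*_{\mu,\theta}=1+\frac{2+\theta}{-\tau_-(\mu)}$, and $p^\#_{\mu,\theta}=1+\frac{2+\theta}{-\tau_+(\mu)}$ if $\mu\in[-1,+\infty)\setminus\{0\}$, $p^\#_{0,\theta}=0$. *)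

(* Defs.v *)
From HB Require Import structures.
From mathcomp Require Import all_boot all_order all_algebra.
From mathcomp Require Import all_classical all_reals all_analysis.

Set Implicit Arguments.
Unset Strict Implicit.
Unset Printing Implicit Defensive.

Import Order.TTheory GRing.Theory Num.Theory.
Import numFieldNormedType.Exports.

Local Open Scope classical_set_scope.
Local Open Scope ring_scope.

(* [limf_esup] and [limf_einf] only apply to functions on a [filteredType]: this
   gives int, hence Z^d, its discrete neighborhoods, on which the values of
   these limits do not depend. *)
HB.instance Definition _ := hasNbhs.Build int principal_filter.

Notation lattice d := 'rV[int]_d.

Definition adjacent (d : nat) (x y : lattice d) : bool :=
  \sum_(k < d) `|x 0 k - y 0 k| == 1.

Definition euclid_norm (R : realType) (d : nat) (x : lattice d) : R :=
  Num.sqrt (\sum_(k < d) (x 0 k)%:~R ^+ 2).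
Arguments euclid_norm R {d} x.

(* The filter of the limits as |x| tends to +oo. *)
Definition at_infinity (R : realType) (d : nat) : set_system (lattice d) :=
  filter_from [set: R] (fun M => [set x | M < euclid_norm R x]).
Arguments at_infinity : clear implicits.

(* Every vertex has finitely many neighbors, so that this finitely supported
   sum is the sum over all of them. *)
Definition laplacian (R : realType) (d : nat) (u : lattice d -> R)
    (x : lattice d) : R :=
  \sum_(y \in [set y | adjacent x y]) (u y - u x).

Definition fundamental_solution (R : realType) (d : nat)
    (Phi : lattice d -> R) : Prop :=
  (forall x, - laplacian Phi x = (x == 0)%:R) /\
  Phi x @[x --> at_infinity R d] --> (0 : R).

(* The function \overline{H}_0 built from the fundamental solution Phi. *)
Definition hardy_weight (R : realType) (d : nat) (Phi : lattice d -> R)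
    (x : lattice d) : R :=
  - laplacian (fun y => Phi y `^ (1 / 2)) x * Phi x `^ (- (1 / 2)).

Definition hardy_operator (R : realType) (d : nat) (mu : R)
    (H u : lattice d -> R) (x : lattice d) : R :=
  - laplacian u x + mu * H x * u x.

Definition tau_plus (R : realType) (d : nat) (mu : R) : R :=
  (2 - d%:R) / 2 * (1 - Num.sqrt (1 + mu)).

Definition tau_minus (R : realType) (d : nat) (mu : R) : R :=
  (2 - d%:R) / 2 * (1 + Num.sqrt (1 + mu)).

Definition p_star (R : realType) (d : nat) (mu theta : R) : R :=
  1 + (2 + theta) / (- tau_minus d mu).

Definition p_sharp (R : realType) (d : nat) (mu theta : R) : R :=
  if mu == 0 then 0 else 1 + (2 + theta) / (- tau_plus d mu).

Definition solution (R : realType) (d : nat) (mu p : R)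
    (H W u : lattice d -> R) : Prop :=
  [/\ forall x, W x * u x `^ p <= hardy_operator mu H u x,
      forall x, 0 <= u x &
      exists x, u x != 0].

(* Main.v *)
(* Write s = - ln Phi and G(x) = sum_(y ~ x) (s(y) - s(x))^2. Since Phi is
   harmonic away from 0, a second order expansion gives
     lap (e^(-a s) h(s)) = (G / 2) e^(-a s) ((a^2 - a) h + (1 - 2 a) h' + h'')
   up to a relative error O(|x|^-1), so that the weight of the problem is
   (1 / 8 + O(|x|^-1)) G, and every comparison function of the continuous radial
   problem can be used on the lattice, with ln |x| replaced by s. No asymptotic
   expansion of the Green function is needed: it suffices that Phi is comparable
   to |x|^(2-d), by barriers, and that its increments are O(|x|^(1-d)), by
   Bernstein's method.
   The comparison principle is used in the following form: if a function w slides
   below a positive u until it touches u, then lap w < lap u strictly at a well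
   chosen contact point.
   A supersolution of the linear problem decays at most like e^(-al s), where
   al = (1 + sqrt (1 + mu)) / 2. For p >= 1 this makes W u^(p-1) a potential of size
   at least G; below the critical exponent, and after one improvement of al at
   the critical exponent, it exceeds Hardy's constant, which a compactly
   supported bump in s excludes. For p < 1, sliding a small bump below u forces u
   to be large, namely to outgrow every supersolution of the linear problem. *)
Require Import Defs.
From HB Require Import structures.
From mathcomp Require Import all_boot all_order all_algebra.
From mathcomp Require Import all_classical all_reals all_analysis.
From mathcomp Require Import ring lra zify.

Set Implicit Arguments.
Unset Strict Implicit.
Unset Printing Implicit Defensive.

Import Order.TTheory GRing.Theory Num.Theory.
Import numFieldNormedType.Exports.

Local Open Scope classical_set_scope.
Local Open Scope ring_scope.

(** * Laplacian and comparison on the lattice *)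

(** With [u = e^(-s/2) z(s)] the linear operator becomes [(G / 2) e^(-s/2) (z'' - (1 + mu) / 4 z)]
    up to errors, an ODE with constant coefficients and exponents [+- sqrt (1 + mu) / 2]; hence the
    square root in the critical exponents. The weight [W] is at least a multiple of [e^(E s) G] with
    [E = (2 + theta) / (d - 2)]: [G] is a common factor of all terms, and only its upper bound is
    used, to compare it with [W]. The obstacle is that the errors have no sign, so an exact solution
    of the ODE need be neither a sub- nor a supersolution on the lattice. Each barrier therefore has
    a strict margin: a slightly shifted exponent, or a correction smaller by a factor [e^(-del s)],
    whose contribution has a sign and still dominates the errors. At [mu = -1] the two exponents
    coincide, powers of [s] take over, and the errors must be beaten even after multiplication by
    [s^2]. Contact sets are made finite by compact support or by comparing growth at infinity. *)

Definition step (d : nat) (i : 'I_d * bool) : lattice d :=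
  (-1) ^+ i.2 *: delta_mx 0 i.1.

Definition lap (R : realType) (d : nat) (u : lattice d -> R) (x : lattice d) : R :=
  \sum_(i : 'I_d * bool) (u (x + step i) - u x).

Lemma stepE d (i : 'I_d * bool) k :
  step i 0 k = (-1) ^+ i.2 * (k == i.1)%:R.
Proof. by rewrite !mxE eqxx /=. Qed.

Lemma step_inj d : injective (@step d).
Proof.
move=> [i b] [j c] /matrixP e; have := e 0 i; rewrite !stepE eqxx /=.
case: eqVneq => [->|_]; last by case: b {e}; rewrite /= ?expr0 ?expr1 mulr0.
by case: b {e}; case: c.
Qed.

Lemma adjacent_step d (x : lattice d) (i : 'I_d * bool) : Defs.adjacent x (x + step i).
Proof.
rewrite /Defs.adjacent (bigD1 i.1) //= big1 ?addr0 => [|k /negPf ki].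
  by rewrite mxE stepE eqxx mulr1 opprD addNKr normrN normrX normrN1 expr1n.
by rewrite mxE stepE ki mulr0 addr0 subrr normr0.
Qed.

Lemma adjacentP d (x y : lattice d) : Defs.adjacent x y -> exists i, y = x + step i.
Proof.
move=> /eqP xy.
have [k xyk] : exists k, x 0 k != y 0 k.
  apply/not_existsP => h; move: xy; rewrite big1 // => k _.
  by have /negP/negPn/eqP -> := h k; rewrite subrr normr0.
move: xy; rewrite (bigD1 k) //= => xy.
have k_ge1 : 1 <= `|x 0 k - y 0 k| by rewrite -gtz0_ge1 normr_gt0 subr_eq0.
have rest_ge0 : 0 <= \sum_(i < d | i != k) `|x 0 i - y 0 i|.
  exact: sumr_ge0.
have [k1 rest0] : `|x 0 k - y 0 k| = 1 /\ \sum_(i < d | i != k) `|x 0 i - y 0 i| = 0.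
  by move: xy k_ge1 rest_ge0; set p := `|_|; set q := \sum_(_ < d | _) _; lia.
have eqo j : j != k -> x 0 j = y 0 j.
  move=> jk; apply/eqP; rewrite -subr_eq0 -normr_eq0.
  by have /psumr_eq0P := rest0; move=> -> //.
exists (k, x 0 k > y 0 k); apply/rowP => j; rewrite mxE stepE /=.
case: eqVneq => [->|jk]; last by rewrite mulr0 addr0 eqo.
by case: ltP => h; rewrite /= ?expr1 ?expr0; lia.
Qed.

Lemma laplacianE (R : realType) d (u : lattice d -> R) : laplacian u = lap u.
Proof.
apply/funext => x; rewrite /laplacian /lap.
rewrite (@reindex_fsbig _ _ _ _ _ (fun i => x + step i) [set: 'I_d * bool]).
  rewrite [RHS](fsbig_seq _ (fun i => u (x + step i) - u x)) ?index_enum_uniq //.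
  suff -> : [set` index_enum ('I_d * bool)%type] = setT by [].
  by apply/seteqP; split=> i //= _; exact: mem_index_enum.
split=> [i _ /=|i j _ _ /addrI/step_inj//|y /= /adjacentP[i ->]].
  exact: adjacent_step.
by exists i.
Qed.

Lemma lapD (R : realType) d (u v : lattice d -> R) x :
  lap (fun y => u y + v y) x = lap u x + lap v x.
Proof. by rewrite /lap -big_split; apply: eq_bigr => i _ /=; ring. Qed.

Lemma lapZ (R : realType) d c (u : lattice d -> R) x :
  lap (fun y => c * u y) x = c * lap u x.
Proof. by rewrite /lap mulr_sumr; apply: eq_bigr => i _ /=; ring. Qed.

Lemma lapB (R : realType) d (u v : lattice d -> R) x :
  lap (fun y => u y - v y) x = lap u x - lap v x.
Proof. by rewrite /lap -sumrB; apply: eq_bigr => i _ /=; ring. Qed.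

(** Connectedness of the lattice: the translations that preserve [P] are closed under addition and
    contain the steps, hence every integer combination of them. *)
Lemma step_closed_setT d (P : set (lattice d)) (a : lattice d) :
  P a -> (forall x i, P x -> P (x + step i)) -> forall x, P x.
Proof.
move=> Pa Pstep x.
pose Q := [set v : lattice d | forall y, P y -> P (y + v)].
have QD u v : Q u -> Q v -> Q (u + v).
  by move=> Qu Qv y Py; rewrite addrA; apply/Qv/Qu.
have Q0 : Q 0 by move=> y; rewrite addr0.
have Qs i : Q (step i) by move=> y /Pstep.
have Qn i n : Q (step i *+ n).
  by elim: n => [|n IH]; rewrite ?mulr0n // mulrS; apply: QD.
have Qall v : Q v.
  rewrite (row_sum_delta v); apply: (big_ind Q) => // k _.
  have [|n|n] := intP (v 0 k).
  - by rewrite scale0r.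
  - have := Qn (k, false) n.+1; rewrite /step /= expr0 scale1r.
    by rewrite -scaler_nat natz.
  - have := Qn (k, true) n.+1; rewrite /step /= expr1 scaleN1r.
    by rewrite mulNrn -scaler_nat natz scaleNr.
by have := Qall (x - a) a Pa; rewrite addrC subrK.
Qed.

Lemma seq_argmin (T : eqType) disp (V : orderType disp) (f : T -> V) (s : seq T) a :
  a \in s -> exists2 x, x \in s & forall y, y \in s -> (f x <= f y)%O.
Proof.
elim: s a => // b s IH a _.
case: s IH => [_|c s /(_ c (mem_head c s)) [x xs xmin]].
  by exists b; rewrite ?mem_head// => y; rewrite inE => /eqP->.
case: (leP (f b) (f x)) => h.
  exists b; rewrite ?mem_head // => y; rewrite inE => /predU1P[->//|/xmin].
  exact: le_trans.
exists x; first by rewrite inE xs orbT.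
by move=> y; rewrite inE => /predU1P[->|/xmin//]; exact: ltW.
Qed.

(* Among the minimizers, one with the largest k-th coordinate is kept: its
   neighbor in direction k cannot be a minimizer. *)
Lemma extremal_argmin disp (V : orderType disp) d (k : 'I_d) (F : set (lattice d))
    (f : lattice d -> V) a :
  finite_set F -> F a ->
  exists2 x, F x & (forall y, F y -> (f x <= f y)%O) /\
    (F (x + step (k, false)) -> (f x < f (x + step (k, false)))%O).
Proof.
move=> /finite_seqP[s Fs] Fa.
have [|x xs xmin] := @seq_argmin _ _ _ f s a; first by rewrite Fs in Fa.
have [|z] := @seq_argmin _ _ _ (fun y : lattice d => - y 0 k)
  [seq y <- s | f y == f x] x; first by rewrite mem_filter eqxx.
rewrite mem_filter => /andP[/eqP zx zs] zmax.
exists z; first by rewrite Fs.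
split=> [y|]; rewrite Fs /= ?zx; first exact: xmin.
move=> ys; rewrite lt_neqAle xmin // andbT; apply/eqP => e.
have := zmax (z + step (k, false)).
rewrite mem_filter ys e eqxx => /(_ isT).
by rewrite mxE stepE eqxx expr0 mulr1 lerN2 gerDl.
Qed.

(** [t] is the least ratio [u / w] over the contact set, so [u - t w] vanishes at the minimizer and
    is nonnegative at its neighbors. Taking the minimizer farthest in one direction makes one
    neighbor strict; barriers that satisfy only a non-strict inequality then already give a
    contradiction. *)
Lemma touching (R : realType) d (D : set (lattice d)) (u w : lattice d -> R) a :
  (0 < d)%N ->
  (forall x, D x -> 0 < u x) ->
  (forall x i, D x -> ~ D (x + step i) ->
    0 < u (x + step i) /\ w (x + step i) < u (x + step i)) ->
  finite_set [set x | D x /\ u x <= w x] ->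
  D a -> u a < w a ->
  exists x t, [/\ D x, 0 < t <= 1, u x = t * w x & t * lap w x < lap u x].
Proof.
move=> d0 u_gt0 bd finF Da ua.
pose F := [set x | D x /\ u x <= w x].
have Fw x : F x -> 0 < w x by move=> [Dx]; apply: lt_le_trans; exact: u_gt0.
have [|x0 Fx0 [x0min x0str]] :=
  @extremal_argmin _ R d (Ordinal d0) F (fun x => u x / w x) a finF.
  by split=> //; exact: ltW.
set t := u x0 / w x0 in x0min x0str.
have Dx0 := Fx0.1; have wx0 := Fw _ Fx0.
have t_gt0 : 0 < t by rewrite divr_gt0 ?u_gt0.
have t_le1 : t <= 1 by rewrite ler_pdivrMr // mul1r; exact: Fx0.2.
have ux0 : u x0 = t * w x0 by rewrite divfK ?gt_eqF.
have tw x : 0 < u x -> w x < u x -> t * w x < u x.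
  move=> ux wux; have [w0|w0] := lerP (w x) 0.
    by rewrite (le_lt_trans _ ux) // mulr_ge0_le0 // ltW.
  by rewrite (le_lt_trans _ wux) // ger_pMl.
have nb i : t * w (x0 + step i) <= u (x0 + step i).
  have [Dy|nDy] := pselect (D (x0 + step i)); last first.
    by have [? ?] := bd _ _ Dx0 nDy; exact/ltW/tw.
  have [uw|wu] := lerP (u (x0 + step i)) (w (x0 + step i)).
    have Fy : F (x0 + step i) by [].
    by rewrite -ler_pdivlMr ?Fw // x0min.
  by apply/ltW/tw => //; exact: u_gt0.
have nbs : t * w (x0 + step (Ordinal d0, false)) < u (x0 + step (Ordinal d0, false)).
  have [Dy|nDy] := pselect (D (x0 + step (Ordinal d0, false))); last first.
    by have [? ?] := bd _ _ Dx0 nDy; exact: tw.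
  case: (lerP (u (x0 + step (Ordinal d0, false))) (w (x0 + step (Ordinal d0, false)))).
    move=> uw.
    have Fy : F (x0 + step (Ordinal d0, false)) by [].
    by rewrite -ltr_pdivlMr ?Fw //; exact: x0str.
  by move=> wu; apply: tw => //; exact: u_gt0.
exists x0, t; split=> //; first by rewrite t_gt0.
rewrite -lapZ -subr_gt0 -lapB /lap (bigD1 (Ordinal d0, false)) //=.
rewrite -ux0 subrr subr0 ltr_pwDl ?subr_gt0 // sumr_ge0 // => i _.
by rewrite subr0 subr_ge0.
Qed.

(** The finiteness hypothesis replaces a condition at infinity: a negative value would yield a
    minimum over a finite set, and the extremal minimizer would have [lap u > 0]. *)
Lemma superharmonic_ge0 (R : realType) d (D : set (lattice d)) (u : lattice d -> R) :
  (0 < d)%N ->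
  (forall x, D x -> lap u x <= 0) ->
  (forall x i, D x -> ~ D (x + step i) -> 0 <= u (x + step i)) ->
  (forall e, 0 < e -> finite_set [set x | D x /\ u x <= - e]) ->
  forall x, D x -> 0 <= u x.
Proof.
move=> d0 lapu bd fin x Dx; rewrite leNgt; apply/negP => ux.
have [||x0 Fx0 [x0min x0str]] := @extremal_argmin _ R d (Ordinal d0)
  [set y | D y /\ u y <= u x] u x.
- by have := fin (- u x); rewrite opprK oppr_gt0; apply.
- by [].
have x0l : u x0 < 0 by apply: le_lt_trans ux; exact: Fx0.2.
have := lapu x0 Fx0.1; rewrite leNgt => /negP; apply.
rewrite /lap (bigD1 (Ordinal d0, false)) //=.
have nb i : u x0 <= u (x0 + step i).
  have [Dy|nDy] := pselect (D (x0 + step i)); last first.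
    by apply/ltW/(lt_le_trans x0l)/bd => //; exact: Fx0.1.
  have [uw|wu] := lerP (u (x0 + step i)) (u x); first exact: x0min.
  by apply: ltW; apply: le_lt_trans wu; exact: Fx0.2.
rewrite ltr_pwDl ?subr_gt0 //; last first.
  by apply: sumr_ge0 => i _; rewrite subr_ge0.
have [Dy|nDy] := pselect (D (x0 + step (Ordinal d0, false))); last first.
  by apply: (lt_le_trans x0l); apply: bd => //; exact: Fx0.1.
have [uw|wu] := lerP (u (x0 + step (Ordinal d0, false))) (u x).
  exact: x0str.
by apply: le_lt_trans wu; exact: Fx0.2.
Qed.

Lemma strong_maximum_principle (R : realType) d (u : lattice d -> R) a :
  (forall x, 0 <= u x) -> (forall x, u x = 0 -> lap u x <= 0) ->
  u a = 0 -> forall x, u x = 0.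
Proof.
move=> u_ge0 lapu ua; apply: (@step_closed_setT d [set x | u x = 0] a) => //= x i ux.
have /eqP : lap u x = 0.
  apply/eqP; rewrite eq_le lapu //= sumr_ge0 // => j _.
  by rewrite ux subr0.
rewrite /lap psumr_eq0 => [/allP/(_ i (mem_index_enum i))|j _]; last first.
  by rewrite ux subr0.
by rewrite ux subr0 => /eqP.
Qed.

(** * Elementary estimates *)

Lemma expr2_le_fact n : (2 ^ n.+1 <= n.+3`!)%N.
Proof.
elim: n => // n IH; rewrite expnS factS leq_mul //.
Qed.

(** Because [2^(n+1) <= (n+3)!], the terms of the series from the cubic one on are dominated by
    [|z|^3 2^-(n+1)], whose sum is [|z|^3]. *)
Lemma expR_taylor2 (R : realType) (z : R) :
  `|z| <= 1 -> `|expR z - (1 + z + z ^+ 2 / 2)| <= `|z| ^+ 3.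
Proof.
move=> z1.
have bound n : `|series (exp_coeff z) n.+3 - (1 + z + z ^+ 2 / 2)|
    <= `|z| ^+ 3 * (1 - 2^-1 ^+ n).
  elim: n => [|n IH].
    rewrite expr0 subrr mulr0 /series /= !big_nat_recr //= big_geq //.
    rewrite /exp_coeff /= !fact0 !factS fact0 !muln1 expr0 expr1 invr1 !mulr1.
    by rewrite add0r subrr normr0.
  rewrite /series /= big_nat_recr //= -/(series _ _).
  rewrite addrAC (le_trans (ler_normD _ _)) //.
  rewrite -[X in _ <= X](subrK (`|z| ^+ 3 * (1 - 2^-1 ^+ n))) [X in _ <= X]addrC.
  rewrite lerD //.
  rewrite /exp_coeff /= normrM normrX normfV normr_nat -mulrBr.
  have -> : 1 - 2^-1 ^+ n.+1 - (1 - 2^-1 ^+ n) = 2^-1 ^+ n.+1 :> R.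
    by rewrite exprS; field.
  rewrite -[n.+3]/(3 + n)%N exprD -mulrA ler_wpM2l ?exprn_ge0 //.
  rewrite (@le_trans _ _ (1 * (n.+3)`!%:R^-1)) // ?ler_wpM2r ?invr_ge0 //.
    by rewrite exprn_ile1.
  rewrite mul1r exprVn lef_pV2 ?posrE ?exprn_gt0 ?ltr0n ?fact_gt0 //.
  by rewrite -natrX ler_nat expr2_le_fact.
have H : \forall n \near \oo,
    `|series (exp_coeff z) n - (1 + z + z ^+ 2 / 2)| <= `|z| ^+ 3.
  near=> n.
  have [m ->] : exists m, n = m.+3.
    by exists (n - 3)%N; rewrite -addn3 subnK //; near: n; exists 3%N.
  rewrite (le_trans (bound m)) // ler_piMr ?exprn_ge0 //.
rewrite ler_norml; apply/andP; split.
  rewrite lerBrDl; apply: limr_ge; first exact: is_cvg_series_exp_coeff.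
  by apply: filterS H => n; rewrite ler_norml => /andP[]; rewrite lerBrDl.
rewrite lerBlDr; apply: limr_le; first exact: is_cvg_series_exp_coeff.
by apply: filterS H => n; rewrite ler_norml => /andP[_]; rewrite lerBlDr.
Unshelve. all: by end_near. Qed.

Lemma expR_mul_taylor2 (R : realType) (a q0 q1 q2 r M v : R) :
  `|v| <= 1 -> `|a * v| <= 1 ->
  `|q0| <= M -> `|q1| <= M -> `|q2| <= M -> `|r| <= M * `|v| ^+ 3 ->
  `|expR (- (a * v)) * (q0 + q1 * v + q2 / 2 * v ^+ 2 + r)
    - (q0 + (q1 - a * q0) * v + (q2 - 2 * a * q1 + a ^+ 2 * q0) / 2 * v ^+ 2)|
  <= 4 * (1 + `|a|) ^+ 3 * M * `|v| ^+ 3.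
Proof.
move=> v1 av1 q0M q1M q2M rM.
have v_ge0 : 0 <= `|v| by [].
have a_ge0 : 0 <= `|a| by [].
have M_ge0 : 0 <= M by apply: le_trans q0M.
set E := expR (- (a * v)) - (1 + - (a * v) + (- (a * v)) ^+ 2 / 2).
have E_le : `|E| <= `|a| ^+ 3 * `|v| ^+ 3.
  by rewrite -exprMn -normrM -(normrN (a * v)) expR_taylor2 // normrN.
have e_le : `|expR (- (a * v))| <= 4.
  rewrite ger0_norm ?expR_ge0 // (@le_trans _ _ (expR 1)) //.
    by rewrite ler_expR; move: av1; rewrite -normrN; exact: le_trans (ler_norm _).
  have := @expR_taylor2 R 1; rewrite normr1 lexx => /(_ isT).
  by rewrite !expr1n ler_norml => /andP[_]; lra.
have -> : expR (- (a * v)) * (q0 + q1 * v + q2 / 2 * v ^+ 2 + r)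
    - (q0 + (q1 - a * q0) * v + (q2 - 2 * a * q1 + a ^+ 2 * q0) / 2 * v ^+ 2)
  = E * (q0 + q1 * v + q2 / 2 * v ^+ 2) + expR (- (a * v)) * r
    + v ^+ 3 * (a ^+ 2 * q1 / 2 - a * q2 / 2 + a ^+ 2 * q2 / 4 * v).
  by rewrite /E; field.
have T1 : `|E * (q0 + q1 * v + q2 / 2 * v ^+ 2)| <=
    `|a| ^+ 3 * `|v| ^+ 3 * (3 * M).
  rewrite normrM ler_pM //.
  have h1 : `|q1 * v| <= M by rewrite normrM -[M]mulr1 ler_pM.
  have h2 : `|q2 / 2 * v ^+ 2| <= M.
    rewrite normrM normrX normrM normfV normr_nat -[M]mulr1 ler_pM //.
      by rewrite -[M]mulr1 ler_pM // ?invf_le1 ?ler1n // invr_ge0.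
    by rewrite exprn_ile1.
  have := ler_normD (q0 + q1 * v) (q2 / 2 * v ^+ 2).
  by have := ler_normD q0 (q1 * v); lra.
have T2 : `|expR (- (a * v)) * r| <= 4 * (M * `|v| ^+ 3).
  by rewrite normrM ler_pM.
have T3 : `|v ^+ 3 * (a ^+ 2 * q1 / 2 - a * q2 / 2 + a ^+ 2 * q2 / 4 * v)| <=
   `|v| ^+ 3 * ((`|a| ^+ 2 + `|a|) * M).
  rewrite normrM normrX ler_wpM2l ?exprn_ge0 //.
  rewrite (le_trans (ler_normD _ _)) //.
  rewrite (@le_trans _ _ (`|a| ^+ 2 * M / 2 + `|a| * M / 2 + `|a| ^+ 2 * M / 4)) //.
    rewrite lerD //.
      rewrite (le_trans (ler_normB _ _)) // lerD //.
        by rewrite !(normrX, normrM) normfV !normr_nat ler_wpM2r // ler_wpM2l ?exprn_ge0.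
      by rewrite !normrM normfV !normr_nat ler_wpM2r // ler_wpM2l.
    rewrite !(normrX, normrM) normfV !normr_nat -[X in _ <= X]mulr1 ler_pM //.
    by rewrite ler_wpM2r // ler_wpM2l ?exprn_ge0.
  have : 0 <= `|a| ^+ 2 * M by rewrite mulr_ge0 // exprn_ge0.
  have : 0 <= `|a| * M by rewrite mulr_ge0.
  by lra.
rewrite (le_trans (ler_normD _ _)) //.
apply: le_trans (lerD (le_trans (ler_normD _ _) (lerD T1 T2)) T3) _.
have MV : 0 <= M * `|v| ^+ 3 by rewrite mulr_ge0 // exprn_ge0.
have -> : `|a| ^+ 3 * `|v| ^+ 3 * (3 * M) + 4 * (M * `|v| ^+ 3) +
   `|v| ^+ 3 * ((`|a| ^+ 2 + `|a|) * M) =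
   (3 * `|a| ^+ 3 + 4 + `|a| ^+ 2 + `|a|) * (M * `|v| ^+ 3) by ring.
rewrite -[X in _ <= X]mulrA ler_wpM2r //.
have : 0 <= `|a| ^+ 3 by rewrite exprn_ge0.
have : 0 <= `|a| ^+ 2 by rewrite exprn_ge0.
have -> : 4 * (1 + `|a|) ^+ 3 = 4 + 12 * `|a| + 12 * `|a| ^+ 2 + 4 * `|a| ^+ 3.
  by ring.
by lra.
Qed.

Lemma ln1D_bound (R : realType) (t : R) : `|t| <= 1 / 2 -> `|ln (1 + t)| <= 2 * `|t|.
Proof.
move=> t12; have := t12; rewrite ler_norml => /andP[t1 t2].
have t_gt : -1 < t by lra.
rewrite ler_norml; apply/andP; split.
  (* Lower bound: the inequality [ln (1 + y) <= y] is applied to the reciprocal. *)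
  have -> : 1 + t = (1 + - (t / (1 + t)))^-1 by field; apply/andP; split; lra.
  have h : `|t / (1 + t)| <= 2 * `|t|.
    have t0 : 0 < 1 + t by lra.
    rewrite normrM normfV (gtr0_norm t0) ler_pdivrMr // mulrAC ler_peMl //.
    by lra.
  have k : -1 < - (t / (1 + t)).
    rewrite ltrN2 ltr_pdivrMr; lra.
  rewrite lnV ?posrE ?lerN2 //; last by lra.
  apply: le_trans (le_ln1Dx k) _.
  by apply: le_trans h; rewrite -normrN ler_norm.
apply: le_trans (le_ln1Dx t_gt) _.
by apply: le_trans (ler_norm t) _; rewrite ler_peMl // ler1n.
Qed.

(** The expansion of [exp] at [L = ln (1 + t)] is inverted: [L = t - L^2 / 2 - r] first gives
    [L - t = O(t^2)], and substituting this back gives the cubic error. *)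
Lemma ln1D_taylor2 (R : realType) (t : R) :
  `|t| <= 1 / 2 -> `|ln (1 + t) - (t - t ^+ 2 / 2)| <= 20 * `|t| ^+ 3.
Proof.
move=> t12; have L2 := ln1D_bound t12; have := t12; rewrite ler_norml => /andP[t1 t2].
set L := ln (1 + t) in L2 *.
have eL : expR L = 1 + t by rewrite lnK // posrE; lra.
have L1 : `|L| <= 1 by lra.
have := expR_taylor2 L1; rewrite eL.
set r := (X in `|X| <= _) => rL.
have L3 : `|L| ^+ 3 <= 8 * `|t| ^+ 3.
  have -> : 8 * `|t| ^+ 3 = (2 * `|t|) ^+ 3 by ring.
  by rewrite lerXn2r ?nnegrE.
have LL : `|L| ^+ 2 <= 2 * `|t| * (2 * `|t|) by rewrite expr2 ler_pM.
have tt : 0 <= `|t| by [].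
have t3 : `|t| ^+ 3 <= `|t| ^+ 2 / 2.
  by rewrite exprS mulrC ler_wpM2l ?exprn_ge0 // -div1r.
have Lt : `|L - t| <= 6 * `|t| ^+ 2.
  have -> : L - t = - (L ^+ 2 / 2) - r by rewrite /r; ring.
  rewrite (le_trans (ler_normB _ _)) // normrN normrM normfV normr_nat normrX.
  have -> : 6 * `|t| ^+ 2 = 2 * `|t| * (2 * `|t|) / 2 + 4 * `|t| ^+ 2 by field.
  have := le_trans rL L3.
  by move: LL t3; set p := `|L| ^+ 2; set q := 2 * `|t| * _; set w := `|r|; lra.
have -> : L - (t - t ^+ 2 / 2) = - ((L - t) * (L + t) / 2) - r.
  by rewrite /r; field.
rewrite (le_trans (ler_normB _ _)) // normrN !normrM normfV normr_nat.
have Lpt : `|L + t| <= 3 * `|t|.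
  by rewrite (le_trans (ler_normD _ _)) //; move: L2; lra.
have : `|L - t| * `|L + t| <= 6 * `|t| ^+ 2 * (3 * `|t|) by rewrite ler_pM.
have -> : 6 * `|t| ^+ 2 * (3 * `|t|) = 18 * `|t| ^+ 3 by ring.
have := le_trans rL L3.
have : 0 <= `|t| ^+ 3 by rewrite exprn_ge0.
by lra.
Qed.

(** The factor [1 + s^2] is there for the double root [mu = -1], where [s] or [s^2] multiplies the
    errors, and for bumps as wide as a fraction of [s]. *)
Lemma expR_decay (R : realType) (delta K eta : R) : 0 < delta -> 0 <= K -> 0 < eta ->
  exists s0, forall s, s0 < s -> 1 < s /\ K * (1 + s ^+ 2) * expR (- (delta * s)) <= eta.
Proof.
move=> d0 K0 e0.
have d3 : 0 < delta ^+ 3 by rewrite exprn_gt0.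
exists (1 + 12 * K / (eta * delta ^+ 3)) => s hs.
have k0 : 0 <= 12 * K / (eta * delta ^+ 3) by rewrite divr_ge0 ?mulr_ge0 // ltW.
have s1 : 1 < s by lra.
split=> //.
rewrite expRN ler_pdivrMr ?expR_gt0 //.
have s0 : 0 < s by lra.
have h : (delta * s) ^+ 3 / 6 <= expR (delta * s).
  have := @expR_ge1Dxn R (delta * s) 2; rewrite mulr_ge0 ?(ltW d0) ?(ltW s0) //.
  by rewrite !factS fact0 /= => /(_ isT); lra.
have h2 : 12 * K <= eta * delta ^+ 3 * s.
  have : 12 * K / (eta * delta ^+ 3) < s by lra.
  by rewrite ltr_pdivrMr ?mulr_gt0 // [s * _]mulrC => /ltW.
apply: (@le_trans _ _ (eta * ((delta * s) ^+ 3 / 6))); last first.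
  by rewrite ler_wpM2l // ltW.
have ss : 1 <= s ^+ 2 by rewrite exprn_ege1 // ltW.
apply: (@le_trans _ _ (K * (2 * s ^+ 2))).
  by rewrite ler_wpM2l //; lra.
have -> : eta * ((delta * s) ^+ 3 / 6) = (eta * delta ^+ 3 * s) * (s ^+ 2 / 6).
  by rewrite exprMn; field.
have -> : K * (2 * s ^+ 2) = 12 * K * (s ^+ 2 / 6) by field.
by rewrite ler_wpM2r // divr_ge0 ?exprn_ge0 ?ltW.
Qed.

Lemma expR_growth (R : realType) (delta M : R) : 0 < delta ->
  exists s0, forall s, s0 < s -> M <= expR (delta * s).
Proof.
move=> d0; exists (M / delta) => s; rewrite ltr_pdivrMr // mulrC => h.
by apply: le_trans (expR_ge1Dx _); lra.
Qed.

(** * Bernstein gradient estimate *)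

Definition nsq (R : realType) (d : nat) (x : lattice d) : R :=
  \sum_(k < d) (x 0 k)%:~R ^+ 2.
Arguments nsq R {d} x.

(** Inner product of [x] with [step i]: along this step the squared norm changes by
    [2 * scoord + 1]. *)
Definition scoord (R : realType) (d : nat) (x : lattice d) (i : 'I_d * bool) : R :=
  (-1) ^+ i.2 * (x 0 i.1)%:~R.
Arguments scoord R {d} x i.

Lemma sum_steps (R : realType) d (F : 'I_d * bool -> R) :
  \sum_i F i = \sum_(k < d) (F (k, true) + F (k, false)).
Proof.
rewrite -(eq_bigr _ (fun i _ => congr1 F (esym (surjective_pairing i)))).
rewrite -(pair_bigA _ (fun k b => F (k, b))) /=.
by apply: eq_bigr => k _; rewrite big_bool.
Qed.

Lemma sum_scoord (R : realType) d (x : lattice d) : \sum_i scoord R x i = 0.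
Proof.
by rewrite sum_steps big1 // => k _; rewrite /scoord /= expr1 expr0; ring.
Qed.

Lemma sum_scoord2 (R : realType) d (x : lattice d) :
  \sum_i scoord R x i ^+ 2 = 2 * nsq R x.
Proof.
rewrite sum_steps /nsq mulr_sumr; apply: eq_bigr => k _.
by rewrite /scoord /= expr1 expr0; ring.
Qed.

Lemma sum_cst_steps (R : realType) d (c : R) :
  \sum_(i : 'I_d * bool) c = 2 * d%:R * c.
Proof.
rewrite sum_steps big_const card_ord iter_addr_0 -mulr_natr; ring.
Qed.

Lemma nsq_ge0 (R : realType) d (x : lattice d) : 0 <= nsq R x.
Proof. by rewrite sumr_ge0 // => k _; rewrite sqr_ge0. Qed.

Lemma scoord2_le (R : realType) d (x : lattice d) i : scoord R x i ^+ 2 <= nsq R x.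
Proof.
rewrite /scoord exprMn sqrr_sign mul1r /nsq (bigD1 i.1) //= lerDl sumr_ge0 //.
by move=> k _; rewrite sqr_ge0.
Qed.

Lemma nsq_step (R : realType) d (x : lattice d) i :
  nsq R (x + step i) = nsq R x + 2 * scoord R x i + 1.
Proof.
rewrite /nsq (bigD1 i.1) //= [X in _ = X + _ + _](bigD1 i.1) //=.
rewrite (eq_bigr (fun k => (x 0 k)%:~R ^+ 2)); last first.
  by move=> k /negPf ki; rewrite mxE stepE ki mulr0 addr0.
rewrite mxE stepE eqxx mulr1 intrD /scoord.
by case: i.2; rewrite /= ?expr0 ?expr1 ?mulrN1z; ring.
Qed.

Lemma nsq_step_le (R : realType) d (x : lattice d) i (r : R) :
  0 <= r -> nsq R x <= r ^+ 2 -> nsq R (x + step i) <= (r + 1) ^+ 2.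
Proof.
move=> r0 xr; rewrite nsq_step.
have : scoord R x i <= r.
  rewrite (le_trans (ler_norm _)) // -(@ler_pXn2r _ 2) ?nnegrE // -normrX.
  by rewrite ger0_norm ?sqr_ge0 // (le_trans (scoord2_le _ _ _)).
have -> : (r + 1) ^+ 2 = r ^+ 2 + 2 * r + 1 by ring.
by lra.
Qed.

Lemma nsqB_le (R : realType) d (x y : lattice d) :
  nsq R x <= 2 * nsq R y + 2 * nsq R (y - x).
Proof.
rewrite /nsq !mulr_sumr -big_split ler_sum // => k _ /=.
rewrite !mxE intrD mulrNz.
by set a := (x 0 k)%:~R; set b := (y 0 k)%:~R; have := sqr_ge0 (a - 2 * b : R); nra.
Qed.

Lemma finite_nsq (R : realType) d (M : R) :
  finite_set [set x : lattice d | nsq R x <= M].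
Proof.
pose N := Num.bound M.
pose g (m : 'rV['I_(N + N).+1]_d) : lattice d := \row_k ((m 0 k)%:Z - N%:Z).
apply: (@sub_finite_set _ _ (g @` setT)); last by apply: finite_image.
move=> x /= xM.
have xN k : `|x 0 k| <= N%:Z.
  rewrite -(ler_int R) intr_norm.
  have [->|x0] := eqVneq (x 0 k) 0; first by rewrite normr0 ler0n.
  apply: (@le_trans _ _ (nsq R x)); last first.
    by apply: (le_trans xM); exact/ltW/archi_boundP/(le_trans (nsq_ge0 _ x) xM).
  rewrite /nsq (bigD1 k) //= (@le_trans _ _ ((x 0 k)%:~R ^+ 2)) //; last first.
    by rewrite lerDl sumr_ge0 // => j _; rewrite sqr_ge0.
  rewrite -real_normK ?num_real // expr2 ler_peMl // -intr_norm ler1z.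
  by rewrite -gtz0_ge1 normr_gt0.
exists (\row_k inord (absz (x 0 k + N%:Z))) => //.
apply/rowP => k; rewrite !mxE inordK; last by have := xN k; lia.
by have := xN k; lia.
Qed.

Lemma lap_shift (R : realType) d (f : lattice d -> R) a x :
  lap (fun y => f (y + a)) x = lap f (x + a).
Proof. by rewrite /lap; apply: eq_bigr => i _; rewrite addrAC. Qed.

Lemma lap_cst (R : realType) d (c : R) (x : lattice d) : lap (fun _ => c) x = 0.
Proof. by rewrite /lap big1 // => i _; rewrite subrr. Qed.

Lemma lap_sum (R : realType) d (I : Type) (r : seq I) (F : I -> lattice d -> R) x :
  lap (fun y => \sum_(i <- r) F i y) x = \sum_(i <- r) lap (F i) x.
Proof.
by rewrite /lap exchange_big /=; apply: eq_bigr => i _; rewrite sumrB.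
Qed.

Lemma lap_sqr (R : realType) d (h : lattice d -> R) x :
  lap h x = 0 -> lap (fun y => h y ^+ 2) x = \sum_i (h (x + step i) - h x) ^+ 2.
Proof.
move=> h0; apply/eqP; rewrite -subr_eq0; apply/eqP.
transitivity (2 * h x * lap h x); last by rewrite h0 mulr0.
by rewrite /lap -sumrB mulr_sumr; apply: eq_bigr => i _; ring.
Qed.

Lemma lap_nsq (R : realType) d (c x : lattice d) :
  lap (fun y => nsq R (y - c)) x = 2 * d%:R.
Proof.
rewrite /lap (eq_bigr (fun i => 2 * scoord R (x - c) i + 1)).
  by rewrite big_split /= -mulr_sumr sum_scoord mulr0 add0r sum_cst_steps mulr1.
by move=> i _; rewrite addrAC nsq_step; ring.
Qed.

(* Bernstein's method: the auxiliary function P below is subharmonic. *)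
Lemma bernstein_gradient (R : realType) d (c : lattice d) (h : lattice d -> R)
    (r M : R) :
  (0 < d)%N -> 2 <= r ->
  (forall z, nsq R (z - c) <= 4 * r ^+ 2 -> lap h z = 0 /\ `|h z| <= M) ->
  forall i, (h (c + step i) - h c) ^+ 2 <=
    ((40 * d%:R + 9) * (2 * d%:R + 1) + 36) * M ^+ 2 / r ^+ 2.
Proof.
move=> d0 r2 hh i.
have r0 : 0 < r by lra.
have rr0 : 0 < r ^+ 2 by rewrite exprn_gt0.
(* [40 d] collects [2 d] terms of size 18 and [4 d] from [lap eta]; 9 is the coefficient of the
   squares of [v] at the neighbors. *)
pose K : R := 40 * d%:R + 9.
have K0 : 0 <= K by rewrite addr_ge0 ?mulr_ge0.
have KR0 : 0 <= K / r ^+ 2 by rewrite divr_ge0 // ltW.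
pose eta x := 1 - nsq R (x - c) / r ^+ 2.
pose v x := h (x + step i) - h x.
(* The values at the neighbors enter because on the lattice the error in [lap (eta^2 v^2)] involves
   [v] at the neighbors too; the Laplacian of [h^2] taken there produces these squares. *)
pose Q x := h x ^+ 2 + \sum_j h (x + step j) ^+ 2.
pose P x := eta x ^+ 2 * v x ^+ 2 + K / r ^+ 2 * Q x.
pose D := [set x | nsq R (x - c) < r ^+ 2].
have hD1 x : D x -> lap h x = 0.
  by move=> /ltW Dx; apply: (hh _ _).1; rewrite (le_trans Dx) // ler_peMl ?ltW //; lra.
have nb x j : D x -> nsq R (x + step j - c) <= (r + 1) ^+ 2.
  by move=> /ltW Dx; rewrite addrAC nsq_step_le // ltW.
have hD2 x j : D x -> lap h (x + step j) = 0.
  move=> /(@nb x j) xj; apply: (hh _ _).1; apply: le_trans xj _.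
  by have := sqr_ge0 r; nra.
have hb x : nsq R (x - c) <= (r + 1) ^+ 2 -> `|h x| <= M.
  move=> xj; apply: (hh _ _).2; apply: le_trans xj _.
  by nra.
(* A neighbor of a point next to the ball of radius [r] is at distance at most [r + 2], and
   [r + 2 <= 2 r] because [2 <= r]. *)
have hb2 x j : nsq R (x - c) <= (r + 1) ^+ 2 -> `|h (x + step j)| <= M.
  move=> xj; apply: (hh _ _).2; rewrite addrAC.
  by apply: le_trans (nsq_step_le _ _ xj) _; [lra|nra].
have M0 : 0 <= M.
  apply: le_trans (normr_ge0 (h c)) (hb _ _); rewrite subrr.
  rewrite /nsq big1 ?sqr_ge0 // => k _; by rewrite !mxE mulr0z expr0n.
have lapv x : D x -> lap v x = 0.
  by move=> Dx; rewrite /v lapB lap_shift (hD1 _ Dx) (hD2 _ _ Dx) subr0.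
have eta01 x : D x -> 0 <= eta x <= 1.
  move=> Dx; rewrite subr_ge0 ler_pdivrMr // mul1r ltW //= gerBl.
  by rewrite divr_ge0 ?nsq_ge0 ?ltW.
have lapeta x : lap eta x = - (2 * d%:R / r ^+ 2).
  rewrite /eta lapB lap_cst sub0r; congr (- _).
  rewrite -(lap_nsq R c x) mulrC -lapZ; congr (lap _ x).
  by apply/funext => y; rewrite mulrC.
have etaB x j : D x -> (eta (x + step j) - eta x) ^+ 2 <= 9 / r ^+ 2.
  move=> Dx.
  have -> : eta (x + step j) - eta x = - ((2 * scoord R (x - c) j + 1) / r ^+ 2).
    by rewrite /eta (addrAC x) nsq_step; field; rewrite gt_eqF.
  rewrite sqrrN expr_div_n ler_pdivrMr ?exprn_gt0 //.
  have -> : 9 / r ^+ 2 * (r ^+ 2) ^+ 2 = (3 * r) ^+ 2 by field; rewrite gt_eqF.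
  have : `|scoord R (x - c) j| <= r.
    rewrite -(@ler_pXn2r _ 2) ?nnegrE ?(ltW r0) // -normrX ger0_norm ?sqr_ge0 //.
    exact/ltW/(le_lt_trans (scoord2_le _ _ _)).
  rewrite ler_norml => /andP[s1 s2].
  by nra.
have lapQ x : D x -> v x ^+ 2 + \sum_j v (x + step j) ^+ 2 <= lap Q x.
  move=> Dx; rewrite /Q lapD lap_sqr ?hD1 //.
  have grad y : v y ^+ 2 <= \sum_j (h (y + step j) - h y) ^+ 2.
    by rewrite (bigD1 i) //= lerDl sumr_ge0 // => j _; rewrite sqr_ge0.
  rewrite lerD ?grad // lap_sum ler_sum // => j _.
  by rewrite (lap_shift (fun y => h y ^+ 2)) lap_sqr ?hD2 ?grad.
have lapP x : D x -> 0 <= lap P x.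
  move=> Dx; rewrite /P lapD lapZ.
  have etaP := etaB x ^~ Dx.
  have [e0 e1] := andP (eta01 x Dx).
  (* A discrete product rule: two completed squares are dropped, and the rest is linear in the
     increments of [v] and [eta], up to [(b - a)^2 (2 p^2 + q^2)]. *)
  have key j : 2 * eta x ^+ 2 * v x * (v (x + step j) - v x)
      + 2 * eta x * v x ^+ 2 * (eta (x + step j) - eta x)
      + (- (18 / r ^+ 2 * v x ^+ 2)) + (- (9 / r ^+ 2 * v (x + step j) ^+ 2)) <=
      eta (x + step j) ^+ 2 * v (x + step j) ^+ 2 - eta x ^+ 2 * v x ^+ 2.
    have := etaP j; set a := eta x; set b := eta _; set p := v x; set q := v _.
    move=> ab.
    have h1 : (b - a) ^+ 2 * (2 * p ^+ 2 + q ^+ 2) <=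
        9 / r ^+ 2 * (2 * p ^+ 2 + q ^+ 2).
      by rewrite ler_wpM2r // addr_ge0 ?sqr_ge0 // mulr_ge0 ?sqr_ge0.
    have h2 := sqr_ge0 (b * (q - p) + 2 * (b - a) * p).
    have h3 := sqr_ge0 ((b - a) * (p - q)).
    have -> : b ^+ 2 * q ^+ 2 - a ^+ 2 * p ^+ 2 =
      (b * (q - p) + 2 * (b - a) * p) ^+ 2 + ((b - a) * (p - q)) ^+ 2 +
      (2 * a ^+ 2 * p * (q - p) + 2 * a * p ^+ 2 * (b - a)
       - (b - a) ^+ 2 * (2 * p ^+ 2 + q ^+ 2)) by ring.
    have -> : 18 / r ^+ 2 = 2 * (9 / r ^+ 2) by ring.
    move: h1 h2 h3; set w := 9 / r ^+ 2; set A1 := (b * _ + _) ^+ 2.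
    set A2 := (_ * (p - q)) ^+ 2; set A3 := (b - a) ^+ 2 * _; lra.
  have : - (K / r ^+ 2) * (v x ^+ 2 + \sum_j v (x + step j) ^+ 2) <=
      lap (fun y => eta y ^+ 2 * v y ^+ 2) x.
    rewrite /lap; apply: le_trans (ler_sum _ (fun j _ => key j)).
    rewrite !big_split /= -!mulr_sumr -!/(lap _ _) lapv // lapeta.
    rewrite !sumrN -!mulr_sumr sum_cst_steps.
    set S := \sum_(_ | _) _; have S0 : 0 <= S.
      by rewrite sumr_ge0 // => j _; rewrite sqr_ge0.
    have n0 : 0 <= (d%:R : R) by [].
    have p0 := sqr_ge0 (v x); have i0 : 0 <= (r ^+ 2)^-1 by rewrite invr_ge0 ltW.
    have : 0 <= (1 - eta x) * (d%:R * v x ^+ 2 * (r ^+ 2)^-1).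
      by apply: mulr_ge0; [rewrite subr_ge0|apply: mulr_ge0 => //; exact: mulr_ge0].
    have : 0 <= d%:R * S * (r ^+ 2)^-1 by rewrite !mulr_ge0.
    have : 0 <= v x ^+ 2 * (r ^+ 2)^-1 by rewrite mulr_ge0.
    rewrite /K; move: (r ^+ 2)^-1 (v x) => ir p.
    by set m := d%:R; lra.
  have := ler_wpM2l KR0 (lapQ x Dx).
  move=> h2 h1; rewrite -lerBlDr sub0r; apply: le_trans h1.
  by rewrite mulNr lerN2.
set B := (_ + 36) * M ^+ 2 / r ^+ 2.
have Dc : D c.
  rewrite /D /= subrr /nsq big1 // => k _; by rewrite !mxE mulr0z expr0n.
have Qb y : nsq R (y - c) <= (r + 1) ^+ 2 -> Q y <= (2 * d%:R + 1) * M ^+ 2.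
  move=> yr; rewrite mulrDl mul1r addrC /Q lerD //.
    by rewrite -real_normK ?num_real // lerXn2r ?nnegrE ?hb.
  rewrite -sum_cst_steps ler_sum // => j _.
  by rewrite -real_normK ?num_real // lerXn2r ?nnegrE ?hb2.
have : 0 <= B - P c.
  apply: (@superharmonic_ge0 _ _ D (fun y => B - P y)) => //.
  - by move=> x Dx; rewrite lapB lap_cst sub0r oppr_le0 lapP.
  - move=> x j Dx nDy; rewrite subr_ge0.
    set y := x + step j.
    have y1 : nsq R (y - c) <= (r + 1) ^+ 2 by exact: nb.
    have y2 : r ^+ 2 <= nsq R (y - c) by rewrite leNgt; apply/negP.
    have vy : v y ^+ 2 <= 4 * M ^+ 2.
      have -> : 4 * M ^+ 2 = (2 * M) ^+ 2 by ring.
      rewrite -real_normK ?num_real // lerXn2r ?nnegrE ?mulr_ge0 //.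
      rewrite (le_trans (ler_normB _ _)) // mulr_natl mulr2n.
      by apply: lerD; [exact: hb2|exact: hb].
    (* At a neighbor outside the ball [eta] is not 0 but only [O(1 / r)]; this produces the summand
       [36 = 9 * 4] of the constant. *)
    have ey : eta y ^+ 2 <= 9 / r ^+ 2.
      have -> : eta y = - ((nsq R (y - c) - r ^+ 2) / r ^+ 2).
        by rewrite /eta; field; rewrite gt_eqF.
      rewrite sqrrN expr_div_n ler_pdivrMr ?exprn_gt0 //.
      have -> : 9 / r ^+ 2 * (r ^+ 2) ^+ 2 = (3 * r) ^+ 2 by field; rewrite gt_eqF.
      by nra.
    rewrite /P /B.
    apply: (le_trans (lerD (ler_pM (sqr_ge0 _) (sqr_ge0 _) ey vy)
             (ler_wpM2l KR0 (Qb _ y1)))).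
    by rewrite /K le_eqVlt; apply/orP; left; apply/eqP; ring.
  - move=> e e0; apply: (@sub_finite_set _ _ [set x | nsq R (x - c) <= r ^+ 2]).
      by move=> x [/ltW].
    have -> : [set x | nsq R (x - c) <= r ^+ 2] =
        (fun y => y + c) @` [set x : lattice d | nsq R x <= r ^+ 2].
      apply/seteqP; split => [x xr|_ [x xr <-]] /=; last by rewrite addrK.
      by exists (x - c) => //; rewrite subrK.
    exact/finite_image/finite_nsq.
rewrite subr_ge0; apply: le_trans.
rewrite /P /eta subrr.
have -> : nsq R (0 : lattice d) = 0.
  by rewrite /nsq big1 // => k _; rewrite !mxE mulr0z expr0n.
rewrite mul0r subr0 expr1n mul1r lerDl mulr_ge0 // addr_ge0 ?sqr_ge0 //.
by rewrite sumr_ge0 // => j _; rewrite sqr_ge0.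
Qed.

(** * Size of the fundamental solution *)

Lemma expR_ln1D_taylor2 (R : realType) (b t : R) :
  `|t| <= 1 / 2 -> 2 * `|b| * `|t| <= 1 ->
  `|expR (- (b * ln (1 + t))) - (1 - b * t + b * (b + 1) / 2 * t ^+ 2)| <=
    20 * (1 + `|b|) ^+ 3 * `|t| ^+ 3.
Proof.
move=> t12 bt1.
have L2 := ln1D_bound t12; have L3 := ln1D_taylor2 t12.
set L := ln (1 + t) in L2 L3 *.
have t0 : 0 <= `|t| by []. have b0 : 0 <= `|b| by [].
have t3 : `|t| ^+ 3 <= `|t| ^+ 2 / 2.
  by rewrite exprS mulrC ler_wpM2l ?exprn_ge0 // -div1r.
have t30 : 0 <= `|t| ^+ 3 by rewrite exprn_ge0.
have bL : `|- (b * L)| <= 2 * `|b| * `|t|.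
  by rewrite normrN normrM [2 * _]mulrC -mulrA ler_wpM2l.
have := expR_taylor2 (le_trans bL bt1).
set E := expR _ - _ => E3.
have E3' : `|E| <= 8 * `|b| ^+ 3 * `|t| ^+ 3.
  apply: (le_trans E3).
  have -> : 8 * `|b| ^+ 3 * `|t| ^+ 3 = (2 * `|b| * `|t|) ^+ 3 by ring.
  by rewrite lerXn2r ?nnegrE // !mulr_ge0.
have Lt : `|L - t| <= 11 * `|t| ^+ 2.
  have -> : L - t = (L - (t - t ^+ 2 / 2)) - t ^+ 2 / 2 by ring.
  rewrite (le_trans (ler_normB _ _)) //.
  have -> : `|t ^+ 2 / 2| = `|t| ^+ 2 / 2.
    by rewrite normrM normrX normfV normr_nat.
  by lra.
have Lpt : `|L + t| <= 3 * `|t|.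
  by rewrite (le_trans (ler_normD _ _)) //; lra.
have LL : `|L ^+ 2 - t ^+ 2| <= 33 * `|t| ^+ 3.
  have -> : L ^+ 2 - t ^+ 2 = (L - t) * (L + t) by ring.
  have -> : 33 * `|t| ^+ 3 = 11 * `|t| ^+ 2 * (3 * `|t|) by ring.
  by rewrite normrM ler_pM.
have -> : expR (- (b * L)) - (1 - b * t + b * (b + 1) / 2 * t ^+ 2) =
  E - b * (L - (t - t ^+ 2 / 2)) + b ^+ 2 / 2 * (L ^+ 2 - t ^+ 2).
  by rewrite /E; field.
have h1 : `|b * (L - (t - t ^+ 2 / 2))| <= `|b| * (20 * `|t| ^+ 3).
  by rewrite normrM ler_wpM2l.
have h2 : `|b ^+ 2 / 2 * (L ^+ 2 - t ^+ 2)| <= `|b| ^+ 2 / 2 * (33 * `|t| ^+ 3).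
  by rewrite normrM [`|b ^+ 2 / 2|]normrM normrX normfV normr_nat ler_wpM2l // divr_ge0 // exprn_ge0.
have bt : 0 <= `|b| * `|t| ^+ 3 by rewrite mulr_ge0.
have b2t : 0 <= `|b| ^+ 2 * `|t| ^+ 3 by rewrite mulr_ge0 ?exprn_ge0.
have b3t : 0 <= `|b| ^+ 3 * `|t| ^+ 3 by rewrite mulr_ge0 ?exprn_ge0.
have := ler_normD (E - b * (L - (t - t ^+ 2 / 2))) (b ^+ 2 / 2 * (L ^+ 2 - t ^+ 2)).
have := ler_normB E (b * (L - (t - t ^+ 2 / 2))).
have -> : 20 * (1 + `|b|) ^+ 3 * `|t| ^+ 3 = 20 * `|t| ^+ 3 +
   60 * (`|b| * `|t| ^+ 3) + 60 * (`|b| ^+ 2 * `|t| ^+ 3) +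
   20 * (`|b| ^+ 3 * `|t| ^+ 3) by ring.
lra.
Qed.

(** A regularized [2 ln |x|]: adding 1 makes it nonnegative and meaningful at 0, and [e^(-b lnu)]
    behaves like [|x|^(-2b)]. *)
Definition lnu (R : realType) (d : nat) (x : lattice d) : R := ln (nsq R x + 1).
Arguments lnu R {d} x.

Lemma nu_gt0 (R : realType) d (x : lattice d) : 0 < nsq R x + 1.
Proof. by rewrite ltr_wpDl ?nsq_ge0. Qed.

Lemma expR_lnu (R : realType) d (x : lattice d) : expR (lnu R x) = nsq R x + 1.
Proof. by rewrite lnK // posrE nu_gt0. Qed.

Lemma lnu_ge0 (R : realType) d (x : lattice d) : 0 <= lnu R x.
Proof. by rewrite ln_ge0 // lerDr nsq_ge0. Qed.

Lemma finite_lnu (R : realType) d (M : R) :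
  finite_set [set x : lattice d | lnu R x <= M].
Proof.
apply: sub_finite_set (finite_nsq d (expR M - 1)) => x /=.
by rewrite -ler_expR expR_lnu lerBrDr.
Qed.

(* The main term is that of the continuous Laplacian of |x|^(-2 b). *)
Lemma lap_nu_power (R : realType) d (b : R) :
  exists C L0, [/\ 0 <= C, 0 <= L0 & forall x : lattice d, L0 < lnu R x ->
    `|lap (fun y => expR (- (b * lnu R y))) x
       - 4 * b * (b - (d%:R - 2) / 2) * expR (- lnu R x) * expR (- (b * lnu R x))|
    <= C * expR (- (3 / 2 * lnu R x)) * expR (- (b * lnu R x))].
Proof.
have b0 : 0 <= `|b| by [].
pose C1 := 20 * (1 + `|b|) ^+ 3.
pose C2 := `|b * (b + 1) * (d%:R - 4)|.
have C10 : 0 <= C1 by rewrite mulr_ge0 // exprn_ge0 // addr_ge0.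
have b6 : 1 <= 6 * (1 + `|b|) by lra.
(* Beyond this level the square root [r] of [nsq + 1] is at least [6 (1 + |b|)], so the relative
   increments, at most [3 / r], meet both smallness conditions of the expansion. *)
exists (2 * d%:R * (27 * C1) + C2), (2 * ln (6 * (1 + `|b|))).
split; first by rewrite addr_ge0 ?normr_ge0 // mulr_ge0 // mulr_ge0.
  by rewrite mulr_ge0 // ln_ge0.
move=> x hx.
set F := expR (- (b * lnu R x)).
set r := expR (lnu R x / 2).
have r2 : r ^+ 2 = nsq R x + 1 by rewrite -expR_lnu /r -expRM_natr divfK.
have r0 : 0 < r by exact: expR_gt0.
have rb : 6 * (1 + `|b|) <= r.
  rewrite -[X in X <= _]lnK ?posrE; last by lra.
  by rewrite ler_expR; lra.
have r1 : 1 <= r by lra.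
have rn0 : r != 0 by rewrite gt_eqF.
pose t i := (2 * scoord R x i + 1) / r ^+ 2.
have tr i : `|t i| <= 3 / r.
  rewrite /t normrM normfV (gtr0_norm (exprn_gt0 2 r0)) ler_pdivrMr ?exprn_gt0 //.
  have -> : 3 / r * r ^+ 2 = 2 * r + r by field.
  rewrite (le_trans (ler_normD _ _)) // lerD ?normr1 // normrM normr_nat.
  rewrite ler_wpM2l // -(@ler_pXn2r _ 2) ?nnegrE ?(ltW r0) // -normrX.
  by rewrite ger0_norm ?sqr_ge0 // r2 (le_trans (scoord2_le _ _ _)) // lerDl.
have t12 i : `|t i| <= 1 / 2.
  by rewrite (le_trans (tr i)) // ler_pdivrMr //; lra.
have tb i : 2 * `|b| * `|t i| <= 1.
  apply: (@le_trans _ _ (2 * `|b| * (3 / r))); first by rewrite ler_wpM2l ?mulr_ge0.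
  by rewrite mulrA ler_pdivrMr //; lra.
have t3 i : `|t i| ^+ 3 <= 27 / r ^+ 3.
  have -> : 27 / r ^+ 3 = (3 / r) ^+ 3 by field.
  by rewrite lerXn2r ?nnegrE // divr_ge0 // ltW.
have lnuS i : lnu R (x + step i) = lnu R x + ln (1 + t i).
  rewrite /lnu -lnM ?posrE ?nu_gt0 //.
    congr ln; rewrite nsq_step /t r2; field; rewrite gt_eqF ?nu_gt0 //.
  by have := t12 i; rewrite ler_norml => /andP[]; lra.
have FS i : expR (- (b * lnu R (x + step i))) - F =
    F * (- b * t i + b * (b + 1) / 2 * t i ^+ 2) +
    F * (expR (- (b * ln (1 + t i))) - (1 - b * t i + b * (b + 1) / 2 * t i ^+ 2)).
  by rewrite lnuS mulrDr opprD expRD -/F; ring.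
rewrite /lap (eq_bigr _ (fun i _ => FS i)) big_split /= -!mulr_sumr big_split /=.
rewrite -!mulr_sumr.
have -> : \sum_i t i = 2 * d%:R / r ^+ 2.
  rewrite /t -mulr_suml big_split /= -mulr_sumr sum_scoord mulr0 add0r.
  by rewrite sum_cst_steps mulr1.
have -> : \sum_i t i ^+ 2 = 8 / r ^+ 2 + (2 * d%:R - 8) / (r ^+ 2) ^+ 2.
  rewrite (eq_bigr (fun i => (4 * scoord R x i ^+ 2 + 4 * scoord R x i + 1) / (r ^+ 2) ^+ 2)).
    rewrite -mulr_suml !big_split /= -!mulr_sumr sum_scoord sum_scoord2 mulr0 addr0.
    have -> : nsq R x = r ^+ 2 - 1 by rewrite r2 addrK.
    by rewrite sum_cst_steps; field.
  by move=> i _; rewrite /t; field.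
set S := \sum_i _.
have S_le : `|S| <= 2 * d%:R * (27 * C1) / r ^+ 3.
  rewrite -[X in _ <= X]mulrA -sum_cst_steps.
  rewrite (le_trans (ler_norm_sum _ _ _)) // ler_sum // => i _.
  rewrite (le_trans (expR_ln1D_taylor2 (t12 i) (tb i))) //.
  have -> : 27 * C1 / r ^+ 3 = C1 * (27 / r ^+ 3) by ring.
  by rewrite ler_wpM2l.
have eN : expR (- lnu R x) = (r ^+ 2)^-1 by rewrite expRN expR_lnu r2.
have e3 : expR (- (3 / 2 * lnu R x)) = (r ^+ 3)^-1.
  by rewrite expRN /r -expRM_natr; congr (expR _)^-1; field.
rewrite eN e3.
set X := (X in `|X|).
have -> : X = F * (b * (b + 1) * (d%:R - 4) / r ^+ 4 + S).
  by rewrite /X; field.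
rewrite normrM (gtr0_norm (expR_gt0 _)) mulrC ler_wpM2r ?expR_ge0 //.
rewrite (le_trans (ler_normD _ _)) // mulrDl addrC lerD //.
rewrite normrM ler_wpM2l // normfV ger0_norm ?exprn_ge0 ?(ltW r0) //.
by rewrite lef_pV2 ?posrE ?exprn_gt0 // ler_weXn2l.
Qed.

Lemma finite_dominated (R : realType) (T : choiceType) (A : set T) (f g : T -> R) :
  finite_set A -> (forall x, A x -> 0 < g x) ->
  exists2 C, 0 < C & forall x, A x -> f x < C * g x.
Proof.
move=> /finite_seqP[s ->] /=; elim: s => [_|a s IH gs].
  by exists 1.
have [|C C0 Cs] := IH; first by move=> x xs; apply: gs; rewrite inE xs orbT.
have ga : 0 < g a by apply: gs; rewrite mem_head.
exists (C + `|f a| / g a + 1); first by rewrite ltr_wpDr // ltr_wpDr // divr_ge0 // ltW.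
move=> x; rewrite inE => /predU1P[->|xs].
  rewrite !mulrDl divfK ?gt_eqF // mul1r.
  by have := ler_norm (f a); have := mulr_gt0 C0 ga; lra.
have gx : 0 < g x by apply: gs; rewrite inE xs orbT.
apply: lt_le_trans (Cs x xs) _; rewrite ler_wpM2r ?(ltW gx) //.
have : 0 <= `|f a| / g a by rewrite divr_ge0 // ltW.
by lra.
Qed.

Lemma lap_fundamental (R : realType) d (Phi : lattice d -> R) :
  fundamental_solution Phi -> forall x, lap Phi x = - (x == 0)%:R.
Proof. by move=> [h _] x; rewrite -laplacianE -h opprK. Qed.

Lemma finite_fundamental (R : realType) d (Phi : lattice d -> R) :
  fundamental_solution Phi ->
  forall e, 0 < e -> finite_set [set x | e <= `|Phi x|].
Proof.
move=> [_ Phi0] e e0.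
have := Phi0 _ (nbhsx_ballx (0 : R) e e0).
move=> [M _ hM].
apply: sub_finite_set (finite_nsq d (Num.max 0 M ^+ 2)) => x /= ex.
rewrite leNgt; apply/negP => Mx.
have : M < euclid_norm R x.
  rewrite /euclid_norm -/(nsq R x) (@le_lt_trans _ _ (Num.max 0 M)) ?le_max ?lexx ?orbT //.
  have m0 : 0 <= Num.max 0 M by rewrite le_max lexx.
  by rewrite -(ger0_norm m0) -sqrtr_sqr ltr_sqrt // (le_lt_trans _ Mx) // sqr_ge0.
by move=> /hM; rewrite /preimage /ball /= sub0r normrN ltNge ex.
Qed.

Lemma fundamental_gt0 (R : realType) d (Phi : lattice d -> R) :
  (0 < d)%N -> fundamental_solution Phi -> forall x, 0 < Phi x.
Proof.
move=> d0 Phif.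
have lapP := lap_fundamental Phif.
have P_ge0 x : 0 <= Phi x.
  apply: (@superharmonic_ge0 _ _ setT Phi) => // [y _|e e0].
    by rewrite lapP oppr_le0.
  apply: sub_finite_set (finite_fundamental Phif e0) => y [_ /= ye].
  by rewrite -normrN (le_trans _ (ler_norm _)) // lerNr.
move=> x; rewrite lt_def P_ge0 andbT; apply/eqP => Px.
have P0 := strong_maximum_principle P_ge0 _ Px.
have : lap Phi 0 = 0.
  rewrite /lap big1 // => i _; rewrite !P0 ?subrr // => y _; by rewrite lapP oppr_le0.
by rewrite lapP eqxx => /eqP; rewrite oppr_eq0 oner_eq0.
Qed.

(** At the exponent [b0] the main term of the Laplacian vanishes and a relative error [|x|^-3] of
    unknown sign remains. The power [b1] has a positive Laplacian, of order [|x|^(-5/2)] relative to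
    [F b0], which dominates that error. Hence [2 F b0 - F b1] is superharmonic and [F b0 + F b1]
    subharmonic near infinity, and both are comparable to [F b0]. *)
Lemma fundamental_bounds (R : realType) d (Phi : lattice d -> R) :
  (3 <= d)%N -> fundamental_solution Phi ->
  exists c C, [/\ 0 < c, 0 < C & forall x,
    c * expR (- ((d%:R - 2) / 2 * lnu R x)) <= Phi x <=
    C * expR (- ((d%:R - 2) / 2 * lnu R x))].
Proof.
move=> d3 Phif.
have d0 : (0 < d)%N by apply: leq_trans d3.
have P0 := fundamental_gt0 d0 Phif.
set b0 : R := (d%:R - 2) / 2.
have b0_gt0 : 0 < b0.
  by rewrite divr_gt0 // subr_gt0 ltr_nat.
pose F (b : R) (x : lattice d) := expR (- (b * lnu R x)).
have F0 b x : 0 < F b x by exact: expR_gt0.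
pose b1 := b0 + 1 / 4.
have [C0 [L0 [C00 L00 H0]]] := lap_nu_power d b0.
have [C1 [L1 [C10 L10 H1]]] := lap_nu_power d b1.
have b1_gt0 : 0 < b1 by rewrite /b1; lra.
have [L2 H2] := @expR_decay R (1 / 4) (C0 + C1 + C0) b1 ltac:(lra) ltac:(lra) b1_gt0.
pose L := Num.max L0 (Num.max L1 (Num.max L2 0)).
pose D := [set x : lattice d | L < lnu R x].
have F10 x : F b1 x = F b0 x * expR (- (1 / 4 * lnu R x)).
  by rewrite /F -expRD; congr expR; rewrite /b1; ring.
have lapF x : D x -> `|lap (F b0) x| * 2 <= lap (F b1) x.
  rewrite /D /L /= !gt_max => /and4P[x0 x1 x2 x3].
  have := H0 x x0; have := H1 x x1.
  rewrite -/(F b0 x) -/(F b1 x) subrr mulr0 mul0r mul0r subr0 => h1 h0.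
  have [l1 h2] := H2 _ x2.
  set l := lnu R x in x0 x1 x2 x3 h0 h1 h2 l1 *.
  set A := lap (F b0) x in h0 *; set B := lap (F b1) x in h1 *.
  set q := expR (- (1 / 4 * l)) in h2 *.
  have q0 : 0 < q by exact: expR_gt0.
  have q1 : q <= 1 by rewrite -expR0 ler_expR; lra.
  have e4 : expR (- l) = q ^+ 4 by rewrite /q -expRM_natr; congr expR; field.
  have e6 : expR (- (3 / 2 * l)) = q ^+ 6 by rewrite /q -expRM_natr; congr expR; field.
  have eF : F b1 x = F b0 x * q by rewrite F10.
  rewrite e6 in h0; rewrite e6 e4 eF in h1.
  set f := F b0 x in h0 h1; have f0 : 0 < f by exact: F0.
  set G := q ^+ 5 * f; have G0 : 0 < G by rewrite mulr_gt0 // exprn_gt0.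
  have E0 : C0 * q ^+ 6 * f = C0 * q * G by rewrite /G; ring.
  have E1 : C1 * q ^+ 6 * (f * q) <= C1 * q * G.
    have -> : C1 * q ^+ 6 * (f * q) = C1 * q * G * q by rewrite /G; ring.
    by rewrite ler_piMr // !mulr_ge0 // ltW.
  have E2 : 4 * b1 * (b1 - b0) * q ^+ 4 * (f * q) = b1 * G.
    by rewrite /G /b1; field.
  rewrite E0 in h0; rewrite E2 in h1.
  have h2' : (C0 + C1 + C0) * q <= b1.
    apply: le_trans h2; rewrite ler_wpM2r ?(ltW q0) //.
    by rewrite mulrDr mulr1 lerDl mulr_ge0 ?sqr_ge0 // !addr_ge0.
  move: h1; rewrite ler_norml => /andP[h1 _].
  have : (C0 + C1 + C0) * q * G <= b1 * G by rewrite ler_wpM2r // ltW.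
  by lra.
have finD : finite_set (~` D).
  by apply: sub_finite_set (finite_lnu d L) => x /=; rewrite /D /= => /negP; rewrite -leNgt.
have L_ge0 : 0 <= L by rewrite /L !le_max lexx !orbT.
have D0 x : D x -> lap Phi x = 0.
  move=> Dx; rewrite (lap_fundamental Phif); case: eqVneq => [x0|_]; last by rewrite oppr0.
  move: Dx; rewrite /D /= x0 /lnu.
  have -> : nsq R (0 : lattice d) = 0.
    by rewrite /nsq big1 // => k _; rewrite !mxE mulr0z expr0n.
  by rewrite add0r ln1 ltNge L_ge0.
have F1F0 x : F b1 x <= F b0 x.
  by rewrite ler_expR lerN2 ler_wpM2r ?lnu_ge0 // /b1; lra.
have finF e : 0 < e -> finite_set [set x : lattice d | e <= F b0 x].
  move=> e0; apply: sub_finite_set (finite_lnu d (- ln e / b0)) => x /=.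
  rewrite -[X in X <= _](lnK (x := e)) ?posrE // ler_expR => h.
  by rewrite ler_pdivlMr // mulrC lerNr.
have [C Cpos HC] : exists2 C, 0 < C & forall x, Phi x <= C * F b0 x.
  have [|K K0 HK] := @finite_dominated R _ (~` D) Phi (fun x => 2 * F b0 x - F b1 x) finD.
    by move=> x _; have := F1F0 x; have := F0 b0 x; lra.
  exists (2 * K); first by rewrite mulr_gt0.
  suff H x : Phi x <= K * (2 * F b0 x - F b1 x).
    move=> x; apply: le_trans (H x) _.
    by have := mulr_gt0 K0 (F0 b1 x); lra.
  have [Dx|nDx] := pselect (D x); last exact/ltW/HK.
  (* As [Phi] tends to 0 at infinity, adding the constant [e] makes the contact set finite. *)
  apply/ler_addgt0Pr => e e0; rewrite leNgt; apply/negP => h.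
  have [|||y [t [Dy /andP[t0 _] _]]] := @touching R d D
    (fun x => K * (2 * F b0 x - F b1 x) + e) Phi x d0 _ _ _ Dx h.
  - move=> y _; rewrite ltr_wpDl // mulr_ge0 ?(ltW K0) //.
    by have := F1F0 y; have := F0 b0 y; lra.
  - move=> y i _ /HK h2; split; last by rewrite (lt_trans h2) // ltrDl.
    by rewrite (lt_trans _ (lt_trans h2 _)) // ltrDl.
  - apply: sub_finite_set (finite_fundamental Phif e0) => y /= [_ hy].
    rewrite (le_trans _ (ler_norm _)) // (le_trans _ hy) // lerDr.
    rewrite mulr_ge0 ?(ltW K0) //.
    by have := F1F0 y; have := F0 b0 y; lra.
  - rewrite D0 // mulr0 lapD lapZ lap_cst addr0 lapB lapZ pmulr_rgt0 //.
    have := lapF y Dy; have := ler_norm (lap (F b0) y).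
    by lra.
have [c cpos Hc] : exists2 c, 0 < c & forall x, F b0 x <= c * Phi x.
  have [|K K0 HK] := @finite_dominated R _ (~` D) (fun x => F b0 x + F b1 x) Phi finD.
    by move=> x _.
  exists K => //.
  suff H x : F b0 x + F b1 x <= K * Phi x.
    move=> x; apply: le_trans (H x); by rewrite lerDl ltW.
  have [Dx|nDx] := pselect (D x); last exact/ltW/HK.
  apply/ler_addgt0Pr => e e0; rewrite leNgt; apply/negP => h.
  have [|||y [t [Dy /andP[t0 _] _]]] := @touching R d D
    (fun x => K * Phi x + e) (fun x => F b0 x + F b1 x) x d0 _ _ _ Dx h.
  - by move=> y _; rewrite addr_gt0 // mulr_gt0.
  - move=> y i _ /HK h2; split; last by rewrite (lt_trans h2) // ltrDl.
    by rewrite addr_gt0 // mulr_gt0.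
  - have e2 : 0 < e / 2 by rewrite divr_gt0.
    apply: sub_finite_set (finF _ e2) => y /= [_ hy].
    rewrite ler_pdivrMr //; have := F1F0 y; have := mulr_gt0 K0 (P0 y); lra.
  - rewrite !lapD lapZ lap_cst addr0 D0 // mulr0 pmulr_rlt0 //.
    have := lapF y Dy; have := ler_norm (- lap (F b0) y); rewrite normrN.
    have := normr_ge0 (lap (F b0) y).
    by lra.
exists c^-1, C; split; rewrite ?invr_gt0 // => x.
apply/andP; split; last exact: HC.
by rewrite -(ler_pM2l cpos) mulrA mulfV ?gt_eqF // mul1r; exact: Hc.
Qed.

(** The Bernstein estimate is applied on the ball of radius [|x| / 2] around [x], that is with
    [r = |x| / 4]: this ball avoids the pole, and [Phi] has size [|x|^(2-d)] on it. The threshold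
    [ln 66] ensures [2 <= r]. *)
Lemma fundamental_gradient (R : realType) d (Phi : lattice d -> R) :
  (3 <= d)%N -> fundamental_solution Phi ->
  exists C L0, 0 < C /\ forall x, L0 < lnu R x -> forall i,
    `|Phi (x + step i) - Phi x| <=
      C * expR (- (lnu R x / 2)) * expR (- ((d%:R - 2) / 2 * lnu R x)).
Proof.
move=> d3 Phif.
have d0 : (0 < d)%N by apply: leq_trans d3.
have P0 := fundamental_gt0 d0 Phif.
have [c [C [c0 C0 HC]]] := fundamental_bounds d3 Phif.
set b0 : R := (d%:R - 2) / 2 in HC *.
have b0_gt0 : 0 < b0.
  by rewrite divr_gt0 // subr_gt0 ltr_nat.
set K : R := (40 * d%:R + 9) * (2 * d%:R + 1) + 36.
have K0 : 0 <= K by rewrite addr_ge0 ?mulr_ge0 // addr_ge0 ?mulr_ge0.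
have C40 : 0 < C * expR (b0 * ln 4) by rewrite mulr_gt0 ?expR_gt0.
exists ((1 + 32 * K) * (C * expR (b0 * ln 4))), (ln 66); split.
  by rewrite mulr_gt0 //; lra.
move=> x; rewrite -ltr_expR expR_lnu lnK ?posrE // => hx i.
have n0 : 0 < nsq R x by lra.
pose r := Num.sqrt (nsq R x) / 4.
have r2 : r ^+ 2 = nsq R x / 16.
  by rewrite /r expr_div_n sqr_sqrtr ?ltW //; field.
have r_ge2 : 2 <= r.
  rewrite -(@ler_pXn2r _ 2) ?nnegrE // ?divr_ge0 ?sqrtr_ge0 // r2; lra.
pose F := expR (- (b0 * lnu R x)).
have F0 : 0 < F by exact: expR_gt0.
have hz z : nsq R (z - x) <= 4 * r ^+ 2 ->
    lap Phi z = 0 /\ `|Phi z| <= C * expR (b0 * ln 4) * F.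
  rewrite r2 => zx; have := nsqB_le R x z => xz.
  split.
    rewrite (lap_fundamental Phif); case: eqVneq => [z0|_]; last by rewrite oppr0.
    move: xz; rewrite [nsq R z]big1; first lra.
    by move=> k _; rewrite z0 mxE expr0n.
  rewrite gtr0_norm // (le_trans (andP (HC z)).2) //.
  rewrite -mulrA ler_wpM2l ?(ltW C0) // /F -expRD ler_expR.
  have : lnu R x <= lnu R z + ln 4.
    rewrite -ler_expR expRD !expR_lnu lnK ?posrE //; lra.
  by move=> h; have := ler_wpM2l (ltW b0_gt0) h; lra.
have := bernstein_gradient d0 r_ge2 hz i; rewrite -/K r2 => h.
set E := expR (- (lnu R x / 2)).
have E0 : 0 < E by exact: expR_gt0.
have E2 : E ^+ 2 = (nsq R x + 1)^-1.
  by rewrite /E -expRM_natr -expR_lnu -expRN; congr expR; field.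
set M := C * expR (b0 * ln 4) in C40 h *.
have rhs0 : 0 <= (1 + 32 * K) * M * E * F.
  by rewrite (mulr_ge0 (mulr_ge0 (mulr_ge0 _ (ltW C40)) (ltW E0)) (ltW F0)) //; lra.
rewrite -(@ler_pXn2r _ 2) ?nnegrE //.
rewrite real_normK ?num_real // (le_trans h) //.
have -> : ((1 + 32 * K) * M * E * F) ^+ 2 =
    (1 + 32 * K) ^+ 2 / (nsq R x + 1) * (M * F) ^+ 2 by rewrite -E2; ring.
have -> : K * (M * F) ^+ 2 / (nsq R x / 16) = 16 * K / nsq R x * (M * F) ^+ 2.
  by field; rewrite gt_eqF.
rewrite ler_wpM2r ?sqr_ge0 // ler_pdivrMr // mulrAC ler_pdivlMr; last lra.
have : 0 <= K * nsq R x by rewrite mulr_ge0 // ltW.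
have : 0 <= K ^+ 2 * nsq R x by rewrite mulr_ge0 ?sqr_ge0 // ltW.
have : 0 <= K * (nsq R x - 1) by rewrite mulr_ge0 //; lra.
by lra.
Qed.

(* All estimates near infinity are expressed through s = - ln Phi, which grows
   like (d - 2) ln |x|; gamma stands for 1 / (d - 2). *)
Definition log_regular (R : realType) (d : nat) (s : lattice d -> R)
    (gamma C S0 : R) : Prop :=
  [/\ 0 < gamma, 0 <= C,
      forall M, finite_set [set x | s x <= M] &
      forall x, S0 < s x -> lap (fun y => expR (- s y)) x = 0 /\
        forall i, `|s (x + step i) - s x| <= C * expR (- (gamma * s x))].

(** Along a step [s] changes by [- ln (1 + t)], where [t] is the relative increment of [Phi], of
    order [1 / |x|]. With [gamma = 1 / (d - 2)], the function [e^(-gamma s)] is comparable to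
    [1 / |x|]. *)
Lemma fundamental_log_regular (R : realType) d (Phi : lattice d -> R) :
  (3 <= d)%N -> fundamental_solution Phi ->
  exists C S0 K, log_regular (fun x => - ln (Phi x)) (d%:R - 2)^-1 C S0 /\
    forall x, `|- ln (Phi x) - (d%:R - 2) / 2 * lnu R x| <= K.
Proof.
move=> d3 Phif.
have d0 : (0 < d)%N by apply: leq_trans d3.
have P0 := fundamental_gt0 d0 Phif.
have D0 : 0 < (d%:R - 2 : R) by rewrite subr_gt0 ltr_nat.
have [c [C [c0 C0 HC]]] := fundamental_bounds d3 Phif.
have [C1 [L0 [C10 HG]]] := fundamental_gradient d3 Phif.
set b0 : R := (d%:R - 2) / 2 in HC HG *.
have b0_gt0 : 0 < b0 by rewrite divr_gt0.
pose K := `|ln c| + `|ln C|.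
have HK x : `|- ln (Phi x) - b0 * lnu R x| <= K.
  have [h1 h2] := andP (HC x).
  have lc : ln c - b0 * lnu R x <= ln (Phi x).
    by rewrite -ler_expR expRD !lnK ?posrE.
  have lC : ln (Phi x) <= ln C - b0 * lnu R x.
    by rewrite -ler_expR expRD !lnK ?posrE.
  rewrite ler_norml /K; have := ler_norm (- ln c); rewrite normrN.
  have := ler_norm (ln C); have := normr_ge0 (ln c); have := normr_ge0 (ln C).
  by move=> *; apply/andP; split; lra.
have K0 : 0 <= K by apply: le_trans (HK 0).
pose B := C1 / c.
have B0 : 0 < B by rewrite divr_gt0.
have B2 : 0 < 2 * B by rewrite mulr_gt0.
pose l1 := Num.max 0 (Num.max L0 (2 * ln (2 * B))).
exists (2 * B * expR (K * (d%:R - 2)^-1)), (b0 * l1 + K), K.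
split=> //; split.
- by rewrite invr_gt0.
- by rewrite mulr_ge0 ?expR_ge0 // ltW.
- move=> M; apply: sub_finite_set (finite_lnu d ((M + K) / b0)) => x /= xM.
  rewrite ler_pdivlMr // mulrC.
  by have := HK x; rewrite ler_norml => /andP[]; lra.
move=> x hx.
have hl : l1 < lnu R x.
  rewrite -(@ltr_pM2l _ b0) //.
  by have := HK x; rewrite ler_norml => /andP[]; lra.
move: hl; rewrite /l1 !gt_max => /and3P[h0 hL hB].
split.
  have -> : (fun y => expR (- - ln (Phi y))) = Phi.
    by apply/funext => y; rewrite opprK lnK ?posrE.
  rewrite (lap_fundamental Phif); case: eqVneq => [x0|_]; last by rewrite oppr0.
  move: h0; rewrite x0 /lnu [nsq R _]big1; last by move=> k _; rewrite mxE expr0n.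
  by rewrite add0r ln1 ltxx.
move=> i.
pose t := (Phi (x + step i) - Phi x) / Phi x.
have e2 : expR (- (lnu R x / 2)) <= (2 * B)^-1.
  rewrite expRN lef_pV2 ?posrE ?expR_gt0 //.
  by rewrite -[X in X <= _]lnK ?posrE // ler_expR; lra.
have tB : `|t| <= B * expR (- (lnu R x / 2)).
  rewrite /t normrM normfV (gtr0_norm (P0 x)) ler_pdivrMr //.
  rewrite (le_trans (HG x hL i)) //.
  have -> : B * expR (- (lnu R x / 2)) * Phi x =
    C1 * expR (- (lnu R x / 2)) * (Phi x / c) by rewrite /B; ring.
  rewrite ler_wpM2l ?(mulr_ge0 (ltW C10)) ?expR_ge0 //.
  by rewrite ler_pdivlMr // mulrC; exact: (andP (HC x)).1.
have t12 : `|t| <= 1 / 2.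
  apply: (le_trans tB); apply: le_trans (ler_wpM2l (ltW B0) e2) _.
  by rewrite le_eqVlt; apply/orP; left; apply/eqP; field; rewrite gt_eqF.
have -> : - ln (Phi (x + step i)) - - ln (Phi x) = - ln (1 + t).
  have -> : Phi (x + step i) = Phi x * (1 + t) by rewrite /t; field; rewrite gt_eqF.
  rewrite lnM ?posrE //; first by ring.
  by move: t12; rewrite ler_norml => /andP[]; lra.
rewrite normrN (le_trans (ln1D_bound t12)) //.
set e := expR (K / _); set e' := expR (- _).
have -> : 2 * B * e * e' = 2 * (B * (e * e')) by ring.
apply: ler_wpM2l => //; apply: (le_trans tB); apply: ler_wpM2l; first exact: ltW.
rewrite -expRD ler_expR.
have -> : K * (d%:R - 2)^-1 - (d%:R - 2)^-1 * - ln (Phi x) =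
  (K - - ln (Phi x)) / (d%:R - 2) by ring.
rewrite lerNl -mulNr ler_pdivrMr //.
have := HK x; rewrite ler_norml => /andP[_].
by rewrite /b0; lra.
Qed.

(** * Radial functions of the logarithm of the fundamental solution *)

(** Each direction is counted with both signs, so this approximates twice the continuous
    [|grad s|^2]; hence the factors [grad2 / 2] below. *)
Definition grad2 (R : realType) (d : nat) (s : lattice d -> R) (x : lattice d) : R :=
  \sum_i (s (x + step i) - s x) ^+ 2.

Lemma grad2_ge0 (R : realType) d (s : lattice d -> R) x : 0 <= grad2 s x.
Proof. by rewrite sumr_ge0 // => i _; rewrite sqr_ge0. Qed.

(** Discrete counterpart of [Delta s = |grad s|^2]: harmonicity of [e^(-s)] means that [e^(-v) - 1]
    sums to 0 over the increments [v], and its second order expansion relates the sums of [v] and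
    [v^2]. *)
Lemma sum_increments (R : realType) d (s : lattice d -> R) x (r : R) :
  lap (fun y => expR (- s y)) x = 0 ->
  (forall i, `|s (x + step i) - s x| <= r) -> r <= 1 ->
  `|\sum_i (s (x + step i) - s x) - grad2 s x / 2| <= r * grad2 s x.
Proof.
move=> harm sr r1.
pose v i := s (x + step i) - s x.
have E : \sum_i (expR (- v i) - 1) = 0.
  have : expR (- s x) * \sum_i (expR (- v i) - 1) = 0.
    rewrite -[RHS]harm /lap mulr_sumr; apply: eq_bigr => i _.
    by rewrite mulrBr mulr1 -expRD; congr (expR _ - _); rewrite /v; ring.
  by move/eqP; rewrite mulf_eq0 gt_eqF ?expR_gt0 //= => /eqP.
have -> : \sum_i v i - grad2 s x / 2 =
    \sum_i (expR (- v i) - (1 + - v i + (- v i) ^+ 2 / 2)).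
  transitivity (\sum_i (v i - v i ^+ 2 / 2) + \sum_i (expR (- v i) - 1)).
    by rewrite E addr0 [RHS]sumrB -mulr_suml.
  by rewrite -big_split; apply: eq_bigr => i _ /=; ring.
rewrite (le_trans (ler_norm_sum _ _ _)) // mulr_sumr ler_sum // => i _.
have vi1 : `|- v i| <= 1 by rewrite normrN (le_trans (sr i)).
apply: (le_trans (expR_taylor2 vi1)); rewrite normrN.
by rewrite exprS real_normK ?num_real // ler_wpM2r ?sqr_ge0 //; exact: sr.
Qed.

(** [q0], [q1], [q2] play the roles of [h], [h'], [h''] at [s x]. [K] and [S1] are chosen before
    [h], so the estimate is uniform in the center and width of a bump, and [M] may grow with
    [s x]. *)
Lemma lap_radial (R : realType) d (s : lattice d -> R) (gamma C S0 a : R) :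
  log_regular s gamma C S0 ->
  exists K S1, [/\ 0 <= K, S0 <= S1 &
    forall (h : R -> R) x q0 q1 q2 M, S1 < s x ->
    `|q0| <= M -> `|q1| <= M -> `|q2| <= M ->
    (forall v, `|v| <= 1 ->
      `|h (s x + v) - (q0 + q1 * v + q2 / 2 * v ^+ 2)| <= M * `|v| ^+ 3) ->
    `|lap (fun y => expR (- (a * s y)) * h (s y)) x -
      grad2 s x / 2 * expR (- (a * s x)) *
        ((a ^+ 2 - a) * q0 + (1 - 2 * a) * q1 + q2)|
    <= K * M * expR (- (gamma * s x)) * grad2 s x * expR (- (a * s x))].
Proof.
move=> [g0 C0 _ reg].
have a0 : 0 <= `|a| by [].
have aC : 0 <= (1 + `|a|) * C by rewrite mulr_ge0 // addr_ge0.
have [S1 dec] := expR_decay g0 aC (ltr01 : 0 < 1 :> R).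
exists (5 * (1 + `|a|) ^+ 3 * C), (Num.max S0 S1); split.
- by rewrite !mulr_ge0 // exprn_ge0 // addr_ge0.
- by rewrite le_max lexx.
move=> h x q0 q1 q2 M; rewrite gt_max => /andP[x0 x1] q0M q1M q2M hT.
have [harm inc] := reg x x0.
have [s1 decx] := dec _ x1.
set r := C * expR (- (gamma * s x)) in inc.
have r0 : 0 <= r by rewrite mulr_ge0 // expR_ge0.
have ar1 : (1 + `|a|) * r <= 1.
  apply: le_trans decx; rewrite /r mulrA ler_wpM2r ?expR_ge0 //.
  by rewrite mulrDr mulr1 lerDl mulr_ge0 ?sqr_ge0.
have r1 : r <= 1.
  by apply: le_trans ar1; rewrite mulrDl mul1r lerDl mulr_ge0.
have M0 : 0 <= M by apply: le_trans q0M.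
pose v i := s (x + step i) - s x.
have v1 i : `|v i| <= 1 by apply: le_trans (inc i) r1.
have av1 i : `|a * v i| <= 1.
  rewrite normrM; apply: le_trans ar1; rewrite mulrDl mul1r.
  by rewrite ler_wpDl // ler_wpM2l //; exact: inc.
set G := grad2 s x.
have hx : h (s x) = q0.
  have := hT 0; rewrite normr0 ler01 !mulr0 !expr0n !mulr0 !addr0 => /(_ isT).
  by rewrite normr_le0 subr_eq0 => /eqP.
pose A1 := q1 - a * q0; pose A2 := q2 - 2 * a * q1 + a ^+ 2 * q0.
pose e i := expR (- (a * v i)) * h (s x + v i) - (q0 + A1 * v i + A2 / 2 * v i ^+ 2).
have eB i : `|e i| <= 4 * (1 + `|a|) ^+ 3 * M * (r * v i ^+ 2).
  have -> : e i = expR (- (a * v i)) * (q0 + q1 * v i + q2 / 2 * v i ^+ 2 +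
      (h (s x + v i) - (q0 + q1 * v i + q2 / 2 * v i ^+ 2))) -
     (q0 + A1 * v i + A2 / 2 * v i ^+ 2).
    by rewrite /e; congr (_ * _ - _); ring.
  rewrite (le_trans (expR_mul_taylor2 (v1 i) (av1 i) q0M q1M q2M (hT _ (v1 i)))) //.
  rewrite ler_wpM2l // ?mulr_ge0 ?exprn_ge0 ?addr_ge0 //.
  by rewrite exprS real_normK ?num_real // ler_wpM2r ?sqr_ge0 // (inc i).
set E := expR (- (a * s x)).
have -> : lap (fun y => expR (- (a * s y)) * h (s y)) x =
    E * (A1 * (\sum_i v i) + A2 / 2 * G + \sum_i e i).
  rewrite /lap /G /grad2 !mulr_sumr -!big_split /= mulr_sumr; apply: eq_bigr => i _.
  rewrite /e hx /v.
  have -> : s x + (s (x + step i) - s x) = s (x + step i) by ring.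
  rewrite mulrDr; set Y := h _.
  have -> : expR (- (a * s (x + step i))) = E * expR (- (a * (s (x + step i) - s x))).
    by rewrite /E -expRD; congr expR; move: (s (x + step i)) => z; ring.
  by rewrite -/(v i) -/E; set ee := expR (- (a * v i)); ring.
have -> : E * (A1 * (\sum_i v i) + A2 / 2 * G + \sum_i e i) -
   G / 2 * E * ((a ^+ 2 - a) * q0 + (1 - 2 * a) * q1 + q2) =
   E * (A1 * (\sum_i v i - G / 2) + \sum_i e i).
  by rewrite /A1 /A2; field.
rewrite normrM (gtr0_norm (expR_gt0 _)) mulrC ler_wpM2r ?expR_ge0 //.
have -> : 5 * (1 + `|a|) ^+ 3 * C * M * expR (- (gamma * s x)) * G =
   (1 + `|a|) ^+ 3 * M * (r * G) + 4 * (1 + `|a|) ^+ 3 * M * (r * G).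
  by rewrite /r; ring.
rewrite (le_trans (ler_normD _ _)) // lerD //.
  rewrite normrM; apply: ler_pM => //; last exact: sum_increments.
  apply: (@le_trans _ _ ((1 + `|a|) * M)).
    rewrite (le_trans (ler_normB _ _)) // mulrDl mul1r lerD // normrM.
    by rewrite ler_wpM2l.
  rewrite ler_wpM2r // -[X in X <= _]expr1 ler_weXn2l //; lra.
rewrite (le_trans (ler_norm_sum _ _ _)) // /G /grad2 !mulr_sumr ler_sum //.
Qed.

Lemma lap_power (R : realType) d (s : lattice d -> R) (gamma C S0 a : R) :
  log_regular s gamma C S0 ->
  exists K S1, [/\ 0 <= K, S0 <= S1 & forall x, S1 < s x ->
    `|lap (fun y => expR (- (a * s y))) x -
      grad2 s x / 2 * expR (- (a * s x)) * (a ^+ 2 - a)|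
    <= K * expR (- (gamma * s x)) * grad2 s x * expR (- (a * s x))].
Proof.
move=> reg; have [K [S1 [K0 S01 H]]] := lap_radial a reg.
exists K, S1; split=> // x xS.
have := H (fun=> 1) x 1 0 0 1 xS; rewrite normr1 normr0 lexx ler01 => /(_ isT isT isT).
rewrite !mulr0 !mulr1 !addr0 => h.
have -> : (fun y => expR (- (a * s y))) = (fun y => expR (- (a * s y)) * 1).
  by apply/funext => y; rewrite mulr1.
apply: h => v _; rewrite !mul0r !addr0 subrr normr0 mul1r exprn_ge0 //.
Qed.

(** * Bumps and the Hardy constant *)

(* A bump that changes sign at +-1 while being strictly convex there. *)
Definition quartic (R : realType) (X : R) : R := (1 - X ^+ 2) * (2 - X ^+ 2).

Lemma bump_gt0 (R : realType) (X : R) : `|X| < 1 -> 0 < quartic X <= 2.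
Proof.
rewrite ltr_norml => /andP[h1 h2].
have X2 : 0 <= X ^+ 2 < 1 by rewrite sqr_ge0 /=; nra.
by rewrite /quartic; case/andP: X2 => ? ?; apply/andP; split; nra.
Qed.

(** [quartic] is positive again beyond [sqrt 2]. The bound [7 / 5] leaves room for one step out of
    the annulus, by at most [2 / 5] of its width. *)
Lemma bump_le0 (R : realType) (X : R) : 1 <= `|X| -> `|X| <= 7 / 5 -> quartic X <= 0.
Proof.
move=> h1 h2; rewrite /quartic -(real_normK (num_real X)).
set Y := `|X| in h1 h2 *.
by rewrite mulr_le0_ge0 //; nra.
Qed.

(** [12 X^2 - 6] is the second derivative of [quartic]: near the edge the bump is convex, elsewhere
    it is bounded below, so that a small excess of potential can pay for its concavity. The split is
    at [X^2 = 2 / 3]. *)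
Lemma bump_alt (R : realType) (X : R) : `|X| < 1 ->
  2 <= 12 * X ^+ 2 - 6 \/ 4 / 9 <= quartic X /\ - 6 <= 12 * X ^+ 2 - 6.
Proof.
rewrite ltr_norml => /andP[h1 h2].
have X2 : 0 <= X ^+ 2 by exact: sqr_ge0.
have [h|h] := leP (2 / 3) (X ^+ 2); first by left; lra.
right; rewrite /quartic; split; nra.
Qed.

Lemma bump_taylor (R : realType) (X l v : R) : `|X| <= 1 -> 1 <= l -> `|v| <= 1 ->
  `|quartic (X + v / l) - (quartic X + (4 * X ^+ 3 - 6 * X) / l * v +
     (12 * X ^+ 2 - 6) / l ^+ 2 / 2 * v ^+ 2)| <= 10 * `|v| ^+ 3.
Proof.
move=> X1 l1 v1.
have l0 : 0 < l by lra.
have -> : quartic (X + v / l) - (quartic X + (4 * X ^+ 3 - 6 * X) / l * v +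
     (12 * X ^+ 2 - 6) / l ^+ 2 / 2 * v ^+ 2) = v ^+ 3 * ((4 * X + v / l) / l ^+ 3).
  by rewrite /quartic; field; rewrite gt_eqF.
rewrite normrM normrX mulrC ler_wpM2r ?exprn_ge0 //.
rewrite normrM normfV (ger0_norm (exprn_ge0 3 (ltW l0))) ler_pdivrMr ?exprn_gt0 //.
have l3 : 1 <= l ^+ 3 by rewrite exprn_ege1.
apply: (@le_trans _ _ 10); last by rewrite ler_peMr.
rewrite (le_trans (ler_normD _ _)) // !normrM normfV normr_nat (gtr0_norm l0).
have : `|v| / l <= 1 by rewrite ler_pdivrMr // mul1r (le_trans v1).
by lra.
Qed.

Lemma bump_coef_bounds (R : realType) (X l : R) : `|X| <= 1 -> 1 <= l ->
  [/\ `|quartic X| <= 10, `|(4 * X ^+ 3 - 6 * X) / l| <= 10 &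
      `|(12 * X ^+ 2 - 6) / l ^+ 2| <= 10].
Proof.
move=> X1 l1; have l0 : 0 < l by lra.
have X2 : `|X| ^+ 2 <= 1 by rewrite exprn_ile1.
have X3 : `|X| ^+ 3 <= 1 by rewrite exprn_ile1.
have X20 := sqr_ge0 X.
rewrite -normrX (ger0_norm X20) in X2.
rewrite -normrX in X3.
have l2 : 1 <= l ^+ 2 by rewrite exprn_ege1.
split.
- by rewrite /quartic ler_norml; apply/andP; split; nra.
- rewrite normrM normfV (gtr0_norm l0) ler_pdivrMr // (le_trans (ler_normB _ _)) //.
  have : `|4 * X ^+ 3| <= 4 by rewrite normrM normr_nat; lra.
  have : `|6 * X| <= 6 by rewrite normrM normr_nat; lra.
  by lra.
- rewrite normrM normfV (gtr0_norm (exprn_gt0 2 l0)) ler_pdivrMr ?exprn_gt0 //.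
  apply: (@le_trans _ _ 10); last by rewrite ler_peMr.
  by rewrite ler_norml; apply/andP; split; nra.
Qed.

Lemma lattice_infinite d : (0 < d)%N -> ~ finite_set [set: lattice d].
Proof.
move=> d0 fin.
have [x _ [_]] := @extremal_argmin _ int d (Ordinal d0) setT (fun=> 0) 0 fin I.
by rewrite ltxx => /(_ I).
Qed.

(** At [a = 1 / 2] the coefficient [1 - 2 a] vanishes and [a^2 - a] takes its minimum [- 1 / 4]:
    only the bump and its second derivative remain, and Hardy's constant appears. *)
Lemma lap_bump (R : realType) d (s : lattice d -> R) (gamma C S0 : R) :
  log_regular s gamma C S0 ->
  exists K S1, [/\ 0 <= K, S0 <= S1 & forall S l x, 1 <= l -> `|s x - S| <= l ->
    S1 < s x ->
    `|lap (fun y => expR (- (1 / 2 * s y)) * quartic ((s y - S) / l)) x -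
      grad2 s x / 2 * expR (- (1 / 2 * s x)) *
        ((12 * ((s x - S) / l) ^+ 2 - 6) / l ^+ 2 - quartic ((s x - S) / l) / 4)|
    <= K * expR (- (gamma * s x)) * grad2 s x * expR (- (1 / 2 * s x))].
Proof.
move=> reg; have [K [S1 [K0 S01 H]]] := lap_radial (1 / 2) reg.
exists (K * 10), S1; split; rewrite ?mulr_ge0 // => S l x l1 xl xS.
have l0 : 0 < l by lra.
set X := (s x - S) / l.
have X1 : `|X| <= 1 by rewrite normrM normfV (gtr0_norm l0) ler_pdivrMr // mul1r.
have [b0 b1 b2] := bump_coef_bounds X1 l1.
have := H (fun z => quartic ((z - S) / l)) x _ _ _ _ xS b0 b1 b2.
have -> : ((1 / 2) ^+ 2 - 1 / 2) * quartic X + (1 - 2 * (1 / 2)) * ((4 * X ^+ 3 - 6 * X) / l) +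
   (12 * X ^+ 2 - 6) / l ^+ 2 = (12 * X ^+ 2 - 6) / l ^+ 2 - quartic X / 4 by field; rewrite gt_eqF.
apply=> v v1.
have -> : (s x + v - S) / l = X + v / l by rewrite /X; field; rewrite gt_eqF.
exact: bump_taylor.
Qed.

(* Sliding the bump below u over the annulus |s - s a| < l. *)
Lemma bump_touching (R : realType) d (s : lattice d -> R) (gamma C S0 : R) :
  (0 < d)%N -> log_regular s gamma C S0 ->
  exists K S1, [/\ 0 <= K, 0 <= S1 & forall (u : lattice d -> R) a l T,
    (forall x, 0 < u x) -> 1 <= l -> S1 + l < s a -> 0 < T ->
    u a < T * expR (- (1 / 2 * s a)) ->
    exists x X t, [/\ `|X| < 1, s x = s a + l * X, 0 < t <= T / 2,
      u x = t * expR (- (1 / 2 * s x)) * quartic X &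
      t * (grad2 s x * expR (- (1 / 2 * s x)) *
        (((12 * X ^+ 2 - 6) / l ^+ 2 - quartic X / 4) / 2 - K * expR (- (gamma * s x))))
      < lap u x]].
Proof.
move=> d0 reg; have [K [S1 [K0 S01 H]]] := lap_bump reg.
have [g0 C0 fin regx] := reg.
have [S2 dec] := @expR_decay R gamma C (2 / 5) g0 C0 ltac:(lra).
pose S3 := Num.max 0 (Num.max S1 S2).
exists K, S3; split=> //; first by rewrite le_max lexx.
move=> u a l T u0 l1 al T0 ua.
have l0 : 0 < l by lra.
pose D := [set x | `|s x - s a| < l].
(* The division by 2 compensates [quartic 0 = 2], so that [w a = T e^(-s a / 2)]. *)
pose w x := T / 2 * (expR (- (1 / 2 * s x)) * quartic ((s x - s a) / l)).
have DS x : D x -> S3 < s x by rewrite /D /= ltr_norml => /andP[]; lra.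
have T20 : 0 < T / 2 by rewrite divr_gt0.
have nX x : `|(s x - s a) / l| = `|s x - s a| / l.
  by rewrite normrM normfV (gtr0_norm l0).
have Da : D a by rewrite /D /= subrr normr0.
have ua' : u a < w a.
  have b0 : quartic ((s a - s a) / l) = 2 by rewrite subrr mul0r /quartic; ring.
  rewrite /w b0.
  by have -> : T / 2 * (expR (- (1 / 2 * s a)) * 2) = T * expR (- (1 / 2 * s a)) by field.
have bd x i : D x -> ~ D (x + step i) -> 0 < u (x + step i) /\ w (x + step i) < u (x + step i).
  move=> Dx nDy; split=> //; apply: le_lt_trans (u0 _).
  rewrite /w mulr_ge0_le0 ?(ltW T20) // mulr_ge0_le0 ?expR_ge0 //.
  have yl : l <= `|s (x + step i) - s a| by rewrite leNgt; exact/negP.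
  apply: bump_le0; rewrite nX; first by rewrite ler_pdivlMr // mul1r.
  rewrite ler_pdivrMr //.
  have := DS x Dx; rewrite /S3 !gt_max => /and3P[x0 x1 x2].
  have [_ /(_ i) hi] := regx x (le_lt_trans S01 x1).
  have [_ hd] := dec _ x2.
  have h25 : C * expR (- (gamma * s x)) <= 2 / 5.
    apply: le_trans hd; rewrite ler_wpM2r ?expR_ge0 //.
    by rewrite mulrDr mulr1 lerDl mulr_ge0 ?sqr_ge0.
  have -> : s (x + step i) - s a = (s x - s a) + (s (x + step i) - s x) by ring.
  rewrite (le_trans (ler_normD _ _)) //; move: Dx; rewrite /D /= => Dx.
  by lra.
have finD : finite_set [set x | D x /\ u x <= w x].
  apply: sub_finite_set (fin (s a + l)) => x [Dx _] /=.
  by move: Dx; rewrite /D /= ltr_norml => /andP[]; lra.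
have [x [t [Dx /andP[t0 t1] ux tl]]] := touching d0 (fun x _ => u0 x) bd finD Da ua'.
exists x, ((s x - s a) / l), (t * (T / 2)); split.
- by rewrite nX ltr_pdivrMr // mul1r.
- by field; rewrite gt_eqF.
- by rewrite mulr_gt0 //= ler_piMl // ltW.
- by rewrite ux /w; ring.
- apply: le_lt_trans tl; rewrite /w lapZ [X in _ <= X]mulrA.
  apply: ler_wpM2l; first by rewrite mulr_ge0 ?(ltW t0) ?(ltW T20).
  have := DS x Dx; rewrite /S3 !gt_max => /and3P[x0 x1 x2].
  have := H (s a) l x l1 (ltW Dx) x1; rewrite ler_norml => /andP[h _].
  set A := lap _ _ in h *; set E := expR (- (1 / 2 * s x)) in h *.
  set q := expR (- (gamma * s x)) in h *; set X := (s x - s a) / l in h *.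
  set B := (12 * X ^+ 2 - 6) / l ^+ 2 in h *.
  by lra.
Qed.

Lemma exists_large (R : realType) d (s : lattice d -> R) M :
  (0 < d)%N -> finite_set [set x | s x <= M] -> exists a, M < s a.
Proof.
move=> d0 fin; apply/not_existsP => h; apply: (lattice_infinite d0).
apply: sub_finite_set fin => x _ /=; rewrite leNgt; exact/negP/h.
Qed.

(** The inequality is linear, so the amplitude of the bump is free. The width satisfies
    [8 / l^2 <= eta]: where the bump exceeds [4 / 9], the excess [eta] pays for the concavity
    [- 6 / l^2], and near the edge convexity suffices. *)
Lemma no_supercritical (R : realType) d (s : lattice d -> R) (gamma C S0 : R)
    (u : lattice d -> R) (eta S1 : R) :
  (0 < d)%N -> log_regular s gamma C S0 -> (forall x, 0 < u x) -> 0 < eta ->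
  (forall x, S1 < s x -> (1 / 8 + eta) * grad2 s x * u x <= - lap u x) -> False.
Proof.
move=> d0 reg u0 e0 hu.
have [K [S2 [K0 S20 H]]] := bump_touching d0 reg.
have [g0 C0 fin _] := reg.
pose l := 1 + 8 / eta.
have l1 : 1 <= l by rewrite lerDl divr_ge0 // ltW.
have l0 : 0 < l by lra.
have li : 0 < 1 / l ^+ 2 by rewrite divr_gt0 // exprn_gt0.
have l2 : 8 * (1 / l ^+ 2) <= eta.
  rewrite mulrA mulr1 ler_pdivrMr ?exprn_gt0 //.
  apply: (@le_trans _ _ (eta * l)); last by rewrite ler_wpM2l ?(ltW e0) // expr2 ler_peMl ?(ltW l0).
  by rewrite /l mulrDr mulr1 mulrC divfK ?gt_eqF //; lra.
have [S3 dec] := @expR_decay R gamma K (1 / l ^+ 2 / 9) g0 K0 ltac:(lra).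
pose S4 := Num.max S1 (Num.max S2 S3).
have [a aS] := exists_large d0 (fin (S4 + l)).
have E0 : 0 < expR (- (1 / 2 * s a)) by exact: expR_gt0.
have T0 : 0 < 2 * u a / expR (- (1 / 2 * s a)) by rewrite divr_gt0 // mulr_gt0.
have aS2 : S2 + l < s a by apply: le_lt_trans aS; rewrite lerD2r /S4 !le_max lexx orbT.
have [|x [X [t [X1 sx /andP[t0 _] ux hl]]]] := H u a l _ u0 l1 aS2 T0.
  by rewrite divfK ?gt_eqF // mulr_natl mulr2n ltrDl.
have : S4 < s x.
  rewrite sx; have : `|l * X| <= l by rewrite normrM (gtr0_norm l0) ler_piMr ?ltW.
  by rewrite ler_norml => /andP[]; lra.
rewrite /S4 !gt_max => /and3P[x1 x2 x3].
have [_ hd] := dec _ x3.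
have := hu x x1; rewrite ux.
have G0 := grad2_ge0 s x.
move: hl hd; set E := expR (- (1 / 2 * s x)); set q := expR (- (gamma * s x)).
set G := grad2 s x in G0 *; set L := lap u x; set b := quartic X => hl hd hL.
have tEG : 0 <= t * E * G by rewrite !mulr_ge0 ?expR_ge0 // ltW.
have Kq : K * q <= 1 / l ^+ 2 / 9.
  apply: le_trans hd; rewrite ler_wpM2r ?expR_ge0 //.
  by rewrite mulrDr mulr1 lerDl mulr_ge0 ?sqr_ge0.
have /andP[b0 b2] := bump_gt0 X1.
have key : 0 <= eta * b + ((12 * X ^+ 2 - 6) / l ^+ 2) / 2 - K * q.
  have -> : (12 * X ^+ 2 - 6) / l ^+ 2 = (12 * X ^+ 2 - 6) * (1 / l ^+ 2) by rewrite div1r.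
  have eb : 0 <= eta * b by exact: (mulr_ge0 (ltW e0) (ltW b0)).
  case: (bump_alt X1) => [h|[h1 h2]].
    by have := ler_wpM2r (ltW li) h; lra.
  have := ler_wpM2r (ltW li) h2; have : eta * (4 / 9) <= eta * b by rewrite ler_wpM2l // ltW.
  by lra.
have := mulr_ge0 tEG key.
set B := (12 * X ^+ 2 - 6) / l ^+ 2 in hl *; lra.
Qed.

(** * Lower and upper bounds for linear supersolutions *)

(** The leading part of the linear potential plus an error bound. [m] is a parameter distinct from
    [mu] because at the critical exponent part of the nonlinear term is moved into the potential. *)
Definition potential (R : realType) (d : nat) (s : lattice d -> R) (m A e : R)
    (x : lattice d) : R :=
  (m / 8 + A * expR (- (e * s x))) * grad2 s x.

Lemma expR_small (R : realType) (delta K eta : R) : 0 < delta -> 0 <= K -> 0 < eta ->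
  exists s0, forall s, s0 < s -> K * expR (- (delta * s)) <= eta.
Proof.
move=> d0 K0 e0; have [s0 H] := expR_decay d0 K0 e0.
exists s0 => s /H[_]; apply: le_trans.
by rewrite ler_wpM2r ?expR_ge0 // mulrDr mulr1 lerDl mulr_ge0 ?sqr_ge0.
Qed.

Lemma expR_opp_le1 (R : realType) (a s : R) : 0 <= a -> 0 <= s -> expR (- (a * s)) <= 1.
Proof. by move=> a0 s0; rewrite -expR0 ler_expR oppr_le0 mulr_ge0. Qed.

Lemma expR_opp_le_sqr (R : realType) (a b s : R) : 2 * a <= b -> 0 <= s ->
  expR (- (b * s)) <= expR (- (a * s)) ^+ 2.
Proof.
move=> ab s0; rewrite -expRM_natr ler_expR mulNr lerN2 mulrAC ler_wpM2r //.
by rewrite mulrC.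
Qed.

Lemma expR_opp_split (R : realType) (a b s : R) :
  expR (- ((a + b) * s)) = expR (- (a * s)) * expR (- (b * s)).
Proof. by rewrite -expRD mulrDl opprD. Qed.

Lemma two_powers_ineq (R : realFieldType) (G E q g e K1 K2 A del al m L1 L2 : R) :
  0 <= G -> 0 < E -> 0 < q -> q <= 1 -> 0 <= g -> g <= q ^+ 2 -> 0 <= e -> e <= q ^+ 2 ->
  0 <= K1 -> 0 <= K2 -> 0 <= A -> 1 / 2 <= al -> 0 < del -> al ^+ 2 - al = m / 4 ->
  (2 * A + K1 + K2) * q <= del ^+ 2 / 2 ->
  - (K1 * g * G * E) <= L1 - G / 2 * E * (al ^+ 2 - al) ->
  - (K2 * g * G * (E * q)) <= L2 - G / 2 * (E * q) * ((al + del) ^+ 2 - (al + del)) ->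
  (m / 8 + A * e) * G * (E + E * q) <= L1 + L2.
Proof.
move=> G0 E0 q0 q1 g0 gq e0 eq K10 K20 A0 al2 del0 alm small h1 h2.
have GE : 0 <= G * E by rewrite mulr_ge0 // ltW.
have GEq : 0 <= G * E * q by rewrite mulr_ge0 // ltW.
have a1 : m / 4 + del ^+ 2 <= (al + del) ^+ 2 - (al + del).
  have -> : (al + del) ^+ 2 - (al + del) = (al ^+ 2 - al) + del * (2 * al - 1) + del ^+ 2 by ring.
  rewrite alm lerD2r lerDl mulr_ge0 ?(ltW del0) // subr_ge0.
  by rewrite -ler_pdivrMl // mulrC.
have a1' := ler_wpM2l GEq a1.
have a2 := ler_wpM2l (mulr_ge0 K10 GE) gq.
have a3 : K2 * (G * E) * (g * q) <= K2 * (G * E) * q ^+ 2.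
  apply: ler_wpM2l; first exact: mulr_ge0.
  by apply: le_trans gq; rewrite ler_piMr.
have a4 : A * (G * E) * (e * (1 + q)) <= A * (G * E) * (q ^+ 2 * 2).
  apply: ler_wpM2l; first exact: mulr_ge0.
  by rewrite ler_pM ?addr_ge0 ?(ltW q0) // lerD2l.
have a5 := ler_wpM2r GEq small.
rewrite alm in h1.
clear - h1 h2 a1' a2 a3 a4 a5; lra.
Qed.

(** The power [al] solves the limit equation and leaves errors without sign. As [al >= 1 / 2],
    raising the exponent by [del] gains at least [del^2] in [a^2 - a]. The gain is of order
    [e^(-del s)], while the bounds on [2 del] make the errors of the order of its square. *)
Lemma lap_two_powers (R : realType) d (s : lattice d -> R) (gamma C S0 : R)
    (m A e al del : R) :
  log_regular s gamma C S0 -> 0 <= A -> 1 / 2 <= al -> al ^+ 2 - al = m / 4 ->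
  0 < del -> 2 * del <= e -> 2 * del <= gamma ->
  exists S1, forall x, S1 < s x ->
    potential s m A e x * (expR (- (al * s x)) + expR (- ((al + del) * s x))) <=
    lap (fun y => expR (- (al * s y)) + expR (- ((al + del) * s y))) x.
Proof.
move=> reg A0 al2 alm del0 dele delg.
have [K1 [T1 [K10 _ H1]]] := lap_power al reg.
have [K2 [T2 [K20 _ H2]]] := lap_power (al + del) reg.
have K0 : 0 <= 2 * A + K1 + K2 by rewrite !addr_ge0 // mulr_ge0.
have del2 : 0 < del ^+ 2 / 2 by rewrite divr_gt0 // exprn_gt0.
have [T5 dec5] := expR_small del0 K0 del2.
exists (Num.max 0 (Num.max T1 (Num.max T2 T5))) => x.
rewrite !gt_max => /and4P[/ltW x0 t1 t2 t5].
have := H1 x t1; rewrite ler_norml -mulNr => /andP[h1 _].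
have := H2 x t2; rewrite ler_norml -mulNr => /andP[h2 _].
rewrite lapD; rewrite expR_opp_split in h2 *.
apply: (@two_powers_ineq R _ _ _ (expR (- (gamma * s x))) _ K1 K2 A del al);
  rewrite ?expR_gt0 ?expR_ge0 ?grad2_ge0 ?expR_opp_le1 ?expR_opp_le_sqr ?(ltW del0) //.
- exact: dec5.
- by move: h1; rewrite !mulNr.
- by move: h2; rewrite !mulNr.
Qed.

Lemma critical_barrier_ineq (R : realFieldType) (G E q g s K3 K4 del L3 L4 : R) :
  0 <= G -> 0 < E -> 0 < q -> q <= 1 -> 0 <= g -> g <= q ^+ 2 -> 0 <= s ->
  0 <= K3 -> 0 <= K4 ->
  2 * (K3 + K4) * (1 + s ^+ 2) * q <= del ^+ 2 / 2 ->
  - (K3 * g * G * (E * q)) <= L3 - G / 2 * (E * q) * ((1 / 2 + del) ^+ 2 - (1 / 2 + del)) ->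
  L4 - G / 2 * E * (- (1 / 4) * s) <= K4 * (1 + s) * g * G * E ->
  L4 - L3 <= - (G / 8 * (E * (s - q))).
Proof.
move=> G0 E0 q0 q1 g0 gq s0 K30 K40 small h3 h4.
have GE : 0 <= G * E by rewrite mulr_ge0 // ltW.
have GEq : 0 <= G * E * q by rewrite mulr_ge0 // ltW.
have GEqq : 0 <= G * E * q ^+ 2 by rewrite mulr_ge0 // exprn_ge0 // ltW.
have a3 : K3 * (G * E) * (g * q) <= K3 * (G * E) * q ^+ 2.
  apply: ler_wpM2l; first exact: mulr_ge0.
  by apply: le_trans gq; rewrite ler_piMr.
have a4 := ler_wpM2l (mulr_ge0 (mulr_ge0 K40 (addr_ge0 ler01 s0)) GE) gq.
have a5 := ler_wpM2r GEq small.
have ss : 1 + s <= 2 * (1 + s ^+ 2) by have := sqr_ge0 (s - 1); have := sqr_ge0 s; clear; lra.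
have a6 := ler_wpM2r GEqq (ler_wpM2l K40 ss).
have a7 : 0 <= K3 * s ^+ 2 * (G * E * q ^+ 2) by rewrite mulr_ge0 // mulr_ge0 ?sqr_ge0.
have a8 : 0 <= K3 * (G * E * q ^+ 2) by rewrite mulr_ge0.
clear - h3 h4 a3 a4 a5 a6 a7 a8; lra.
Qed.

(** [s e^(-s/2)] is the larger solution of the limit equation at the double root [m = -1];
    subtracting a faster decaying power fixes the sign of the error. A larger [m] only raises the
    potential, so one barrier serves all [m >= -1]. *)
Lemma lap_critical_barrier (R : realType) d (s : lattice d -> R) (gamma C S0 : R)
    (m A e del : R) :
  log_regular s gamma C S0 -> -1 <= m -> 0 <= A -> 0 < del -> 2 * del <= gamma ->
  exists S1, forall x, S1 < s x ->
    lap (fun y => expR (- (1 / 2 * s y)) * s y - expR (- ((1 / 2 + del) * s y))) x <=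
    potential s m A e x *
      (expR (- (1 / 2 * s x)) * s x - expR (- ((1 / 2 + del) * s x))).
Proof.
move=> reg m1 A0 del0 delg.
have [K3 [T3 [K30 _ H3]]] := lap_power (1 / 2 + del) reg.
have [K4 [T4 [K40 _ H4]]] := lap_radial (1 / 2) reg.
have K0 : 0 <= 2 * (K3 + K4) by rewrite mulr_ge0 // addr_ge0.
have del2 : 0 < del ^+ 2 / 2 by rewrite divr_gt0 // exprn_gt0.
have [T6 dec6] := expR_decay del0 K0 del2.
exists (Num.max 1 (Num.max T3 (Num.max T4 T6))) => x.
rewrite !gt_max => /and4P[/ltW x1 t3 t4 t6].
have x0 : 0 <= s x by apply: le_trans x1.
have := H3 x t3; rewrite ler_norml => /andP[h3 _].
have sx1 : s x <= 1 + s x by rewrite lerDr.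
have T4x v : `|v| <= 1 ->
    `|s x + v - (s x + 1 * v + 0 / 2 * v ^+ 2)| <= (1 + s x) * `|v| ^+ 3.
  move=> _; rewrite mul1r !mul0r addr0 subrr normr0 mulr_ge0 ?exprn_ge0 //.
  exact: addr_ge0.
have b1 : `|s x| <= 1 + s x by rewrite ger0_norm.
have b2 : `|1 : R| <= 1 + s x by rewrite normr1 lerDl.
have b3 : `|0 : R| <= 1 + s x by rewrite normr0 addr_ge0.
have := H4 id x _ _ _ _ t4 b1 b2 b3 T4x.
rewrite ler_norml => /andP[_ h4].
have -> : expR (- (1 / 2 * s x)) * s x - expR (- ((1 / 2 + del) * s x)) =
    expR (- (1 / 2 * s x)) * (s x - expR (- (del * s x))).
  by rewrite expR_opp_split mulrBr.
have q1 : expR (- (del * s x)) <= 1 by rewrite expR_opp_le1 ?(ltW del0).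
apply: (@le_trans _ _ (- (grad2 s x / 8 *
    (expR (- (1 / 2 * s x)) * (s x - expR (- (del * s x))))))); last first.
  rewrite -mulNr ler_wpM2r //.
    by rewrite mulr_ge0 ?expR_ge0 // subr_ge0 (le_trans q1).
  have -> : - (grad2 s x / 8) = - (1 / 8) * grad2 s x by ring.
  rewrite /potential ler_wpM2r ?grad2_ge0 //.
  have : 0 <= A * expR (- (e * s x)) by rewrite mulr_ge0 ?expR_ge0.
  by move: m1; clear; lra.
rewrite lapB.
rewrite expR_opp_split in h3.
apply: (@critical_barrier_ineq R _ _ _ (expR (- (gamma * s x))) _ K3 K4 del);
  rewrite ?expR_gt0 ?expR_ge0 ?grad2_ge0 ?expR_opp_le_sqr //.
- exact: (dec6 _ t6).2.
- apply: le_trans h4; rewrite le_eqVlt; apply/orP; left; apply/eqP.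
  by rewrite /=; set L := lap _ _; field.
Qed.

(** A Phragmen-Lindelof argument: a small multiple of the supersolution [S] is added to [u]. Since
    [w <= 2 e^(-s/2)] while [S] is of order [s e^(-s/2)], the contact set becomes finite; then the
    multiple tends to 0. *)
Lemma supersolution_lower_bound (R : realType) d (s : lattice d -> R) (gamma C S0 : R)
    (u : lattice d -> R) (m A e S1 al : R) :
  (0 < d)%N -> log_regular s gamma C S0 -> (forall x, 0 < u x) ->
  -1 <= m -> 0 <= A -> 0 < e ->
  1 / 2 <= al -> al ^+ 2 - al = m / 4 ->
  (forall x, S1 < s x -> lap u x <= potential s m A e x * u x) ->
  exists c S2, 0 < c /\ forall x, S2 < s x -> c * expR (- (al * s x)) <= u x.
Proof.
move=> d0 reg u0 m1 A0 e0 al2 alm hu.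
have [g0 C0 fin regx] := reg.
pose del := Num.min e gamma / 2.
have del0 : 0 < del by rewrite divr_gt0 // lt_min e0 g0.
have dele : 2 * del <= e by rewrite /del mulrC divfK // ge_min lexx.
have delg : 2 * del <= gamma by rewrite /del mulrC divfK // ge_min lexx orbT.
pose w (x : lattice d) := expR (- (al * s x)) + expR (- ((al + del) * s x)).
pose S x := expR (- (1 / 2 * s x)) * s x - expR (- ((1 / 2 + del) * s x)).
have [T1 lapw] := lap_two_powers reg A0 al2 alm del0 dele delg.
have [T2 lapS] := lap_critical_barrier e reg m1 A0 del0 delg.
have [T7 dec7] := @expR_small R gamma C 1 g0 C0 ltr01.
(* The level 2 keeps [S] positive one step below the region, since increments are at most 1
   there. *)
pose S3 := Num.max 2 (Num.max (Num.max S0 T7) (Num.max S1 (Num.max T1 T2))).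
have S3P x : S3 < s x -> [/\ 2 < s x, S0 < s x /\ T7 < s x, S1 < s x, T1 < s x & T2 < s x].
  by rewrite /S3 !gt_max => /and5P[-> /andP[-> ->] -> -> ->].
have S_ge x : 0 <= s x -> expR (- (1 / 2 * s x)) * (s x - 1) <= S x.
  move=> sx; rewrite /S expR_opp_split -mulrBr ler_wpM2l ?expR_ge0 // lerD2l lerN2.
  by rewrite expR_opp_le1 // ltW.
have S_gt0 x : 1 < s x -> 0 < S x.
  move=> sx; apply: lt_le_trans (S_ge x (ltW (lt_trans ltr01 sx))).
  by rewrite mulr_gt0 ?expR_gt0 ?subr_gt0.
have w0 x : 0 < w x by rewrite addr_gt0 ?expR_gt0.
have [c0 c00 hc0] := finite_dominated w (fin S3) (fun x _ => u0 x).
pose c := c0^-1; have cpos : 0 < c by rewrite invr_gt0.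
have hc x : s x <= S3 -> c * w x < u x.
  by move=> /hc0; rewrite /c ltr_pdivrMl.
exists c, S3; split=> // x xS.
have lt12 : 1 < 2 :> R by rewrite ltr1n.
have [sx2 _ _ _ _] := S3P x xS.
have Sx : 0 < S x by apply: S_gt0; apply: lt_trans sx2.
suff : c * w x <= u x.
  apply: le_trans; rewrite ler_wpM2l ?(ltW cpos) // /w lerDl expR_ge0 //.
apply/ler_addgt0Pr => eta eta0; rewrite leNgt; apply/negP => ux.
(* The perturbation is normalized to equal [eta] at the point [x] itself. *)
pose e' := eta / S x; have e'0 : 0 < e' by rewrite divr_gt0.
have [||||y [t [Dy /andP[t0 _] uy]]] := @touching R d [set y | S3 < s y]
   (fun y => u y + e' * S y) (fun y => c * w y) x d0 _ _ _ xS.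
- move=> y /S3P[y2 _ _ _ _].
  by rewrite addr_gt0 // mulr_gt0 // S_gt0 // (lt_trans _ y2).
- move=> y i /= Dy /negP; rewrite -leNgt => Dy'.
  have [y2 [y0 t7] _ _ _] := S3P y Dy.
  have [_ /(_ i)] := regx y y0.
  move=> /le_trans/(_ (dec7 _ t7)); rewrite ler_norml => /andP[h _].
  have Sy : 0 < e' * S (y + step i).
    by rewrite mulr_gt0 // S_gt0 //; move: h y2; clear; lra.
  by split; [rewrite addr_gt0|rewrite (lt_le_trans (hc _ Dy')) // lerDl ltW].
- apply: sub_finite_set (fin (1 + 2 * c / e')) => y [/= Dy hy].
  have [y2 _ _ _ _] := S3P y Dy.
  have y0 : 0 <= s y by rewrite ltW // (lt_trans _ y2).
  have E0 : 0 < expR (- (1 / 2 * s y)) by exact: expR_gt0.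
  have wy : w y <= 2 * expR (- (1 / 2 * s y)).
    rewrite /w mulr_natl mulr2n lerD // ler_expR lerN2 ler_wpM2r //.
    by rewrite ler_wpDr // ltW.
  rewrite -lerBlDl ler_pdivlMr // -(ler_pM2r E0).
  have := ler_wpM2l (ltW e'0) (S_ge y y0).
  have := ler_wpM2l (ltW cpos) wy; have := u0 y; move: hy; clear; lra.
- by rewrite /= /e' divfK ?gt_eqF.
- rewrite !lapD !lapZ => h.
  have [_ _ y1 t1 t2] := S3P y Dy.
  have := hu y y1 => k1.
  have := ler_wpM2l (ltW e'0) (lapS y t2).
  have := ler_wpM2l (ltW (mulr_gt0 t0 cpos)) (lapw y t1).
  rewrite -/(w y) -/(S y).
  set Q := potential s m A e y in k1 *.
  have := congr1 (fun z => Q * z) uy => /=.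
  by move: h k1; clear; lra.
Qed.

(** [M w] is slid below [u], with [M] so large that it exceeds [u] at one point. Finiteness for
    every [M] expresses that [u] outgrows [w]. *)
Lemma supersolution_not_above (R : realType) d (s u w q : lattice d -> R) (S3 : R) :
  (0 < d)%N -> (forall x, 0 < u x) ->
  (forall x i, S3 < s x -> s (x + step i) <= S3 -> w (x + step i) <= 0) ->
  (exists a, S3 < s a /\ 0 < w a) ->
  (forall M, finite_set [set x | S3 < s x /\ u x <= M * w x]) ->
  (forall x, S3 < s x -> q x * w x <= lap w x) ->
  (forall x, S3 < s x -> lap u x <= q x * u x) -> False.
Proof.
move=> d0 u0 w_le0 [a [aS wa]] fin hw hu.
pose M := u a / w a + 1.
have M0 : 0 < M by rewrite addr_gt0 // divr_gt0.
have [||x [t [Dx /andP[t0 _] ux tl]]] := @touching R d [set x | S3 < s x] u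
  (fun x => M * w x) a d0 (fun x _ => u0 x) _ (fin M) aS.
- move=> x i xS /negP; rewrite -leNgt => /(w_le0 x i xS) wx; split=> //.
  by apply: le_lt_trans (u0 _); rewrite mulr_ge0_le0 // ltW.
- by rewrite /M mulrDl mul1r divfK ?gt_eqF // ltrDl.
have := ler_wpM2l (ltW (mulr_gt0 t0 M0)) (hw x Dx).
have := hu x Dx; rewrite ux; move: tl; rewrite lapZ; clear; lra.
Qed.

Lemma power_barrier_ineq (R : realFieldType) (G E1 E0 g e K1 K2 A k mu c L1 L0 : R) :
  0 <= G -> 0 < E1 -> 0 < E0 -> 0 <= c -> c * E0 <= E1 -> 0 <= g -> 0 <= e ->
  0 <= K1 -> 0 <= K2 -> 0 <= A -> -1 <= mu ->
  (K1 + K2) * g + A * e <= (k ^+ 2 - (1 + mu) / 4) / 2 ->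
  - (K1 * g * G * E1) <= L1 - G / 2 * E1 * ((1 / 2 - k) ^+ 2 - (1 / 2 - k)) ->
  L0 - G / 2 * E0 * ((1 / 2) ^+ 2 - 1 / 2) <= K2 * g * G * E0 ->
  (mu / 8 + A * e) * G * (E1 - c * E0) <= L1 - c * L0.
Proof.
move=> G0 E10 E00 c0 cE g0 e0 K10 K20 A0 mu1 small h1 h0.
have GE1 : 0 <= G * E1 by rewrite mulr_ge0 // ltW.
have cGE0 : 0 <= c * (G * E0) by rewrite !mulr_ge0 // ltW.
have a1 := ler_wpM2r GE1 small.
have a2 := ler_wpM2l c0 h0.
have a3 : 0 <= A * e * (c * (G * E0)) by rewrite !mulr_ge0 // ltW.
have a4 : 0 <= (1 + mu) * (c * (G * E0)) by rewrite mulr_ge0 // addrC -lerBlDr sub0r.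
have a5 : K2 * g * G * (c * E0) <= K2 * g * G * E1 by rewrite ler_wpM2l // !mulr_ge0.
clear - h1 a1 a2 a3 a4 a5; lra.
Qed.

(** For [k > sqrt (1 + mu) / 2] the power [e^((k - 1/2) s)] is a subsolution with a margin near
    infinity. Subtracting [K e^(-s/2)] makes [w] nonpositive up to the level [S3], and [k < k1] lets
    [u] outgrow [w]. *)
Lemma no_fast_growth (R : realType) d (s : lattice d -> R) (gamma C S0 : R)
    (u : lattice d -> R) (mu A e S1 c k k1 : R) :
  (0 < d)%N -> log_regular s gamma C S0 -> (forall x, 0 < u x) ->
  -1 <= mu -> 0 <= A -> 0 < e ->
  (forall x, S1 < s x -> lap u x <= potential s mu A e x * u x) ->
  0 < c -> 0 < k -> (1 + mu) / 4 < k ^+ 2 -> k < k1 ->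
  (forall x, S1 < s x -> c * expR (- ((1 / 2 - k1) * s x)) <= u x) -> False.
Proof.
move=> d0 reg u0 mu1 A0 e0 hu c0 k0 kmu kk1 hc.
have [g0 C0 fin regx] := reg.
have [K1 [T1 [K10 _ H1]]] := lap_power (1 / 2 - k) reg.
have [K2 [T2 [K20 _ H2]]] := lap_power (1 / 2) reg.
have eta0 : 0 < (k ^+ 2 - (1 + mu) / 4) / 4 by rewrite divr_gt0 // subr_gt0.
have [T3 dec3] := expR_small g0 (addr_ge0 K10 K20) eta0.
have [T4 dec4] := expR_small e0 A0 eta0.
pose S3 := Num.max S1 (Num.max T1 (Num.max T2 (Num.max T3 T4))).
have S3P x : S3 < s x -> [/\ S1 < s x, T1 < s x, T2 < s x, T3 < s x & T4 < s x].
  by rewrite /S3 !gt_max => /and5P[-> -> -> -> ->].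
pose K := expR (k * S3).
have E1E x : expR (- ((1 / 2 - k) * s x)) = expR (k * s x) * expR (- (1 / 2 * s x)).
  by rewrite -expRD; congr expR; ring.
pose w x := expR (- ((1 / 2 - k) * s x)) - K * expR (- (1 / 2 * s x)).
have wE x : w x = (expR (k * s x) - K) * expR (- (1 / 2 * s x)).
  by rewrite /w E1E mulrBl.
apply: (@supersolution_not_above R d s u w (potential s mu A e) S3) => //.
- move=> x i _ xS; rewrite wE mulr_le0_ge0 ?expR_ge0 // subr_le0 ler_expR.
  by rewrite ler_wpM2l // ltW.
- have [a aS] := exists_large d0 (fin S3).
  exists a; split=> //; rewrite wE mulr_gt0 ?expR_gt0 // subr_gt0 ltr_expR.
  by rewrite ltr_pM2l.
- move=> M.
  have kk0 : 0 < k1 - k by rewrite subr_gt0.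
  have [T5 gr] := expR_growth (`|M| / c + 1) kk0.
  apply: sub_finite_set (fin T5) => x [/= xS ux]; rewrite leNgt; apply/negP => xT.
  have [x1 _ _ _ _] := S3P x xS.
  have E0 : 0 < expR (- ((1 / 2 - k) * s x)) by exact: expR_gt0.
  have : c * expR (- ((1 / 2 - k1) * s x)) <= `|M| * expR (- ((1 / 2 - k) * s x)).
    apply: le_trans (hc x x1) _; apply: (le_trans ux).
    have w0 : 0 <= w x.
      rewrite wE mulr_ge0 ?expR_ge0 // subr_ge0 ler_expR.
      by rewrite ler_wpM2l // ltW.
    apply: (@le_trans _ _ (`|M| * w x)); first by rewrite ler_wpM2r // ler_norm.
    by rewrite ler_wpM2l // /w gerBl mulr_ge0 ?expR_ge0.
  have -> : expR (- ((1 / 2 - k1) * s x)) =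
      expR ((k1 - k) * s x) * expR (- ((1 / 2 - k) * s x)).
    by rewrite -expRD; congr expR; ring.
  rewrite mulrA ler_pM2r // leNgt => /negP; apply.
  rewrite -ltr_pdivrMl // mulrC; apply: lt_le_trans (gr _ xT).
  by rewrite ltrDl.
- move=> x xS; have [x1 t1 t2 t3 t4] := S3P x xS.
  have := H1 x t1; rewrite ler_norml => /andP[h1 _].
  have := H2 x t2; rewrite ler_norml => /andP[_ h2].
  rewrite /w lapB lapZ.
  apply: (@power_barrier_ineq R _ _ _ (expR (- (gamma * s x))) _ K1 K2 A k);
    rewrite ?expR_gt0 ?expR_ge0 ?grad2_ge0 //.
    by rewrite E1E ler_wpM2r ?expR_ge0 // ler_expR ler_wpM2l // ltW.
  have := lerD (dec3 _ t3) (dec4 _ t4) => /le_trans; apply.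
  by rewrite -mulrDr (_ : 4^-1 + 4^-1 = 2^-1) //; field.
- by move=> x /S3P[x1 _ _ _ _]; exact: hu.
Qed.

Lemma square_barrier_ineq (R : realFieldType) (G E g e K A s S L : R) :
  0 <= G -> 0 < E -> 0 <= g -> 0 <= e -> 0 <= K -> 0 <= A -> 1 <= S -> S < s ->
  4 * K * (1 + s ^+ 2) * g <= 1 / 2 -> A * (1 + s ^+ 2) * e <= 1 / 2 ->
  - (K * (4 * (1 + s ^+ 2)) * g * G * E) <=
    L - G / 2 * E * (- (1 / 4) * (s ^+ 2 - S ^+ 2) + 2) ->
  (- 1 / 8 + A * e) * G * (E * (s ^+ 2 - S ^+ 2)) <= L.
Proof.
move=> G0 E0 g0 e0 K0 A0 S1 Ss h1 h2 h3.
have GE : 0 <= G * E by rewrite mulr_ge0 // ltW.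
have a1 := ler_wpM2r GE h1.
have a2 := ler_wpM2r GE h2.
have a3 : 0 <= A * e * (G * E) * (1 + S ^+ 2).
  by rewrite mulr_ge0 ?addr_ge0 ?sqr_ge0 // mulr_ge0 // mulr_ge0.
clear - h3 a1 a2 a3; lra.
Qed.

(** A power of [s] is smaller than every growing exponential of [s], so the previous barrier is too
    large here. Instead [s^2 e^(-s/2)] is a subsolution with a margin, because [(s^2)'' = 2], and
    [k > 2] lets [u] outgrow it. *)
Lemma no_fast_growth_critical (R : realType) d (s : lattice d -> R) (gamma C S0 : R)
    (u : lattice d -> R) (A e S1 c k : R) :
  (0 < d)%N -> log_regular s gamma C S0 -> (forall x, 0 < u x) ->
  0 <= A -> 0 < e ->
  (forall x, S1 < s x -> lap u x <= potential s (-1) A e x * u x) ->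
  0 < c -> 2 < k ->
  (forall x, S1 < s x -> c * expR (k * ln (s x)) * expR (- (1 / 2 * s x)) <= u x) ->
  False.
Proof.
move=> d0 reg u0 A0 e0 hu c0 k2 hc.
have [g0 C0 fin regx] := reg.
have [K1 [T1 [K10 _ H1]]] := lap_radial (1 / 2) reg.
have half0 : 0 < 1 / 2 :> R by rewrite divr_gt0.
have K40 : 0 <= 4 * K1 by rewrite mulr_ge0.
have [T3 dec3] := expR_decay g0 K40 half0.
have [T4 dec4] := expR_decay e0 A0 half0.
have [T5 dec5] := expR_small g0 C0 (ltr01 : 0 < 1 :> R).
pose S3 := Num.max 1 (Num.max (Num.max S1 S0) (Num.max (Num.max T1 T5) (Num.max T3 T4))).
have S3P x : S3 < s x ->
    [/\ 1 < s x, S1 < s x /\ S0 < s x, T1 < s x /\ T5 < s x, T3 < s x & T4 < s x].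
  by rewrite /S3 !gt_max => /and5P[-> /andP[-> ->] /andP[-> ->] -> ->].
have S31 : 1 <= S3 by rewrite /S3 le_max lexx.
have S30 : 0 < S3 by apply: lt_le_trans S31.
pose w x := expR (- (1 / 2 * s x)) * (s x ^+ 2 - S3 ^+ 2).
have w_gt0 x : S3 < s x -> 0 < w x.
  move=> xS; rewrite /w mulr_gt0 ?expR_gt0 // subr_sqr mulr_gt0 ?subr_gt0 //.
  by rewrite addr_gt0 // (lt_trans S30).
apply: (@supersolution_not_above R d s u w (potential s (-1) A e) S3) => //.
- move=> x i xS yS; have [x1 [_ x0] [_ t5] _ _] := S3P x xS.
  have [_ /(_ i)] := regx x x0.
  move=> /le_trans/(_ (dec5 _ t5)); rewrite ler_norml => /andP[hd _].
  have y0 : 0 <= s (x + step i) by move: hd xS S31; clear; lra.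
  rewrite /w mulr_ge0_le0 ?expR_ge0 // subr_le0 lerXn2r ?nnegrE //.
  exact: ltW.
- by have [a aS] := exists_large d0 (fin S3); exists a; split=> //; exact: w_gt0.
- move=> M.
  have kk0 : 0 < k - 2 by rewrite subr_gt0.
  have [T6 gr] := expR_growth (`|M| / c + 1) kk0.
  apply: sub_finite_set (fin (expR T6)) => x [/= xS ux]; rewrite leNgt; apply/negP => xT.
  have [x1 [x2 _] _ _ _] := S3P x xS.
  have x0 : 0 < s x by apply: lt_trans x1.
  have lT : T6 < ln (s x) by rewrite -ltr_expR lnK.
  have E0 : 0 < expR (- (1 / 2 * s x)) by exact: expR_gt0.
  have : c * expR (k * ln (s x)) * expR (- (1 / 2 * s x)) <=
      `|M| * s x ^+ 2 * expR (- (1 / 2 * s x)).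
    apply: le_trans (hc x x2) _; apply: (le_trans ux).
    apply: (@le_trans _ _ (`|M| * w x)).
      by rewrite ler_wpM2r ?ler_norm // ltW // w_gt0.
    rewrite -mulrA ler_wpM2l // /w mulrC ler_wpM2r ?expR_ge0 //.
    by rewrite gerBl sqr_ge0.
  have -> : expR (k * ln (s x)) = expR ((k - 2) * ln (s x)) * s x ^+ 2.
    by rewrite -[X in _ = _ * X ^+ 2](@lnK _ (s x)) // -expRM_natl -expRD; congr expR; ring.
  rewrite mulrA ler_pM2r // ler_pM2r ?exprn_gt0 // leNgt => /negP; apply.
  rewrite -ltr_pdivrMl // mulrC; apply: lt_le_trans (gr _ lT).
  by rewrite ltrDl.
- move=> x xS; have [x1 _ [t1 _] t3 t4] := S3P x xS.
  have ss := sqr_ge0 (s x).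
  have x0 : 0 <= s x by rewrite ltW // (lt_trans _ x1).
  have sS : s x ^+ 2 - S3 ^+ 2 >= 0.
    by rewrite subr_ge0 lerXn2r ?nnegrE ?(ltW S30) // ltW.
  have s2 : 2 * s x <= 1 + s x ^+ 2 by have := sqr_ge0 (s x - 1); clear; lra.
  have b1 : `|s x ^+ 2 - S3 ^+ 2| <= 4 * (1 + s x ^+ 2).
    by rewrite ger0_norm //; have := sqr_ge0 S3; move: ss; clear; lra.
  have b2 : `|2 * s x| <= 4 * (1 + s x ^+ 2).
    by rewrite ger0_norm ?mulr_ge0 //; move: ss s2; clear; lra.
  have b3 : `|2 : R| <= 4 * (1 + s x ^+ 2).
    by rewrite normr_nat; move: ss; clear; lra.
  have hT v : `|v| <= 1 -> `|((s x + v) ^+ 2 - S3 ^+ 2) -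
      ((s x ^+ 2 - S3 ^+ 2) + 2 * s x * v + 2 / 2 * v ^+ 2)| <= 4 * (1 + s x ^+ 2) * `|v| ^+ 3.
    move=> _; have -> : ((s x + v) ^+ 2 - S3 ^+ 2) -
      ((s x ^+ 2 - S3 ^+ 2) + 2 * s x * v + 2 / 2 * v ^+ 2) = 0 by field.
    by rewrite normr0 mulr_ge0 ?exprn_ge0 // mulr_ge0 // addr_ge0.
  have := H1 (fun v => v ^+ 2 - S3 ^+ 2) x _ _ _ _ t1 b1 b2 b3 hT.
  rewrite ler_norml => /andP[h1 _].
  apply: (@square_barrier_ineq R _ _ (expR (- (gamma * s x))) _ K1 _ _ S3);
    rewrite ?expR_gt0 ?expR_ge0 ?grad2_ge0 //.
  + exact: (dec3 _ t3).2.
  + exact: (dec4 _ t4).2.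
  + apply: (le_trans h1); rewrite le_eqVlt; apply/orP; left; apply/eqP.
    by rewrite /w; set L := lap _ _; field.
- by move=> x /S3P[_ [x1 _] _ _ _]; exact: hu.
Qed.

(** * Nonlinear problems *)

Lemma no_linear_growth (R : realType) d (s : lattice d -> R) (gamma C S0 : R)
    (u : lattice d -> R) (mu A e S1 c E : R) :
  (0 < d)%N -> log_regular s gamma C S0 -> (forall x, 0 < u x) ->
  0 <= A -> 0 < e -> 0 < c -> 0 < E ->
  (forall x, S1 < s x -> c * (expR (E * s x) * grad2 s x) * u x <=
     - lap u x + potential s mu A e x * u x) -> False.
Proof.
move=> d0 reg u0 A0 e0 c0 E0 hu.
have [T1 dec] := expR_small e0 A0 (ltr01 : 0 < 1 :> R).
have [T2 gr] := expR_growth ((mu / 8 + 1 + (1 / 8 + 1)) / c) E0.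
apply: (@no_supercritical R d s gamma C S0 u 1 (Num.max S1 (Num.max T1 T2))) => //.
move=> x; rewrite !gt_max => /and3P[x1 t1 t2].
have h1 := hu x x1; have h2 := dec _ t1.
have := gr _ t2; rewrite ler_pdivrMr // => h3.
have Gu : 0 <= grad2 s x * u x by rewrite mulr_ge0 ?grad2_ge0 ?ltW.
have := ler_wpM2r Gu h2; have := ler_wpM2r Gu h3; move: h1; rewrite /potential.
by clear; lra.
Qed.

Lemma no_superlinear (R : realType) d (s : lattice d -> R) (gamma C S0 : R)
    (u : lattice d -> R) (mu A e S1 c E p al : R) :
  (0 < d)%N -> log_regular s gamma C S0 -> (forall x, 0 < u x) ->
  -1 <= mu -> 0 <= A -> 0 < e -> 0 < c -> 1 <= p ->
  1 / 2 <= al -> al ^+ 2 - al = mu / 4 ->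
  al * (p - 1) <= E -> [\/ al * (p - 1) < E, 1 < p | mu = -1] ->
  (forall x, S1 < s x -> c * (expR (E * s x) * grad2 s x) * u x `^ p <=
     - lap u x + potential s mu A e x * u x) -> False.
Proof.
move=> d0 reg u0 mu1 A0 e0 c0 p1 al2 alm alE cas hu.
have p0 : 0 < p by apply: lt_le_trans p1.
(* Since p >= 1, a lower bound on u turns the nonlinear term into a linear one. *)
have linear bet c1 S2 : 0 < c1 ->
    (forall x, S2 < s x -> c1 * expR (- (bet * s x)) <= u x) ->
    exists2 c2, 0 < c2 & forall x, Num.max S1 S2 < s x ->
      c2 * (expR ((E - bet * (p - 1)) * s x) * grad2 s x) * u x <=
      - lap u x + potential s mu A e x * u x.
  move=> c10 hb; exists (c * c1 `^ (p - 1)); first by rewrite mulr_gt0 ?powR_gt0.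
  move=> x; rewrite gt_max => /andP[x1 x2]; apply: le_trans (hu x x1).
  have h : (c1 * expR (- (bet * s x))) `^ (p - 1) <= u x `^ (p - 1).
    by apply: ge0_ler_powR; rewrite ?subr_ge0 ?nnegrE ?mulr_ge0 ?expR_ge0 ?(ltW c10) ?hb // ltW.
  rewrite -(mulr_powRB1 (ltW (u0 x)) p0).
  rewrite powRM ?expR_ge0 ?(ltW c10) // -expRM in h.
  have -> : expR ((E - bet * (p - 1)) * s x) =
      expR (E * s x) * expR (- (bet * s x) * (p - 1)).
    by rewrite -expRD; congr expR; ring.
  have W0 : 0 <= c * (expR (E * s x) * grad2 s x) * u x.
    rewrite mulr_ge0 ?(ltW (u0 x)) // mulr_ge0 ?(ltW c0) //.
    by rewrite mulr_ge0 ?expR_ge0 ?grad2_ge0.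
  have := ler_wpM2l W0 h.
  by set a1 := c1 `^ _; set a2 := u x `^ _; set a3 := expR (_ * (p - 1)); clear; lra.
have hu0 x : S1 < s x -> lap u x <= potential s mu A e x * u x.
  move=> /hu h; rewrite -subr_ge0 addrC; apply: le_trans h.
  by rewrite !mulr_ge0 ?expR_ge0 ?grad2_ge0 ?powR_ge0 ?(ltW c0).
have [c1 [S2 [c10 hb]]] := supersolution_lower_bound d0 reg u0 mu1 A0 e0 al2 alm hu0.
have [c2 c20 hl] := linear _ _ _ c10 hb.
have [Elt|Ege] := ltP (al * (p - 1)) E.
  by apply: (no_linear_growth d0 reg u0 A0 e0 c20 _ hl); rewrite subr_gt0.
have EE : E - al * (p - 1) = 0 by apply/eqP; rewrite subr_eq0 eq_le Ege alE.
have hl' x : Num.max S1 S2 < s x -> c2 * grad2 s x * u x <=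
    - lap u x + potential s mu A e x * u x.
  by move=> xS; have := hl x xS; rewrite EE mul0r expR0 mul1r.
(* At equality the linearized term is a fixed multiple [c2 G]. Either it exceeds the gap
   [(1 + mu) / 8] to Hardy's constant, as it does when [mu = -1], or it can be moved into the
   potential. *)
have [c2l|c2l] := ltP ((1 + mu) / 8) c2.
  pose eta := (c2 - (1 + mu) / 8) / 2.
  have eta0 : 0 < eta by rewrite divr_gt0 // subr_gt0.
  have [T1 dec] := expR_small e0 A0 eta0.
  apply: (@no_supercritical R d s gamma C S0 u eta (Num.max (Num.max S1 S2) T1)) => //.
  move=> x; rewrite gt_max => /andP[xS t1].
  have Gu : 0 <= grad2 s x * u x by rewrite mulr_ge0 ?grad2_ge0 ?ltW.
  have := ler_wpM2r Gu (dec _ t1); have := hl' x xS; rewrite /potential /eta.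
  by clear; lra.
have p_gt1 : 1 < p.
  case: cas => // [|m1]; first by rewrite ltNge Ege.
  by move: c2l; rewrite m1 subrr mul0r leNgt c20.
(* The decay exponent drops to [al' < al]; the improved lower bound on [u] and [p > 1] then make
   [E - al' (p - 1)] positive. *)
pose m := mu - 8 * c2.
have m1 : -1 <= m by rewrite /m; move: c2l; clear; lra.
pose al' := (1 + Num.sqrt (1 + m)) / 2.
have sq : Num.sqrt (1 + m) ^+ 2 = 1 + m by rewrite sqr_sqrtr //; move: m1; clear; lra.
have sq0 := sqrtr_ge0 (1 + m).
have al'2 : 1 / 2 <= al' by rewrite /al'; move: sq0; clear; lra.
have al'm : al' ^+ 2 - al' = m / 4.
  by rewrite /al'; move: sq; set r := Num.sqrt _ => rr; rewrite -(addKr 1 m) -rr; field.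
have al'al : al' < al.
  rewrite ltNge; apply/negP => h.
  have : 0 <= (al' - al) * (al' + al - 1).
    by rewrite mulr_ge0 ?subr_ge0 //; move: al2 al'2; clear; lra.
  have -> : (al' - al) * (al' + al - 1) = (al' ^+ 2 - al') - (al ^+ 2 - al) by ring.
  by rewrite al'm alm /m; move: c20; clear; lra.
have hu' x : Num.max S1 S2 < s x -> lap u x <= potential s m A e x * u x.
  by move=> /hl'; rewrite /potential /m; clear; lra.
have [c3 [S3 [c30 hb3]]] := supersolution_lower_bound d0 reg u0 m1 A0 e0 al'2 al'm hu'.
have [c4 c40 hl4] := linear _ _ _ c30 hb3.
apply: (no_linear_growth d0 reg u0 A0 e0 c40 _ hl4).
by rewrite subr_gt0 (lt_le_trans _ alE) // ltr_pM2r // subr_gt0.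
Qed.

(** * Exponents [p < 1] *)

Lemma bump_powR (R : realType) (b p : R) : 0 < b <= 2 -> 0 < p < 1 ->
  b / 2 <= b `^ p /\ (4 / 9 <= b -> 4 / 9 <= b `^ p).
Proof.
move=> /andP[b0 b2] /andP[p0 p1].
have [b1|b1] := leP b 1.
  have h : b <= b `^ p by rewrite ger1_powR ?b0 // ltW.
  by split=> [|k]; [move: h b0; clear; lra | exact: le_trans h].
have h : 1 <= b `^ p.
  by rewrite -(powRr0 b) ler_powR // ltW.
by split=> *; move: h b2; clear; lra.
Qed.

(** [tp], [tq], [bp] and [il] stand for [t^p], [t^(1-p)], [b^p] and [1 / l^2]. After division by
    [t^p], contact opposes [t^(1-p)] to [B], hence is impossible at small amplitude. The 9 comes
    from [4 / 9 <= bp] and from bounding the linear terms by [4 (il + (1 + mu) / 4)]. *)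
Lemma sublinear_bump_ineq (R : realFieldType)
    (G E t tp tq Tq b bp B N il K q A e mu L : R) :
  0 <= G -> 0 < E -> 0 < tp -> 0 < tq -> t = tp * tq -> tq <= Tq ->
  0 < b -> b <= 2 -> 0 < bp -> b / 2 <= bp -> (4 / 9 <= b -> 4 / 9 <= bp) -> 0 < B ->
  0 < il -> -1 <= mu -> 0 <= A * e -> K * q + 2 * (A * e) <= il ->
  Tq * (il + (1 + mu) / 4) <= B / 9 ->
  2 <= N \/ 4 / 9 <= b /\ - 6 <= N ->
  B * (G * (tp * bp * E)) <= - L + (mu / 8 + A * e) * G * (t * E * b) ->
  t * (G * E * ((N * il - b / 4) / 2 - K * q)) < L -> False.
Proof.
move=> G0 E0 tp0 tq0 tE tT b0 b2 bp0 bbp bbp' B0 il0 mu1 Ae small TB alt h1 h2.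
pose Y := - (N * il) / 2 + b / 8 + K * q + (mu / 8 + A * e) * b.
have Gtp : 0 <= G * tp * E by rewrite mulr_ge0 ?(ltW E0) // mulr_ge0 // ltW.
suff key : tq * Y <= B * bp.
  have := ler_wpM2l Gtp key; move: h1 h2; rewrite tE /Y; clear; lra.
have Aeb : A * e * b <= 2 * (A * e) by rewrite mulrC ler_wpM2r.
have k0 : 0 <= (1 + mu) / 4 by rewrite divr_ge0 //; move: mu1; clear; lra.
case: alt => [N2|[b49 N6]].
  have Nil := ler_wpM2r (ltW il0) N2.
  have Yle : Y <= (1 + mu) / 4 * bp.
    apply: (@le_trans _ _ ((1 + mu) / 4 * (b / 2))); last exact: ler_wpM2l.
    by rewrite /Y; move: Nil Aeb small; clear; lra.
  apply: (le_trans (ler_wpM2l (ltW tq0) Yle)).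
  rewrite mulrA ler_wpM2r ?(ltW bp0) //.
  have h3 := ler_wpM2r k0 tT.
  have h4 : 0 <= Tq * il by rewrite mulr_ge0 ?(ltW il0) // (le_trans (ltW tq0)).
  move: h3 h4 TB B0; clear; lra.
have Nil := ler_wpM2r (ltW il0) N6.
have k1 := ler_wpM2l k0 b2.
have Yle : Y <= 4 * (il + (1 + mu) / 4).
  by rewrite /Y; move: Nil Aeb small k1 k0; clear; lra.
apply: (le_trans (ler_wpM2l (ltW tq0) Yle)).
have h3 : tq * (il + (1 + mu) / 4) <= Tq * (il + (1 + mu) / 4).
  by rewrite ler_wpM2r // addr_ge0 // ltW.
have h4 := ler_wpM2l (ltW B0) (bbp' b49).
by move: h3 h4 TB; clear; lra.
Qed.

(** For [p < 1] the ratio [u^p / u] is large where [u] is small, so a low bump cannot touch [u], and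
    [u] is forced up to an amplitude [T] that balances [B]. The factor [e^(-(1-p) s / 2)] is what
    the substitution [u = e^(-s/2) z] absorbs. Widths up to [s a / 2] are allowed for the sake of
    [mu = -1]. *)
Lemma sublinear_bump (R : realType) d (s : lattice d -> R) (gamma C S0 : R)
    (u : lattice d -> R) (mu A e p : R) :
  (0 < d)%N -> log_regular s gamma C S0 -> (forall x, 0 < u x) ->
  -1 <= mu -> 0 <= A -> 0 < e -> 0 < p < 1 ->
  exists S2, forall a l B T, S2 < s a -> 1 <= l -> l <= s a / 2 -> 0 < B -> 0 < T ->
    (forall x, `|s x - s a| < l ->
      B * (grad2 s x * expR (- ((1 - p) / 2 * s x))) * u x `^ p <=
      - lap u x + potential s mu A e x * u x) ->
    T `^ (1 - p) * (1 / l ^+ 2 + (1 + mu) / 4) <= B / 9 ->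
    T * expR (- (1 / 2 * s a)) <= u a.
Proof.
move=> d0 reg u0 mu1 A0 e0 p01; have /andP[p0 p1] := p01.
have [K [S1 [K0 S10 H]]] := bump_touching d0 reg.
have [g0 _ _ _] := reg.
have half0 : 0 < 1 / 2 :> R by rewrite divr_gt0.
have A20 : 0 <= 2 * A by rewrite mulr_ge0.
have [T1 dec1] := expR_decay g0 K0 half0.
have [T2 dec2] := expR_decay e0 A20 half0.
exists (2 * Num.max S1 (Num.max T1 T2)) => a l B T aS l1 la B0 T0 hu TB.
rewrite leNgt; apply/negP => ua.
have l0 : 0 < l by apply: lt_le_trans l1.
set S2 := Num.max S1 _ in aS.
have S1S2 : S1 <= S2 by rewrite /S2 le_max lexx.
have S1a : S1 + l < s a by move: S1S2 aS la; clear; lra.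
have [x [X [t [X1 sx /andP[t0 tT] ux hl]]]] := H u a l T u0 l1 S1a T0 ua.
have lX : `|l * X| < l by rewrite normrM (gtr0_norm l0) gtr_pMr.
have [sxl sxS] : l < s x /\ S2 < s x.
  by rewrite sx; move: lX; rewrite ltr_norml => /andP[]; move: la aS; clear; lra.
move: sxS; rewrite /S2 !gt_max => /and3P[_ t1 t2].
have xa : `|s x - s a| < l by rewrite sx addrC addKr.
have := hu x xa; rewrite ux.
have E0 := expR_gt0 (- (1 / 2 * s x)).
have /andP[b0 b2] := bump_gt0 X1.
have [bp1 bp2] := bump_powR (bump_gt0 X1) p01.
have -> : (t * expR (- (1 / 2 * s x)) * quartic X) `^ p =
   t `^ p * quartic X `^ p * expR (- (p / 2 * s x)).
  rewrite powRM ?(mulr_ge0 (ltW t0) (ltW E0)) ?(ltW b0) //.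
  rewrite powRM ?(ltW t0) ?(ltW E0) // -expRM mulrAC; congr (_ * expR _).
  by field.
have -> : B * (grad2 s x * expR (- ((1 - p) / 2 * s x))) *
    (t `^ p * quartic X `^ p * expR (- (p / 2 * s x))) =
   B * (grad2 s x * (t `^ p * quartic X `^ p * expR (- (1 / 2 * s x)))).
  have -> : expR (- (1 / 2 * s x)) =
     expR (- ((1 - p) / 2 * s x)) * expR (- (p / 2 * s x)).
    by rewrite -expRD; congr expR; field.
  by ring.
move=> h1.
have tE : t = t `^ p * t `^ (1 - p).
  rewrite -powRD; last by rewrite (gt_eqF t0) implybT.
  by rewrite addrC subrK powRr1 // ltW.
apply: (@sublinear_bump_ineq R (grad2 s x) (expR (- (1 / 2 * s x))) t (t `^ p)
  (t `^ (1 - p)) (T `^ (1 - p)) (quartic X) (quartic X `^ p) B (12 * X ^+ 2 - 6)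
  (1 / l ^+ 2) K (expR (- (gamma * s x))) A (expR (- (e * s x))) mu (lap u x));
  rewrite ?grad2_ge0 ?powR_gt0 ?divr_gt0 ?exprn_gt0 //.
- apply: ge0_ler_powR; rewrite ?nnegrE ?subr_ge0 ?(ltW p1) ?(ltW t0) ?(ltW T0) //.
  by move: tT T0; clear; lra.
- by rewrite mulr_ge0 ?expR_ge0.
- have [_ h2] := dec1 _ t1; have [_ h3] := dec2 _ t2.
  rewrite ler_pdivlMr ?exprn_gt0 //.
  have ll : l ^+ 2 <= 1 + s x ^+ 2.
    by rewrite ler_wpDl // lerXn2r ?nnegrE ?(ltW l0) ?(ltW sxl) // ltW // (lt_trans l0).
  have Q0 : 0 <= K * expR (- (gamma * s x)) + 2 * (A * expR (- (e * s x))).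
    by rewrite addr_ge0 ?mulr_ge0 ?expR_ge0 // mulr_ge0 ?expR_ge0.
  have := ler_wpM2l Q0 ll; move: h2 h3; clear; lra.
- exact: bump_alt.
- by move: hl; rewrite (div1r (l ^+ 2)).
Qed.

(** For [z = e^(s/2) u] the nonlinear term is [e^(F s) z^p], with [F = E + (1 - p) / 2], and bumps
    of width 1 force [z] to be at least of order [e^(k1 s)] with [k1 = F / (1 - p)]. The hypothesis
    on [E] says exactly that [k1] exceeds [sqrt (1 + mu) / 2]. *)
Lemma no_sublinear (R : realType) d (s : lattice d -> R) (gamma C S0 : R)
    (u : lattice d -> R) (mu A e S1 c E p : R) :
  (0 < d)%N -> log_regular s gamma C S0 -> (forall x, 0 < u x) ->
  -1 <= mu -> 0 <= A -> 0 < e -> 0 < c -> 0 < p < 1 ->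
  (1 - p) * (Num.sqrt (1 + mu) - 1) / 2 < E ->
  (forall x, S1 < s x -> c * (expR (E * s x) * grad2 s x) * u x `^ p <=
     - lap u x + potential s mu A e x * u x) -> False.
Proof.
move=> d0 reg u0 mu1 A0 e0 c0 p01 hE hu.
have /andP[p0 p1] := p01.
have q0 : 0 < 1 - p by rewrite subr_gt0.
have mu0 : 0 <= 1 + mu by move: mu1; clear; lra.
pose F := E + (1 - p) / 2.
pose ka := Num.sqrt (1 + mu) / 2.
have ka0 : 0 <= ka by rewrite divr_ge0 ?sqrtr_ge0.
have ka2 : ka ^+ 2 = (1 + mu) / 4.
  by rewrite /ka expr_div_n sqr_sqrtr //; field.
pose k1 := F / (1 - p).
have kk : ka < k1.
  rewrite /k1 ltr_pdivlMr // /F /ka; move: hE; set r := Num.sqrt _; clear; lra.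
have [S2 H] := sublinear_bump d0 reg u0 mu1 A0 e0 p01.
have K0 : 0 < 9 * (1 + (1 + mu) / 4) by rewrite mulr_gt0 // ltr_wpDr // divr_ge0.
(* [s] varies by less than 1 over the annulus, so [e^(F s)] loses at most a factor [e^|F|]. *)
pose c1 := c * expR (- `|F|).
have c10 : 0 < c1 by rewrite mulr_gt0 ?expR_gt0.
pose c2 := c1 / (9 * (1 + (1 + mu) / 4)).
have c20 : 0 < c2 by rewrite divr_gt0.
have hu0 x : S1 < s x -> lap u x <= potential s mu A e x * u x.
  move=> /hu h; rewrite -subr_ge0 addrC; apply: le_trans h.
  by rewrite !mulr_ge0 ?expR_ge0 ?grad2_ge0 ?powR_ge0 ?(ltW c0).
pose T1 := Num.max 2 (Num.max (S1 + 1) S2).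
have T1P x : T1 < s x -> [/\ 2 < s x, S1 + 1 < s x & S2 < s x].
  by rewrite /T1 !gt_max => /and3P[-> -> ->].
apply: (@no_fast_growth R d s gamma C S0 u mu A e (Num.max S1 T1)
  (expR (ln c2 / (1 - p))) ((ka + k1) / 2) k1) => //.
- by move=> x; rewrite gt_max => /andP[/hu0].
- exact: expR_gt0.
- by move: kk ka0; clear; lra.
- rewrite -ka2 ltrXn2r ?nnegrE //=; move: kk ka0; clear; lra.
- by move: kk; clear; lra.
move=> a; rewrite gt_max => /andP[_ /T1P[a2 a1 aS2]].
pose T := expR ((ln c2 + F * s a) / (1 - p)).
have -> : expR (ln c2 / (1 - p)) * expR (- ((1 / 2 - k1) * s a)) = T * expR (- (1 / 2 * s a)).
  by rewrite /T -!expRD /k1; congr expR; field; rewrite gt_eqF.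
apply: (H a 1 (c1 * expR (F * s a))) => //.
- by move: a2; clear; lra.
- by rewrite mulr_gt0 ?expR_gt0.
- exact: expR_gt0.
- move=> x xa.
  have x1 : S1 < s x by move: xa a1; rewrite ltr_norml => /andP[]; clear; lra.
  apply: le_trans (hu x x1); rewrite ler_wpM2r ?powR_ge0 //.
  have -> : c1 * expR (F * s a) * (grad2 s x * expR (- ((1 - p) / 2 * s x))) =
     c * ((expR (- `|F|) * expR (F * s a) * expR (- ((1 - p) / 2 * s x))) * grad2 s x).
    by rewrite /c1; ring.
  rewrite ler_wpM2l ?(ltW c0) // ler_wpM2r ?grad2_ge0 //.
  rewrite -!expRD ler_expR.
  have : - `|F| <= F * (s x - s a).
    apply: (@le_trans _ _ (- `|F * (s x - s a)|)).
      by rewrite lerN2 normrM ler_piMr // ltW.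
    by rewrite lerNl -normrN ler_norm.
  by rewrite /F; clear; lra.
- rewrite /T expr1n divr1 -expRM divfK ?gt_eqF // expRD lnK ?posrE //.
  rewrite le_eqVlt; apply/orP; left; apply/eqP; rewrite /c2.
  by field; move: mu0; clear; lra.
Qed.

(** When [F = 0], bumps of width 1 only give a constant amplitude. But [1 + mu = 0] leaves [1 / l^2]
    as the only cost, and the width [s a / 2] gives [T^(1-p)] proportional to [s^2]: a growth
    [s^(2 / (1-p))], with an exponent above 2. *)
Lemma no_sublinear_critical (R : realType) d (s : lattice d -> R) (gamma C S0 : R)
    (u : lattice d -> R) (A e S1 c E p : R) :
  (0 < d)%N -> log_regular s gamma C S0 -> (forall x, 0 < u x) ->
  0 <= A -> 0 < e -> 0 < c -> 0 < p < 1 -> - (1 - p) / 2 <= E ->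
  (forall x, S1 < s x -> c * (expR (E * s x) * grad2 s x) * u x `^ p <=
     - lap u x + potential s (-1) A e x * u x) -> False.
Proof.
move=> d0 reg u0 A0 e0 c0 p01 hE hu.
have /andP[p0 p1] := p01.
have q0 : 0 < 1 - p by rewrite subr_gt0.
have mu1 : -1 <= -1 :> R by [].
have [S2 H] := sublinear_bump d0 reg u0 mu1 A0 e0 p01.
(* [36 = 9 * 4], the 4 coming from [l = s a / 2]. *)
pose c2 := c / 36.
have c20 : 0 < c2 by rewrite divr_gt0.
have hu0 x : S1 < s x -> lap u x <= potential s (-1) A e x * u x.
  move=> /hu h; rewrite -subr_ge0 addrC; apply: le_trans h.
  by rewrite !mulr_ge0 ?expR_ge0 ?grad2_ge0 ?powR_ge0 ?(ltW c0).
pose T1 := Num.max 2 (Num.max (2 * S1) S2).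
have T1P x : T1 < s x -> [/\ 2 < s x, 2 * S1 < s x & S2 < s x].
  by rewrite /T1 !gt_max => /and3P[-> -> ->].
apply: (@no_fast_growth_critical R d s gamma C S0 u A e (Num.max S1 T1)
  (expR (ln c2 / (1 - p))) (2 / (1 - p))) => //.
- by move=> x; rewrite gt_max => /andP[/hu0].
- exact: expR_gt0.
- by rewrite ltr_pdivlMr //; move: p0; clear; lra.
move=> a; rewrite gt_max => /andP[_ /T1P[a2 a1 aS2]].
have a0 : 0 < s a by apply: lt_trans a2.
pose T := expR ((ln c2 + 2 * ln (s a)) / (1 - p)).
have -> : expR (ln c2 / (1 - p)) * expR (2 / (1 - p) * ln (s a)) = T.
  by rewrite /T -!expRD; congr expR; field; rewrite gt_eqF.
apply: (H a (s a / 2) c) => //.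
- by move: a2; clear; lra.
- exact: expR_gt0.
- move=> x xa.
  have [x1 x0] : S1 < s x /\ 0 < s x.
    by move: xa a1 a0; rewrite ltr_norml => /andP[]; clear; lra.
  apply: le_trans (hu x x1); rewrite ler_wpM2r ?powR_ge0 // ler_wpM2l ?(ltW c0) //.
  rewrite mulrC ler_wpM2r ?grad2_ge0 // ler_expR -mulNr ler_wpM2r ?(ltW x0) //.
  by rewrite -mulNr.
- rewrite /T -expRM divfK ?gt_eqF // expRD lnK ?posrE // expRM_natl lnK ?posrE //.
  rewrite le_eqVlt; apply/orP; left; apply/eqP; rewrite /c2 subrr mul0r addr0.
  by field; rewrite gt_eqF.
Qed.

(** * Reduction to the logarithmic variable *)

Lemma limf_esup_bounded (R : realType) (T : choiceType) (X : filteredType T)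
    (f : X -> R) (F : set (set X)) :
  (limf_esup (fun x => (f x)%:E) F < +oo)%E ->
  exists b V, F V /\ forall x, V x -> f x <= b.
Proof.
move=> /ereal_inf_lt[_ [V FV <-] supV].
have ub x : V x -> ((f x)%:E <= ereal_sup [set (f y)%:E | y in V])%E.
  by move=> Vx; apply: ereal_sup_ubound; exists x.
move: supV ub; case: (ereal_sup _) => [r||] // _ ub.
  by exists r, V; split=> // x /ub; rewrite lee_fin.
by exists 0, V; split=> // x /ub.
Qed.

Lemma limf_einf_gt (R : realType) (T : choiceType) (X : filteredType T)
    (f : X -> R) (F : set (set X)) (a : R) :
  (a%:E < limf_einf (fun x => (f x)%:E) F)%E ->
  exists b V, [/\ a < b, F V & forall x, V x -> b <= f x].
Proof.
rewrite /limf_einf lteNr => /ereal_inf_lt[_ [V FV <-] supV].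
have ub x : V x -> (- (f x)%:E <= ereal_sup [set (- (f y)%:E)%E | y in V])%E.
  by move=> Vx; apply: ereal_sup_ubound; exists x.
move: supV ub; case: (ereal_sup _) => [r||] //.
  rewrite -EFinN lte_fin => ra ub; exists (- r), V; split=> //; first by rewrite ltrNr.
  by move=> x /ub; rewrite -EFinN lee_fin lerNl.
by move=> _ ub; exists (a + 1), V; split=> [|//|x /ub //]; rewrite ltrDl.
Qed.

Lemma at_infinity_log (R : realType) d (s : lattice d -> R) (D K : R) (V : set (lattice d)) :
  0 <= D -> (forall x, `|s x - D * lnu R x| <= K) -> at_infinity R d V ->
  exists S, forall x, S < s x -> V x.
Proof.
move=> D0 sK [M _ MV]; exists (K + D * ln (M ^+ 2 + 1)) => x xS; apply: MV => /=.
have M0 : 0 <= M ^+ 2 by exact: sqr_ge0.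
rewrite ltNge; apply/negP => xM.
have nM : nsq R x <= M ^+ 2.
  have := sqr_sqrtr (nsq_ge0 R x) => <-.
  rewrite lerXn2r ?nnegrE ?sqrtr_ge0 //; apply: le_trans xM; exact: sqrtr_ge0.
have : lnu R x <= ln (M ^+ 2 + 1).
  by rewrite ler_ln ?posrE ?nu_gt0 ?lerD2r // ltr_wpDl.
move=> /(ler_wpM2l D0); have := sK x; rewrite ler_norml => /andP[_].
by move: xS; clear; lra.
Qed.

Lemma ln_euclid_norm (R : realType) d (s : lattice d -> R) (K : R) :
  (3 <= d)%N -> (forall x, `|s x - (d%:R - 2) / 2 * lnu R x| <= K) ->
  exists K' S, forall x, S < s x -> 0 < euclid_norm R x /\
    `|ln (euclid_norm R x) - (d%:R - 2)^-1 * s x| <= K'.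
Proof.
move=> d3 sK.
have D0 : 0 < (d%:R - 2 : R) by rewrite subr_gt0 ltr_nat.
have K0 : 0 <= K by apply: le_trans (sK 0).
have l20 : 0 <= ln 2 :> R by rewrite ln_ge0 // ler1n.
exists ((d%:R - 2)^-1 * K + ln 2), (K + (d%:R - 2) / 2 * ln 2) => x xS.
have hl : ln 2 < lnu R x.
  rewrite -(@ltr_pM2l _ ((d%:R - 2) / 2)) ?divr_gt0 //.
  by have := sK x; rewrite ler_norml => /andP[_]; move: xS; clear; lra.
have n1 : 1 < nsq R x.
  by move: hl; rewrite ltr_ln ?posrE ?nu_gt0 //; clear; lra.
have n0 : 0 < nsq R x by apply: lt_trans n1.
split; first by rewrite sqrtr_gt0.
have -> : ln (euclid_norm R x) = ln (nsq R x) / 2.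
  by rewrite /euclid_norm -/(nsq R x) -powR12_sqrt ?(ltW n0) // ln_powR mulrC.
have h1 : ln (nsq R x) <= lnu R x by rewrite ler_ln ?posrE ?nu_gt0 // lerDl.
have h2 : lnu R x <= ln (nsq R x) + ln 2.
  rewrite -lnM ?posrE // ler_ln ?posrE ?nu_gt0 ?mulr_gt0 //.
  by move: n1; clear; lra.
have h3 : `|(d%:R - 2)^-1 * s x - lnu R x / 2| <= (d%:R - 2)^-1 * K.
  have -> : (d%:R - 2)^-1 * s x - lnu R x / 2 =
      (d%:R - 2)^-1 * (s x - (d%:R - 2) / 2 * lnu R x) by field; rewrite gt_eqF.
  by rewrite normrM gtr0_norm ?invr_gt0 // ler_wpM2l // invr_ge0 ltW.
move: h3 h1 h2 l20; rewrite !ler_norml => /andP[]; clear=> *.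
by apply/andP; split; lra.
Qed.

(** The square root of [Phi] is the power [a = 1 / 2] of [e^(-s)], for which
    [- (a^2 - a) / 2 = 1 / 8]. *)
Lemma hardy_weight_log (R : realType) d (Phi : lattice d -> R) (gamma C S0 : R) :
  (forall x, 0 < Phi x) -> log_regular (fun x => - ln (Phi x)) gamma C S0 ->
  exists K S, [/\ 0 <= K, S0 <= S & forall x, S < - ln (Phi x) ->
    `|hardy_weight Phi x - grad2 (fun x => - ln (Phi x)) x / 8| <=
    K * expR (- (gamma * - ln (Phi x))) * grad2 (fun x => - ln (Phi x)) x].
Proof.
move=> P0 reg; have [K [S [K0 SS H]]] := lap_power (1 / 2) reg.
exists K, S; split=> // x xS; have := H x xS.
set s := fun x => - ln (Phi x).
have E0 := expR_gt0 (- (1 / 2 * s x)).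
rewrite /hardy_weight laplacianE.
have -> : (fun y => Phi y `^ (1 / 2)) = (fun y => expR (- (1 / 2 * s y))).
  by apply/funext => y; rewrite /powR gt_eqF // /s; congr expR; ring.
have -> : Phi x `^ (- (1 / 2)) = (expR (- (1 / 2 * s x)))^-1.
  by rewrite /powR gt_eqF // -expRN /s; congr expR; ring.
rewrite -/(s x); set L := lap _ x; set E := expR _ in E0 *.
set G := grad2 s x => h; rewrite -(ler_pM2r E0).
apply: le_trans h; rewrite -[X in _ * X](gtr0_norm E0) -normrM -normrN.
by rewrite le_eqVlt; apply/orP; left; apply/eqP; congr `|_|; field; rewrite gt_eqF.
Qed.

(** Two errors add up: [e^(-gamma s)] from the expansion of the Hardy weight, and [|x|^(-eps0)],
    comparable to [e^(-eps0 gamma s)], from the limsup. The second dominates since [eps0 < 1]. *)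
Lemma weight_asymptotics (R : realType) d (Phi H0 : lattice d -> R) (C S0 K eps0 : R) :
  (3 <= d)%N -> (forall x, 0 < Phi x) ->
  log_regular (fun x => - ln (Phi x)) (d%:R - 2)^-1 C S0 ->
  (forall x, `|- ln (Phi x) - (d%:R - 2) / 2 * lnu R x| <= K) ->
  (forall x, 0 <= H0 x <= hardy_weight Phi x) -> 0 < eps0 < 1 ->
  (limf_esup (fun x : lattice d => ((hardy_weight Phi x - H0 x)
     * euclid_norm R x `^ eps0 / hardy_weight Phi x)%:E) (at_infinity R d) < +oo)%E ->
  exists A S, 0 <= A /\ forall x, S < - ln (Phi x) ->
    `|H0 x - grad2 (fun x => - ln (Phi x)) x / 8| <=
    A * expR (- (eps0 * (d%:R - 2)^-1 * - ln (Phi x))) *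
      grad2 (fun x => - ln (Phi x)) x.
Proof.
move=> d3 P0 reg sK H0b /andP[e0 e1] /limf_esup_bounded[b [V [FV hV]]].
have D0 : 0 < (d%:R - 2 : R) by rewrite subr_gt0 ltr_nat.
have g0 : 0 < (d%:R - 2)^-1 :> R by rewrite invr_gt0.
set s := fun x => - ln (Phi x) in reg sK *.
set gamma := (d%:R - 2)^-1 in reg g0 *.
have [T1 hT1] := at_infinity_log (divr_ge0 (ltW D0) (ler0n R 2)) sK FV.
have [K1 [T2 hT2]] := ln_euclid_norm d3 sK.
have [K2 [T3 [K20 _ hT3]]] := hardy_weight_log P0 reg.
exists (K2 + `|b| * expR (eps0 * K1) * (1 / 8 + K2)).
exists (Num.max 0 (Num.max T1 (Num.max T2 T3))); split.
  by rewrite addr_ge0 // !mulr_ge0 ?expR_ge0 // addr_ge0.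
move=> x; rewrite !gt_max -/(s x) => /and4P[x0 t1 t2 t3].
have hb := hV x (hT1 x t1); have [n0 hn'] := hT2 x t2.
have hn : `|ln (euclid_norm R x) - gamma * s x| <= K1 := hn'.
have hh : `|hardy_weight Phi x - grad2 s x / 8| <=
  K2 * expR (- (gamma * s x)) * grad2 s x := hT3 x t3.
set G := grad2 s x in hh *; have G0 : 0 <= G by exact: grad2_ge0.
have /andP[h0 hH] := H0b x.
set q := expR (- (eps0 * gamma * s x)).
have qg : expR (- (gamma * s x)) <= q.
  by rewrite ler_expR lerN2 ler_wpM2r ?(ltW x0) // ler_piMl // ltW.
have q1 : expR (- (gamma * s x)) <= 1.
  by apply: expR_opp_le1; rewrite ltW.
set Hb := hardy_weight Phi x in hb hh hH *.
have Hb0 : 0 <= Hb by apply: le_trans hH.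
have HbG : Hb <= (1 / 8 + K2) * G.
  have := ler_wpM2l (mulr_ge0 K20 G0) q1; move: hh; rewrite ler_norml => /andP[_].
  by clear; lra.
have nq : (euclid_norm R x `^ eps0)^-1 <= expR (eps0 * K1) * q.
  rewrite /powR gt_eqF // -expRN /q -expRD ler_expR.
  have : eps0 * (gamma * s x - ln (euclid_norm R x)) <= eps0 * K1.
    rewrite ler_wpM2l ?(ltW e0) //; move: hn; rewrite ler_norml => /andP[]; clear; lra.
  by clear; lra.
have hd : Hb - H0 x <= `|b| * (expR (eps0 * K1) * q) * Hb.
  (* Where the weight vanishes the quotient is 0 by default and says nothing, but [0 <= H0]
     suffices. *)
  move: Hb0; rewrite le_eqVlt => /predU1P[Hb0|Hb0].
    rewrite -Hb0 mulr0 sub0r oppr_le0 //.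
  have N0 : 0 < euclid_norm R x `^ eps0 by rewrite powR_gt0.
  move: hb; rewrite ler_pdivrMr // -ler_pdivlMr // => hb.
  apply: (le_trans hb); rewrite mulrAC ler_wpM2r ?(ltW Hb0) //.
  apply: (@le_trans _ _ (`|b| / euclid_norm R x `^ eps0)).
    by rewrite ler_wpM2r ?invr_ge0 ?(ltW N0) ?ler_norm.
  exact: ler_wpM2l.
have k1 := ler_wpM2l (mulr_ge0 K20 G0) qg.
have k2 : `|b| * (expR (eps0 * K1) * q) * Hb <=
    `|b| * (expR (eps0 * K1) * q) * ((1 / 8 + K2) * G).
  by rewrite ler_wpM2l // !mulr_ge0 ?expR_ge0.
have k3 : 0 <= `|b| * (expR (eps0 * K1) * q) * ((1 / 8 + K2) * G).
  by rewrite mulr_ge0 ?mulr_ge0 ?expR_ge0 // addr_ge0.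
move: hd k1 k2 k3 hh hH; rewrite !ler_norml => c1 c2 c3 c4 /andP[c5 c6] c7.
by clear -c1 c2 c3 c4 c5 c6 c7; apply/andP; split; lra.
Qed.

(** At a zero of [u] the potential term vanishes, and so does [W u^p] because [p > 0]; zeros would
    then spread to the whole lattice. *)
Lemma solution_gt0 (R : realType) d (mu p : R) (H W u : lattice d -> R) :
  0 < p -> solution mu p H W u -> forall x, 0 < u x.
Proof.
move=> p0 [hu u0 [a ua]] x; rewrite lt_def u0 andbT; apply: contra ua => /eqP ux.
apply/eqP; apply: (strong_maximum_principle u0 _ ux) => y uy.
have := hu y; rewrite /hardy_operator uy powR0 ?gt_eqF // !mulr0 addr0 laplacianE.
by rewrite oppr_ge0.
Qed.

(** [|x|^theta] is comparable to [e^(theta gamma s)], and [grad2], a sum of [2 d] squared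
    increments, is at most a multiple of [e^(-2 gamma s)]: this is the 2 in [2 + theta]. *)
Lemma weight_lower_bound (R : realType) d (s W : lattice d -> R) (gamma C S0 K theta : R) :
  (3 <= d)%N -> log_regular s gamma C S0 -> gamma = (d%:R - 2)^-1 ->
  (forall x, `|s x - (d%:R - 2) / 2 * lnu R x| <= K) ->
  (0 < limf_einf (fun x : lattice d => (W x * euclid_norm R x `^ (- theta))%:E)
         (at_infinity R d))%E ->
  exists c S, 0 < c /\ forall x, S < s x ->
    c * (expR ((2 + theta) / (d%:R - 2) * s x) * grad2 s x) <= W x.
Proof.
move=> d3 [_ C0 _ regx] gE sK /limf_einf_gt[c0 [V [c00 FV hV]]].
have D0 : 0 < (d%:R - 2 : R) by rewrite subr_gt0 ltr_nat.
have [T1 hT1] := at_infinity_log (divr_ge0 (ltW D0) (ler0n R 2)) sK FV.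
have [K1 [T2 hT2]] := ln_euclid_norm d3 sK.
pose B := 2 * d%:R * C ^+ 2 + 1.
have B0 : 0 < B by rewrite ltr_wpDl // mulr_ge0 ?sqr_ge0.
exists (c0 * expR (- (`|theta| * K1)) / B), (Num.max S0 (Num.max T1 T2)).
split; first by rewrite divr_gt0 // mulr_gt0 ?expR_gt0.
move=> x; rewrite !gt_max => /and3P[x0 t1 t2].
have hW := hV x (hT1 x t1); have [n0 hn] := hT2 x t2.
rewrite -gE in hn.
have [_ inc] := regx x x0.
have N0 : 0 < euclid_norm R x `^ theta by rewrite powR_gt0.
rewrite powRN ler_pdivlMr // in hW.
apply: le_trans hW; rewrite -!mulrA ler_wpM2l ?(ltW c00) //.
have hN : expR (theta * (gamma * s x) - `|theta| * K1) <= euclid_norm R x `^ theta.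
  rewrite /powR gt_eqF // ler_expR lerBlDr -lerBlDl -mulrBr.
  rewrite (le_trans (ler_norm _)) // normrM ler_wpM2l // distrC //.
apply: le_trans hN; rewrite [X in _ <= expR X]addrC expRD ler_wpM2l ?expR_ge0 //.
rewrite ler_pdivrMl //.
have GB : grad2 s x <= B * expR (- (gamma * s x)) ^+ 2.
  apply: (@le_trans _ _ (2 * d%:R * (C * expR (- (gamma * s x))) ^+ 2)).
    rewrite -sum_cst_steps /grad2 ler_sum // => i _.
    rewrite -real_normK ?num_real // lerXn2r ?nnegrE ?mulr_ge0 ?expR_ge0 //.
  by rewrite exprMn mulrA ler_wpM2r ?sqr_ge0 // lerDl.
apply: (le_trans (ler_wpM2l (expR_ge0 _) GB)).
rewrite mulrCA -expRM_natr -expRD le_eqVlt; apply/orP; left; apply/eqP.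
by rewrite gE; congr (_ * expR _); field; rewrite gt_eqF.
Qed.

Lemma log_reduction (R : realType) (d : nat) (theta : R) (Phi H0 W : lattice d -> R) :
  (3 <= d)%N -> fundamental_solution Phi ->
  (forall x, 0 <= H0 x <= hardy_weight Phi x) ->
  (exists2 eps0 : R, 0 < eps0 < 1 &
    (limf_esup (fun x : lattice d => ((hardy_weight Phi x - H0 x)
      * euclid_norm R x `^ eps0 / hardy_weight Phi x)%:E) (at_infinity R d) < +oo)%E) ->
  (0 < limf_einf (fun x : lattice d => (W x * euclid_norm R x `^ (- theta))%:E)
         (at_infinity R d))%E ->
  exists s gamma C S0 A e c S1,
  [/\ log_regular s gamma C S0, [/\ 0 <= A, 0 < e & 0 < c],
    forall V, at_infinity R d V -> exists S, forall x, S < s x -> V x,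
    forall x, S1 < s x ->
      `|H0 x - grad2 s x / 8| <= A * expR (- (e * s x)) * grad2 s x &
    forall x, S1 < s x ->
      c * (expR ((2 + theta) / (d%:R - 2) * s x) * grad2 s x) <= W x].
Proof.
move=> d3 Phif H0b [eps0 he hsup] hinf.
have d0 : (0 < d)%N by apply: leq_trans d3.
have P0 := fundamental_gt0 d0 Phif.
have D0 : 0 < (d%:R - 2 : R) by rewrite subr_gt0 ltr_nat.
have [C [S0 [K [reg sK]]]] := fundamental_log_regular d3 Phif.
have [A [T1 [A0 hA]]] := weight_asymptotics d3 P0 reg sK H0b he hsup.
have [c [T2 [c0 hc]]] := weight_lower_bound d3 reg erefl sK hinf.
exists (fun x => - ln (Phi x)), (d%:R - 2)^-1, C, S0, A, (eps0 * (d%:R - 2)^-1), c.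
exists (Num.max T1 T2); split=> //.
- by split=> //; rewrite mulr_gt0 ?invr_gt0 //; case/andP: he.
- move=> V; apply: at_infinity_log sK; exact: divr_ge0 (ltW D0) (ler0n R 2).
- by move=> x; rewrite gt_max => /andP[/hA].
- by move=> x; rewrite gt_max => /andP[_ /hc].
Qed.

Lemma solution_potential (R : realType) d (s : lattice d -> R) (mu p c E A e S1 : R)
    (H W u : lattice d -> R) :
  (forall x, 0 < u x) -> 
  (forall x, S1 < s x -> `|H x - grad2 s x / 8| <= A * expR (- (e * s x)) * grad2 s x) ->
  (forall x, S1 < s x -> c * (expR (E * s x) * grad2 s x) <= W x) ->
  solution mu p H W u ->
  forall x, S1 < s x -> c * (expR (E * s x) * grad2 s x) * u x `^ p <=
    - lap u x + potential s mu (`|mu| * A) e x * u x.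
Proof.
move=> u0 hH hW [hu _ _] x xS.
apply: (@le_trans _ _ (W x * u x `^ p)).
  by rewrite ler_wpM2r ?powR_ge0 // hW.
apply: (le_trans (hu x)); rewrite /hardy_operator laplacianE lerD2l.
rewrite ler_wpM2r ?(ltW (u0 x)) // /potential mulrDl.
rewrite -lerBlDl.
have -> : mu * H x - mu / 8 * grad2 s x = mu * (H x - grad2 s x / 8) by field.
by rewrite (le_trans (ler_norm _)) // normrM -!mulrA ler_wpM2l // mulrA hH.
Qed.

(** For [p = 1] the potential [W - mu H] is at least [(1 + eta) H] with [eta = b - (mu + 1)], and
    [H] is asymptotic to Hardy's threshold [grad2 / 8]. *)
Lemma no_solution_linear (R : realType) d (s : lattice d -> R) (gamma C S0 : R)
    (mu A e S1 : R) (H W u : lattice d -> R) :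
  (0 < d)%N -> log_regular s gamma C S0 -> -1 <= mu -> 0 <= A -> 0 < e ->
  (forall V, at_infinity R d V -> exists S, forall x, S < s x -> V x) ->
  (forall x, S1 < s x -> `|H x - grad2 s x / 8| <= A * expR (- (e * s x)) * grad2 s x) ->
  (forall x, 0 <= H x) ->
  ((mu + 1)%:E < limf_einf (fun x : lattice d => (W x / H x)%:E) (at_infinity R d))%E ->
  ~ solution mu 1 H W u.
Proof.
move=> d0 reg mu1 A0 e0 hV hH H0 /limf_einf_gt[b [V [mub FV hb]]] sol.
have u0 := solution_gt0 ltr01 sol; have [hu _ _] := sol.
pose eta := b - (mu + 1); have eta0 : 0 < eta by rewrite subr_gt0.
have b0 : 0 < b by apply: le_lt_trans mub; rewrite -lerBlDr sub0r.
have [T1 hT1] := hV V FV.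
have A10 : 0 <= (1 + eta) * A by rewrite mulr_ge0 // addr_ge0 // ltW.
have e160 : 0 < eta / 16 by rewrite divr_gt0.
have [T2 dec] := expR_small e0 A10 e160.
apply: (@no_supercritical R d s gamma C S0 u (eta / 16) (Num.max S1 (Num.max T1 T2))) => //.
move=> x; rewrite !gt_max => /and3P[x1 t1 t2].
have hWH := hb x (hT1 x t1).
(* Where [H x = 0] the quotient would be 0 by default, contradicting [0 < b]. *)
have Hx0 : 0 < H x.
  rewrite lt_def H0 andbT; apply/eqP => Hx; move: hWH; rewrite Hx invr0 mulr0.
  by rewrite leNgt b0.
rewrite ler_pdivlMr // in hWH.
have := hu x; rewrite /hardy_operator laplacianE powRr1 ?(ltW (u0 x)) // => hux.
have hG := hH x x1; rewrite ler_norml in hG; have /andP[hG1 _] := hG.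
have G0 := grad2_ge0 s x.
have k1 := ler_wpM2r G0 (dec _ t2).
have e1 : 0 <= 1 + eta by rewrite addr_ge0 // ltW.
have k2 := ler_wpM2l e1 hG1.
have k3 : (1 / 8 + eta / 16) * grad2 s x <= (1 + eta) * H x.
  by move: k1 k2; clear; lra.
apply: (le_trans (ler_wpM2r (ltW (u0 x)) k3)).
have k4 := ler_wpM2r (ltW (u0 x)) hWH.
by move: hux k4; rewrite /eta; clear; lra.
Qed.

(** * Critical exponents and case distinction *)

(** [- tau_minus] is [d - 2] times the decay exponent [al] of supersolutions, so [p_star] is the
    root of [al (p - 1) = E]. *)
Lemma le_p_star (R : realType) d (mu theta p : R) : (3 <= d)%N ->
  p <= p_star d mu theta ->
  (1 + Num.sqrt (1 + mu)) / 2 * (p - 1) <= (2 + theta) / (d%:R - 2).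
Proof.
move=> d3; have D0 : 0 < (d%:R - 2 : R) by rewrite subr_gt0 ltr_nat.
have r0 : 0 < 1 + Num.sqrt (1 + mu) by rewrite ltr_wpDr ?sqrtr_ge0.
rewrite /p_star /tau_minus; set r := Num.sqrt _ in r0 *.
rewrite -lerBlDl ler_pdivlMr; last first.
  by rewrite -mulNr mulr_gt0 // -mulNr opprB divr_gt0.
by rewrite ler_pdivlMr //; clear; lra.
Qed.

(** [- tau_plus] has the sign of [- mu]: clearing this denominator reverses the inequality on [p]
    when [mu > 0], and both cases become the same condition. *)
Lemma p_sharp_cond (R : realType) d (mu theta p : R) : (3 <= d)%N ->
  (-1 <= mu < 0 /\ p < p_sharp d mu theta) \/ (0 < mu /\ p_sharp d mu theta < p) ->
  (1 - p) * (Num.sqrt (1 + mu) - 1) / 2 < (2 + theta) / (d%:R - 2).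
Proof.
move=> d3; have D0 : 0 < (d%:R - 2 : R) by rewrite subr_gt0 ltr_nat.
rewrite /p_sharp /tau_plus ltr_pdivlMr //.
case=> [[/andP[mu1 mu0]]|[mu0]].
  rewrite lt_eqF // -ltrBlDl.
  have : Num.sqrt (1 + mu) < 1 by rewrite -[X in _ < X]sqrtr1 ltr_sqrt // gtrDl.
  set r := Num.sqrt _ => r1; rewrite ltr_pdivlMr; last first.
    by rewrite -mulNr mulr_gt0 ?subr_gt0 // -mulNr opprB divr_gt0.
  by clear; lra.
rewrite gt_eqF // -ltrBrDl.
have : 1 < Num.sqrt (1 + mu) by rewrite -[X in X < _]sqrtr1 ltr_sqrt ?ltrDl // addr_gt0.
set r := Num.sqrt _ => r1; rewrite ltr_ndivrMr; last first.
  by rewrite -mulNr pmulr_rlt0 ?subr_lt0 // -mulNr opprB divr_gt0.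
by clear; lra.
Qed.

Theorem theorem5p1 (R : realType) (d : nat) (mu theta : R)
    (Phi H0 W : lattice d -> R)
    (d_ge3 : (3 <= d)%N)
    (mu_ge : -1 <= mu)
    (Phi_fund : fundamental_solution Phi)
    (H0_bounds : forall x, 0 <= H0 x <= hardy_weight Phi x)
    (H0_limsup : exists2 eps0 : R, 0 < eps0 < 1 &
      (0 <= limf_esup
              (fun x : lattice d => ((hardy_weight Phi x - H0 x)
                          * euclid_norm R x `^ eps0 / hardy_weight Phi x)%:E)
              (at_infinity R d)
         < +oo)%E)
    (W_ge0 : forall x, 0 <= W x)
    (W_liminf : (0 < limf_einf
                       (fun x : lattice d => (W x * euclid_norm R x `^ (- theta))%:E)
                       (at_infinity R d))%E) :
  let w_infty :=
    limf_einf (fun x : lattice d => (W x / H0 x)%:E) (at_infinity R d) in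
  [/\ (* (i) *)
      mu = -1 ->
      tau_minus d mu - 2 < theta ->
      forall p : R, 0 < p <= p_star d mu theta ->
      ~ exists u : lattice d -> R, solution mu p H0 W u,
      (* (ii) *)
      -1 < mu < 0 ->
      forall p : R,
      [\/ (* (a) *) -2 < theta /\ 0 < p <= p_star d mu theta,
          (* (b) *) theta = -2 /\
            (0 < p < 1 \/ p = 1 /\ ((mu + 1)%:E < w_infty)%E) |
          (* (c) *) tau_plus d mu - 2 < theta < -2 /\
            0 < p < p_sharp d mu theta] ->
      ~ exists u : lattice d -> R, solution mu p H0 W u &
      (* (iii) *)
      0 <= mu ->
      forall p : R,
        (* (d) *) (-2 < theta /\
          Num.max 0 (p_sharp d mu theta) < p <= p_star d mu theta) \/
        (* (e) *) [/\ theta = -2, p = 1 & ((mu + 1)%:E < w_infty)%E] ->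
      ~ exists u : lattice d -> R, solution mu p H0 W u].
Proof.
move=> w_infty.
have d0 : (0 < d)%N by apply: leq_trans d_ge3.
have D0 : 0 < (d%:R - 2 : R) by rewrite subr_gt0 ltr_nat.
have H0lim : exists2 eps0 : R, 0 < eps0 < 1 &
    (limf_esup (fun x : lattice d => ((hardy_weight Phi x - H0 x)
      * euclid_norm R x `^ eps0 / hardy_weight Phi x)%:E) (at_infinity R d) < +oo)%E.
  by have [eps0 e01 /andP[_ h]] := H0_limsup; exists eps0.
have [s [gamma [C [S0 [A [e [c [S1 [reg [A0 e0 c0] hV hH hW]]]]]]]]] :=
  log_reduction d_ge3 Phi_fund H0_bounds H0lim W_liminf.
have muA : 0 <= `|mu| * A by rewrite mulr_ge0.
have H00 x : 0 <= H0 x by case/andP: (H0_bounds x).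
have mu0 : 0 <= 1 + mu by rewrite addrC -lerBlDr sub0r.
set E := (2 + theta) / (d%:R - 2) in hW.
set r := Num.sqrt (1 + mu).
have r0 : 0 <= r by exact: sqrtr_ge0.
have r2 : r ^+ 2 = 1 + mu by rewrite sqr_sqrtr.
have E_gt0 : -2 < theta -> 0 < E by move=> h; rewrite divr_gt0 //; move: h; clear; lra.
have linear u : ((mu + 1)%:E < w_infty)%E -> ~ solution mu 1 H0 W u.
  by move=> h; apply: (no_solution_linear d0 reg mu_ge A0 e0 hV hH H00 h).
have superlinear p u : 1 <= p -> p <= p_star d mu theta ->
    -2 < theta \/ mu = -1 -> ~ solution mu p H0 W u.
  move=> p1 ps cas sol; have p0 : 0 < p by apply: lt_le_trans p1.
  have u0 := solution_gt0 p0 sol.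
  have hu := solution_potential u0 hH hW sol.
  have alE := le_p_star d_ge3 ps; rewrite -/r -/E in alE.
  apply: (@no_superlinear R d s gamma C S0 u mu (`|mu| * A) e S1 c E p ((1 + r) / 2)) => //.
  - by move: r0; clear; lra.
  - by rewrite (_ : mu / 4 = (r ^+ 2 - 1) / 4); [field|rewrite r2 addrAC subrr add0r].
  - case: cas => [/E_gt0 E0|->]; last by constructor 3.
    have [p1'|] := ltP 1 p; first by constructor 2.
    by move=> p1'; constructor 1; rewrite (_ : p = 1) ?subrr ?mulr0 //; apply/le_anti/andP.
have sublinear p u : 0 < p < 1 -> (1 - p) * (r - 1) / 2 < E -> ~ solution mu p H0 W u.
  move=> p01 hE sol; have u0 := solution_gt0 (andP p01).1 sol.
  have hu := solution_potential u0 hH hW sol.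
  exact: (no_sublinear d0 reg u0 mu_ge muA e0 c0 p01 hE hu).
split.
- move=> mu1 _ p /andP[p0 ps] [u sol].
  have [p1|p1] := leP 1 p; first by apply: superlinear sol => //; right.
  have u0 := solution_gt0 p0 sol.
  have p01 : 0 < p < 1 by rewrite p0.
  have hu x : S1 < s x -> c * (expR (E * s x) * grad2 s x) * u x `^ p <=
      - lap u x + potential s (-1) (`|mu| * A) e x * u x.
    by move=> xS; have := solution_potential u0 hH hW sol xS; rewrite mu1.
  apply: (no_sublinear_critical d0 reg u0 muA e0 c0 p01 _ hu).
  (* With the square root equal to 0, [p <= p_star] reads [- (1 - p) / 2 <= E]. *)
  have := le_p_star d_ge3 ps; rewrite -/E mu1 subrr sqrtr0; clear; lra.
- move=> /andP[mu1 mun] p cas [u sol].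
  have r1 : r < 1 by rewrite -[X in _ < X]sqrtr1 ltr_sqrt // gtrDl.
  (* For [mu < 0] the left-hand side is negative, so [E >= 0] is enough. *)
  have sub0 : 0 < p < 1 -> 0 <= E -> (1 - p) * (r - 1) / 2 < E.
    move=> /andP[p0 p1] E0; apply: lt_le_trans E0.
    by rewrite pmulr_llt0 ?invr_gt0 // pmulr_rlt0 ?subr_gt0 // subr_lt0.
  case: cas => [[th /andP[p0 ps]]|[th cas]|[/andP[th1 th2] /andP[p0 ps]]].
  + have [p1|p1] := leP 1 p; first by apply: superlinear sol => //; left.
    by apply: sublinear sol; rewrite ?p0 ?sub0 // ?p0 // ltW // E_gt0.
  + case: cas => [p01|[p1 hw]]; last by apply: (linear u) => //; rewrite -p1.
    by apply: sublinear sol => //; apply: sub0 => //; rewrite /E th addrN mul0r.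
  + have ps1 : p_sharp d mu theta < 1.
      rewrite /p_sharp lt_eqF // gtrDl pmulr_llt0 ?invr_gt0.
        by move: th2; clear; lra.
      rewrite /tau_plus -/r -mulNr mulr_gt0 ?subr_gt0 // -mulNr opprB divr_gt0 //.
    apply: sublinear sol; first by rewrite p0 (lt_trans ps).
    by apply: p_sharp_cond => //; left; rewrite mu_ge mun.
- move=> mup p [[th /andP[]]|[th p1 hw] [u sol]]; last first.
    by apply: (linear u) => //; rewrite -p1.
  rewrite gt_max => /andP[p0 psh] ps [u sol].
  have [p1|p1] := leP 1 p; first by apply: superlinear sol => //; left.
  apply: sublinear sol; first by rewrite p0.
  move: mup; rewrite le_eqVlt => /predU1P[mu00|mup].
    (* At [mu = 0] the square root is 1 and the left-hand side vanishes, so [E > 0] is enough. *)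
    by rewrite /r -mu00 addr0 sqrtr1 subrr mulr0 mul0r E_gt0.
  by apply: p_sharp_cond => //; right.
Qed.
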